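(* Let $M$ be a closed smooth manifold of dimension $n \ge 3$ and let $g_0$ be a $C^2$-Riemannian metric on $M$. Let $u_i, u : M \to \mathbb{R}_{+}$ ($i = 1, 2, \dots$) be positive $C^2$-functions on $M$, and set $g_i := u_i^{\frac{4}{n-2}} g_0$ and $g := u^{\frac{4}{n-2}} g_0$. Assume: (a) there is a positive constant $C_0$ such that $C_0^{-1} \le u_i \le C_0$ on $M$ for all $i$; (b) $u_i \to u$ in $L^1(M, g_0)$, i.e., $\int_M |u_i - u|\, d\mathrm{vol}_{g_0} \to 0$ as $i \to \infty$; (c) there is a non-positive constant $\kappa \in \mathbb{R}$ such that $\int_M R(g_i)\, d\mathrm{vol}_{g_i} \le \kappa \le 0$ for all $i$ (in particular, this condition forces the Yamabe constant $Y(M, g_0)$ to be $\le 0$). Then $\int_M R(g)\, d\mathrm{vol}_g \le \kappa$.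
   Context: Closed means compact without boundary. For a $C^2$-Riemannian metric $h$ on $M$, $R(h)$ denotes its scalar curvature and $d\mathrm{vol}_h$ its Riemannian volume measure. The Yamabe constant of $g_0$ is $$Y(M, g_0) := \inf\left\{ \frac{\int_M R(h)\, d\mathrm{vol}_h}{\left(\int_M d\mathrm{vol}_h\right)^{\frac{n-2}{n}}} \ \middle|\ h = v^{\frac{4}{n-2}} g_0,\ v \in C^\infty(M),\ v > 0 \text{ on } M \right\}.$$ *)

(* Defs.v *)
From HB Require Import structures.
From mathcomp Require Import all_boot all_order all_algebra.
From mathcomp Require Import all_classical all_reals all_analysis.

Set Implicit Arguments.
Unset Strict Implicit.
Unset Printing Implicit Defensive.

Import Order.TTheory GRing.Theory Num.Theory.
Import numFieldNormedType.Exports.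

Local Open Scope classical_set_scope.
Local Open Scope ring_scope.

Definition partial (R : realType) (n : nat) (i : 'I_n) (f : 'rV[R]_n -> R)
    : 'rV[R]_n -> R :=
  'D_(delta_mx 0 i) f.

(* Meant for open U. *)
Fixpoint Ck_on (R : realType) (n k : nat) (U : set 'rV[R]_n)
    (f : 'rV[R]_n -> R) : Prop :=
  (forall x, U x -> {for x, continuous f}) /\
  match k with
  | 0%N => True
  | k'.+1 => forall i : 'I_n,
      (forall x, U x -> derivable f x (delta_mx 0 i)) /\
      Ck_on k' U (partial i f)
  end.

(* Lebesgue integral on R^n, as an iterated integral. It is only applied to
   nonnegative Borel functions, for which the two agree by Tonelli. *)
Fixpoint lebesgue_integral_rV (R : realType) (n : nat) :
    ('rV[R]_n -> \bar R) -> \bar R :=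
  match n with
  | 0%N => fun f => f 0
  | m.+1 => fun f => (\int[@lebesgue_measure R]_t
      lebesgue_integral_rV
        (fun x : 'rV[R]_m => f (row_mx (const_mx t : 'rV[R]_1) x)))%E
  end.

(* A homeomorphism from the open set [dom] onto an open subset of R^n. The
   values of [coord] and [param] outside [dom] and its image are junk. *)
Record chart (R : realType) (n : nat) (M : topologicalType) := Chart {
  dom : set M ;
  coord : M -> 'rV[R]_n ;
  param : 'rV[R]_n -> M ;
  dom_open : open dom ;
  img_open : open (coord @` dom) ;
  coordK : forall p, dom p -> param (coord p) = p ;
  coord_continuous : forall p, dom p -> {for p, continuous coord} ;
  param_continuous : forall x, (coord @` dom) x -> {for x, continuous param}
}.

Definition transition (R : realType) (n : nat) (M : topologicalType)
    (c d : chart R n M) : 'rV[R]_n -> 'rV[R]_n :=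
  coord d \o param c.

(* Charts take values in open subsets of R^n: there is no boundary. *)
Record smooth_atlas (R : realType) (n : nat) (M : topologicalType) := SmoothAtlas {
  charts : set (chart R n M) ;
  charts_cover : forall p, exists2 c, charts c & dom c p ;
  charts_compatible : forall c d, charts c -> charts d ->
    forall (k : nat) (j : 'I_n),
      Ck_on k (coord c @` (dom c `&` dom d)) (fun x => transition c d x 0 j)
}.

Definition chart_at (R : realType) (n : nat) (M : topologicalType)
    (A : smooth_atlas R n M) (p : M) : chart R n M :=
  sval (cid2 (charts_cover A p)).

Definition C2_function (R : realType) (n : nat) (M : topologicalType)
    (A : smooth_atlas R n M) (u : M -> R) : Prop :=
  forall c, charts A c -> Ck_on 2 (coord c @` dom c) (u \o param c).

(* A field of bilinear forms, given by its components: [g c p i j] is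
   g_p(d/dx_i, d/dx_j) in the chart [c], meaningful for [p] in [dom c]. *)
Definition tensor_field (R : realType) (n : nat) (M : topologicalType) : Type :=
  chart R n M -> M -> 'M[R]_n.

(* The Jacobian acts on row vectors, so the (i, j) entry of J is the i-th
   partial derivative of the j-th component of the transition map, and the last
   clause is the transformation law of covariant 2-tensors. *)
Record C2_metric (R : realType) (n : nat) (M : topologicalType)
    (A : smooth_atlas R n M) (g : tensor_field R n M) : Prop := C2Metric {
  metric_sym : forall c p, charts A c -> dom c p -> (g c p)^T = g c p ;
  metric_pos : forall c p, charts A c -> dom c p ->
    forall v : 'rV[R]_n, v != 0 -> 0 < (v *m g c p *m v^T) 0 0 ;
  metric_C2 : forall c, charts A c -> forall i j : 'I_n,
    Ck_on 2 (coord c @` dom c) (fun x => g c (param c x) i j) ;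
  metric_change : forall c d p, charts A c -> charts A d ->
    dom c p -> dom d p ->
    let J := jacobian (transition c d) (coord c p) in
    g c p = J *m g d p *m J^T
}.

(* The metric u^(4/(n-2)) g. *)
Definition conformal (R : realType) (n : nat) (M : topologicalType)
    (u : M -> R) (g : tensor_field R n M) : tensor_field R n M :=
  fun c p => (u p `^ (4 / (n%:R - 2))) *: g c p.

(* [christoffel G k i j] is the symbol with upper index k and lower indices
   i, j, for the coordinate expression G of a metric. *)
Definition christoffel (R : realType) (n : nat) (G : 'rV[R]_n -> 'M[R]_n)
    (k i j : 'I_n) (x : 'rV[R]_n) : R :=
  2^-1 * \sum_(l < n) invmx (G x) k l *
    (partial i (fun y => G y j l) x + partial j (fun y => G y i l) x
     - partial l (fun y => G y i j) x).

(* Sign convention: round spheres have positive curvature. *)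
Definition ricci (R : realType) (n : nat) (G : 'rV[R]_n -> 'M[R]_n)
    (i j : 'I_n) (x : 'rV[R]_n) : R :=
  \sum_(k < n) (partial k (christoffel G k i j) x
                - partial j (christoffel G k i k) x)
  + \sum_(k < n) \sum_(l < n)
      (christoffel G k k l x * christoffel G l i j x
       - christoffel G k j l x * christoffel G l i k x).

Definition local_scalar_curvature (R : realType) (n : nat)
    (G : 'rV[R]_n -> 'M[R]_n) (x : 'rV[R]_n) : R :=
  \sum_(i < n) \sum_(j < n) invmx (G x) i j * ricci G i j x.

(* For a C^2 metric the value does not depend on the chart around p. *)
Definition scalar_curvature (R : realType) (n : nat) (M : topologicalType)
    (A : smooth_atlas R n M) (g : tensor_field R n M) (p : M) : R :=
  let c := chart_at A p in
  local_scalar_curvature (fun x => g c (param c x)) (coord c p).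

Definition borel (M : ptopologicalType) := g_sigma_algebraType (@open M).

(* dvol = sqrt(det g_ij) dx_1 ... dx_n in every chart. *)
Definition is_riemannian_volume (R : realType) (n : nat) (M : ptopologicalType)
    (A : smooth_atlas R n M) (g : tensor_field R n M)
    (mu : {measure set (borel M) -> \bar R}) : Prop :=
  forall c (B : set (borel M)), charts A c -> measurable B -> B `<=` dom c ->
    mu B = lebesgue_integral_rV
      ((fun x => (Num.sqrt (\det (g c (param c x))))%:E) \_ (coord c @` B)).

(* For a C^2 metric on a compact (or just second countable) manifold there is
   exactly one Borel measure satisfying [is_riemannian_volume]. *)
Definition riemannian_volume (R : realType) (n : nat) (M : ptopologicalType)
    (A : smooth_atlas R n M) (g : tensor_field R n M)
    : {measure set (borel M) -> \bar R} :=
  if pselect (exists mu, is_riemannian_volume A g mu) is left e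
  then sval (cid e) else mzero.

(* Main.v *)
(* Write c = 4(n-1)/(n-2) and R, Delta, dV for the scalar curvature, the
   Laplacian and the volume of g0. For a positive C^2 function w the metric
   w^(4/(n-2)) g0 satisfies R(w^(4/(n-2)) g0) dvol = s(w) dV, where
   s(w) = R w^2 - c w Delta w. Up to divergences of C^1 vector fields,
     s(w) - s(u) = R (w^2 - u^2) - 2 c (w - u) Delta u + c |grad (w - u)|^2,
   in which the derivatives of w only occur in a nonnegative term. Integrating,
   int s(u) <= int s(w) + K int |w - u| with K depending only on sup |w| and on
   u, so that L^1 convergence and a uniform bound on w = u_i are enough.

   The divergences integrate to zero by a partition of unity and Fubini's
   theorem in charts; the conformal formula for R follows from a computation
   with connection matrices in a chart. *)
Require Import Defs.
From HB Require Import structures.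
From mathcomp Require Import all_boot all_order all_algebra.
From mathcomp Require Import all_classical all_reals all_analysis.
From mathcomp Require Import perm measurable_realfun ring lra.
(* Imported again because MathComp's coord would otherwise hide the projection
   of Defs. *)
Require Import Defs.

Set Implicit Arguments.
Unset Strict Implicit.
Unset Printing Implicit Defensive.

Import Order.TTheory GRing.Theory Num.Theory.
Import numFieldNormedType.Exports.

Local Open Scope classical_set_scope.
Local Open Scope ring_scope.

(** * Functions of class C^k on open subsets of R^n *)

(** No Riemannian volume is constructed on [M] from scratch. If [g0] has one, each conformal metric
    has one with an explicit density, and conversely; if not, all integrals in sight are 0.
    Uniqueness, proved from compactness, identifies the chosen measure with the explicit one. The
    Laplacian of a positive function on [M] is read off from the scalar curvatures of [g0] and of
    the rescaled metric. Its independence of charts and its continuity are thus inherited from the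
    scalar curvature, and the formula for the total curvature becomes algebra; the computation in
    charts identifies it with the coordinate Laplacian, to which the divergence theorem applies. The
    metric is only C^2, so Christoffel symbols are C^1 and curvature is continuous: identities are
    arranged so that a connection matrix is differentiated at most once. Green's identity for v and
    u asks only that v be C^1, so C^1 cut-off functions suffice. The iterated integral over R^n is
    realised by a measure, built by induction on n together with the vanishing of integrals of
    derivatives. *)

Section CkBasics.
Context {R : realType} {n : nat}.
Implicit Types (U V : set 'rV[R]_n) (f g : 'rV[R]_n -> R) (i : 'I_n).

Local Notation e i := (delta_mx 0 i : 'rV[R]_n).

Lemma Ck_cont k U f x : Ck_on k U f -> U x -> {for x, continuous f}.
Proof. by case: k => [|k] [h _]; exact: h. Qed.

Lemma Ck_derivable k U f i x : Ck_on k.+1 U f -> U x -> derivable f x (e i).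
Proof. by move=> [_ /(_ i)[h _]]; exact: h. Qed.

Arguments Ck_derivable {k U f} i {x}.

Lemma Ck_partial k U f i : Ck_on k.+1 U f -> Ck_on k U (partial i f).
Proof. by move=> [_ /(_ i)[]]. Qed.

Lemma Ck_intro k U f : (forall x, U x -> {for x, continuous f}) ->
  (forall i x, U x -> derivable f x (e i)) ->
  (forall i, Ck_on k U (partial i f)) -> Ck_on k.+1 U f.
Proof. by move=> h1 h2 h3; split=> // i; split=> // x; exact: h2. Qed.

Lemma Ck_pred k U f : Ck_on k.+1 U f -> Ck_on k U f.
Proof.
elim: k f => [|k IH] f hf; first by case: hf.
apply: Ck_intro; first by move=> x; exact: Ck_cont hf.
  by move=> i x; exact: Ck_derivable _ hf.
by move=> i; apply: IH; exact: Ck_partial.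
Qed.

Lemma Ck_le k l U f : (k <= l)%N -> Ck_on l U f -> Ck_on k U f.
Proof.
move=> /subnK <-; elim: (l - k)%N => // m IH; rewrite addSn => /Ck_pred; exact: IH.
Qed.

Lemma Ck_sub k U V f : V `<=` U -> Ck_on k U f -> Ck_on k V f.
Proof.
move=> VU; elim: k f => [|k IH] f hf.
  by split=> // x /VU; exact: Ck_cont hf.
apply: Ck_intro; first by move=> x /VU; exact: Ck_cont hf.
  by move=> i x /VU; exact: Ck_derivable _ hf.
by move=> i; apply: IH; exact: Ck_partial.
Qed.

Lemma open_near_eq (T : Type) U (f g : 'rV[R]_n -> T) x :
  open U -> U x -> {in U, f =1 g} -> \forall y \near x, f y = g y.
Proof.
move=> oU Ux fg; near=> y; apply: fg; rewrite inE; near: y.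
exact: open_nbhs_nbhs.
Unshelve. all: by end_near. Qed.

Lemma partial_near_eq f g i x :
  (\forall y \near x, f y = g y) -> partial i f x = partial i g x.
Proof. by move=> fg; rewrite /partial; exact: near_eq_derive. Qed.

Lemma near_eq_continuous (S T : topologicalType) (f g : S -> T) (x : S) :
  (\forall y \near x, f y = g y) -> {for x, continuous f} -> {for x, continuous g}.
Proof.
move=> fg; rewrite /prop_for /continuous_at -(nbhs_singleton fg) => fx.
by apply: cvg_trans fx; apply: near_eq_cvg; exact: filterS fg.
Qed.

Lemma Ck_eq k U f g : open U -> {in U, f =1 g} -> Ck_on k U f -> Ck_on k U g.
Proof.
move=> oU; elim: k f g => [|k IH] f g fg hf.
  by split=> // x Ux; apply: near_eq_continuous (open_near_eq oU Ux fg) (Ck_cont hf Ux).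
have cg : forall x, U x -> {for x, continuous g}.
  by move=> x Ux; apply: near_eq_continuous (open_near_eq oU Ux fg) (Ck_cont hf Ux).
apply: Ck_intro => //.
  move=> i x Ux; have nfg := open_near_eq oU Ux fg.
  exact: near_eq_derivable nfg (Ck_derivable i hf Ux).
move=> i; apply: IH (Ck_partial i hf) => x; rewrite inE => Ux.
exact: partial_near_eq (open_near_eq oU Ux fg).
Qed.

Lemma Ck_local k U f : open U ->
  (forall x, U x -> exists V, [/\ open V, V x & Ck_on k V f]) -> Ck_on k U f.
Proof.
move=> oU; elim: k f => [|k IH] f h.
  by split=> // x Ux; have [V [oV Vx]] := h x Ux; move=> /Ck_cont; exact.
apply: Ck_intro.
- by move=> x Ux; have [V [oV Vx]] := h x Ux; move=> /Ck_cont; exact.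
- by move=> i x Ux; have [V [oV Vx]] := h x Ux; move=> /(Ck_derivable i); exact.
- move=> i; apply: IH => x Ux; have [V [oV Vx hV]] := h x Ux.
  by exists V; split=> //; exact: Ck_partial.
Qed.

Lemma partial_cst (a : R) i x : partial i (fun=> a) x = 0.
Proof. exact: derive_cst. Qed.

Lemma partialD f g i x : derivable f x (e i) -> derivable g x (e i) ->
  partial i (fun y => f y + g y) x = partial i f x + partial i g x.
Proof. exact: deriveD. Qed.

Lemma partialN f i x : derivable f x (e i) ->
  partial i (fun y => - f y) x = - partial i f x.
Proof. exact: deriveN. Qed.

Lemma partialB f g i x : derivable f x (e i) -> derivable g x (e i) ->
  partial i (fun y => f y - g y) x = partial i f x - partial i g x.
Proof. exact: deriveB. Qed.

Lemma partialM f g i x : derivable f x (e i) -> derivable g x (e i) ->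
  partial i (fun y => f y * g y) x = partial i f x * g x + f x * partial i g x.
Proof.
by move=> df dg; rewrite /partial (deriveM df dg) addrC /GRing.scale/= mulrC.
Qed.

Lemma derivableMr f g i x : derivable f x (e i) -> derivable g x (e i) ->
  derivable (fun y => f y * g y) x (e i).
Proof. exact: derivableM. Qed.

Lemma fsumE (I : Type) (r : seq I) (F : I -> 'rV[R]_n -> R) :
  (fun y => \sum_(j <- r) F j y) = \sum_(j <- r) F j.
Proof. by apply/funext => y; elim/big_rec2 : _ => // j a b _ ->. Qed.

Lemma derivable_bigsum (I : Type) (r : seq I) (F : I -> 'rV[R]_n -> R) i x :
  (forall j, derivable (F j) x (e i)) ->
  derivable (fun y => \sum_(j <- r) F j y) x (e i).
Proof.
move=> h; rewrite fsumE; elim: r => [|a r IH].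
  by rewrite big_nil; exact: derivable_cst.
by rewrite big_cons; exact: derivableD (h a) IH.
Qed.

Lemma partial_sum (I : Type) (r : seq I) (F : I -> 'rV[R]_n -> R) i x :
  (forall j, derivable (F j) x (e i)) ->
  partial i (fun y => \sum_(j <- r) F j y) x = \sum_(j <- r) partial i (F j) x.
Proof.
move=> h; elim: r => [|a r IH].
  by rewrite big_nil fsumE big_nil; exact: derive_cst.
rewrite big_cons -IH -partialD//; last exact: derivable_bigsum.
by congr (partial i _ x); apply/funext => y; rewrite big_cons.
Qed.

Lemma Ck_cst k U (a : R) : Ck_on k U (fun=> a).
Proof.
elim: k a => [|k IH] a; first by split=> // x _; exact: cst_continuous.
apply: Ck_intro => [x _|i x _|i]; [exact: cst_continuous|exact: derivable_cst|].
rewrite (_ : partial i _ = fun=> 0); first exact: IH.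
by apply/funext => x; rewrite partial_cst.
Qed.

Lemma CkD k U f g : open U -> Ck_on k U f -> Ck_on k U g ->
  Ck_on k U (fun x => f x + g x).
Proof.
move=> oU; elim: k f g => [|k IH] f g hf hg.
  by split=> // x Ux; apply: continuousD; [exact: Ck_cont hf Ux|exact: Ck_cont hg Ux].
apply: Ck_intro => [x Ux|i x Ux|i].
- by apply: continuousD; [exact: Ck_cont hf Ux|exact: Ck_cont hg Ux].
- by apply: derivableD; [exact: Ck_derivable _ hf Ux|exact: Ck_derivable _ hg Ux].
- apply: (@Ck_eq k U (fun x => partial i f x + partial i g x)) => //.
    move=> x; rewrite inE => Ux; rewrite partialD//.
      exact: Ck_derivable _ hf Ux.
    exact: Ck_derivable _ hg Ux.
  by apply: IH; exact: Ck_partial.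
Qed.

Lemma CkM k U f g : open U -> Ck_on k U f -> Ck_on k U g ->
  Ck_on k U (fun x => f x * g x).
Proof.
move=> oU; elim: k f g => [|k IH] f g hf hg.
  by split=> // x Ux; apply: continuousM; [exact: Ck_cont hf Ux|exact: Ck_cont hg Ux].
apply: Ck_intro => [x Ux|i x Ux|i].
- by apply: continuousM; [exact: Ck_cont hf Ux|exact: Ck_cont hg Ux].
- by apply: derivableM; [exact: Ck_derivable _ hf Ux|exact: Ck_derivable _ hg Ux].
- apply: (@Ck_eq k U (fun x => partial i f x * g x + f x * partial i g x)) => //.
    move=> x; rewrite inE => Ux; rewrite partialM//.
      exact: Ck_derivable _ hf Ux.
    exact: Ck_derivable _ hg Ux.
  apply: CkD => //; apply: IH.
  + exact: Ck_partial.
  + exact: Ck_pred.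
  + exact: Ck_pred.
  + exact: Ck_partial.
Qed.

Lemma CkZ k U (a : R) f : open U -> Ck_on k U f -> Ck_on k U (fun x => a * f x).
Proof. by move=> oU hf; apply: CkM => //; exact: Ck_cst. Qed.

Lemma CkN k U f : open U -> Ck_on k U f -> Ck_on k U (fun x => - f x).
Proof.
move=> oU hf; apply: Ck_eq (CkZ (-1) oU hf) => // x _; exact: mulN1r.
Qed.

Lemma CkB k U f g : open U -> Ck_on k U f -> Ck_on k U g ->
  Ck_on k U (fun x => f x - g x).
Proof. by move=> oU hf hg; apply: CkD => //; exact: CkN. Qed.

Lemma Ck_sum k U (I : Type) (r : seq I) (F : I -> 'rV[R]_n -> R) : open U ->
  (forall j, Ck_on k U (F j)) -> Ck_on k U (fun x => \sum_(j <- r) F j x).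
Proof.
move=> oU h; elim: r => [|a r IH].
  by apply: Ck_eq (Ck_cst k U 0) => // x _; rewrite big_nil.
by apply: Ck_eq (CkD oU (h a) IH) => // x _; rewrite big_cons.
Qed.

Lemma Ck_prod k U (I : Type) (r : seq I) (F : I -> 'rV[R]_n -> R) : open U ->
  (forall j, Ck_on k U (F j)) -> Ck_on k U (fun x => \prod_(j <- r) F j x).
Proof.
move=> oU h; elim: r => [|a r IH].
  by apply: Ck_eq (Ck_cst k U 1) => // x _; rewrite big_nil.
by apply: Ck_eq (CkM oU (h a) IH) => // x _; rewrite big_cons.
Qed.

(** [f] is only derivable along the one direction [v], so there is no differential of [f] to compose
    with. On the line through [x] both functions depend on one real variable, where the usual chain
    rule applies. *)
Lemma is_derive_comp1 (h : R -> R) (dh : R) f x v :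
  is_derive (f x) 1 h dh -> derivable f x v ->
  is_derive x v (h \o f) (dh * 'D_v f x).
Proof.
move=> [dhf hdh] dfv.
pose f1 := fun t : R => f (t *: v + x).
have df1 : derivable f1 0 1 := (derivable1P f x v).1 dfv.
have f10 : f1 0 = f x by rewrite /f1 scale0r add0r.
have dh1 : derivable h (f1 0) 1 by rewrite f10; exact: dhf.
have D1 (g : 'rV[R]_n -> R) : 'D_v g x = derive1 (fun t : R => g (t *: v + x)) 0.
  rewrite derive1E /derive; congr (lim _).
  rewrite [X in X @ _ = _](_ : _ =
    fun h0 : R => h0^-1 *: (g ((h0%:A + 0) *: v + x) - g (0 *: v + x))) //.
  by apply/funext => t; rewrite addr0 scale0r add0r [_%:A]mulr1.
have dc : derivable (h \o f1) 0 1.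
  apply/derivable1_diffP; apply: differentiable_comp.
    exact: (derivable1_diffP _ _).1 df1.
  exact: (derivable1_diffP _ _).1 dh1.
apply: DeriveDef.
  exact: (derivable1P (h \o f) x v).2 dc.
rewrite D1 (D1 f) -[RHS]/(dh * derive1 f1 0) -[LHS]/(derive1 (h \o f1) 0).
by rewrite (derive1_comp df1 dh1) (derive1E h) f10 hdh.
Qed.

Lemma partial_comp1 (h : R -> R) (dh : R) f x i :
  is_derive (f x) 1 h dh -> derivable f x (e i) ->
  partial i (fun y => h (f y)) x = dh * partial i f x.
Proof. by move=> hd fd; have [_ <-] := is_derive_comp1 hd fd. Qed.

(** [h j] stands for the j-th derivative of [h 0]. With the whole sequence given, the induction step
    shifts it by one, since the partial derivatives of the composite contain [h 1] in place of
    [h 0]. *)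
Lemma Ck_comp1 k U (h : nat -> R -> R) f : open U ->
  (forall j x, (j < k)%N -> U x -> is_derive (f x) 1 (h j) (h j.+1 (f x))) ->
  (forall x, U x -> {for f x, continuous (h k)}) ->
  Ck_on k U f -> Ck_on k U (fun x => h 0%N (f x)).
Proof.
move=> oU; elim: k h => [|k IH] h hd hc hf.
  split=> // x Ux; apply: continuous_comp; first exact: Ck_cont hf Ux.
  exact: hc.
apply: Ck_intro.
- move=> x Ux; apply: continuous_comp; first exact: Ck_cont hf Ux.
  have [dh _] := hd 0%N x erefl Ux.
  by apply: differentiable_continuous; apply/derivable1_diffP.
- move=> i x Ux.
  by have [] := is_derive_comp1 (hd 0%N x erefl Ux) (Ck_derivable i hf Ux).
- move=> i; apply: (@Ck_eq k U (fun x => h 1%N (f x) * partial i f x)) => //.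
    move=> x; rewrite inE => Ux.
    by rewrite (partial_comp1 (hd 0%N x erefl Ux) (Ck_derivable i hf Ux)).
  apply: CkM => //; last exact: Ck_partial.
  apply: (IH (fun j => h j.+1)) => //; last exact: Ck_pred.
  by move=> j x jk Ux; apply: hd.
Qed.

Lemma Ck_powR k U f (a : R) : open U -> (forall x, U x -> 0 < f x) ->
  Ck_on k U f -> Ck_on k U (fun x => f x `^ a).
Proof.
move=> oU f0 hf.
(* The j-th derivative of t^a: a falling factorial of [a] times t^(a - j). *)
pose h (j : nat) (t : R) : R := (\prod_(l < j) (a - l%:R)) * t `^ (a - j%:R).
have hd j x : U x -> is_derive (f x) 1 (h j) (h j.+1 (f x)).
  move=> Ux; have := f0 _ Ux => fx0.
  rewrite /h big_ord_recr/= -mulrA -natr1 opprD addrA.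
  exact: (is_deriveZ (\prod_(l < j) (a - l%:R)) (is_derive1_powR (a - j%:R) fx0)).
apply: (@Ck_eq k U (fun x => h 0%N (f x))) => //.
  by move=> x _; rewrite /h big_ord0 mul1r subr0.
apply: Ck_comp1 => // x Ux.
have [dh _] := hd k x Ux.
by apply: differentiable_continuous; apply/derivable1_diffP.
Qed.

Lemma Ck_inv k U f : open U -> (forall x, U x -> 0 < f x) ->
  Ck_on k U f -> Ck_on k U (fun x => (f x)^-1).
Proof.
move=> oU f0 hf; apply: Ck_eq (Ck_powR (-1) oU f0 hf) => // x; rewrite inE => Ux.
by rewrite powR_inv1// ltW// f0.
Qed.

Lemma Ck_sqrt k U f : open U -> (forall x, U x -> 0 < f x) ->
  Ck_on k U f -> Ck_on k U (fun x => Num.sqrt (f x)).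
Proof.
move=> oU f0 hf; apply: Ck_eq (Ck_powR (2^-1) oU f0 hf) => // x; rewrite inE => Ux.
by rewrite powR12_sqrt// ltW// f0.
Qed.

End CkBasics.

Arguments Ck_derivable {R n k U f} i {x}.

(** With the partial derivatives as coefficients this linear form is the candidate for the
    differential in [C1_diff]. *)
Definition row_pairing (R : realType) (n : nat) (a : 'I_n -> R) (v : 'rV[R]_n) : R :=
  \sum_(i < n) v 0 i * a i.

Lemma row_pairing_is_linear (R : realType) (n : nat) (a : 'I_n -> R) :
  linear (row_pairing a).
Proof.
move=> k u v; rewrite /row_pairing /GRing.scale/= mulr_sumr -big_split/=.
by apply: eq_bigr => i _; rewrite !mxE mulrDl mulrA.
Qed.

HB.instance Definition _ (R : realType) (n : nat) (a : 'I_n -> R) :=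
  GRing.isLinear.Build R 'rV[R]_n R _ (row_pairing a) (row_pairing_is_linear a).

Lemma continuous_bigsum (R : realType) (T : topologicalType) (I : Type) (r : seq I)
    (F : I -> T -> R) (x : T) : (forall j, {for x, continuous (F j)}) ->
  {for x, continuous (fun y => \sum_(j <- r) F j y)}.
Proof.
move=> h; elim: r => [|a r IH].
  rewrite (_ : (fun y => _) = fun=> 0); first exact: cst_continuous.
  by apply/funext => y; rewrite big_nil.
rewrite (_ : (fun y => _) = fun y => F a y + \sum_(j <- r) F j y).
  exact: continuousD (h a) IH.
by apply/funext => y; rewrite big_cons.
Qed.

(** * Differentiability of C^1 functions and symmetry of second derivatives *)

Section C1.
Context {R : realType} {n : nat}.
Implicit Types (U V : set 'rV[R]_n) (f g : 'rV[R]_n -> R) (i j : 'I_n) (x y : 'rV[R]_n).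

Local Notation e i := (delta_mx 0 i : 'rV[R]_n).

Lemma rV_norm_le x (c : R) : 0 <= c -> (forall i, `|x 0 i| <= c) -> `|x| <= c.
Proof.
move=> c0 h; rewrite [leLHS]/Num.Def.normr/= mx_normrE; apply: bigmax_le => //= -[a b] _ /=.
by rewrite (ord1 a); exact: h.
Qed.

Lemma rV_norm_ge x i : `|x 0 i| <= `|x|.
Proof.
rewrite [leRHS]/Num.Def.normr/= mx_normrE.
exact: (le_bigmax _ (fun k : 'I_1 * 'I_n => `|x k.1 k.2|) (0, i)).
Qed.

Lemma norm_delta i : `|e i| <= 1.
Proof.
by apply: rV_norm_le => // j; rewrite mxE eqxx/=; case: eqP; rewrite ?normr1 ?normr0.
Qed.

Lemma derivable_translate f x v c :
  derivable f (x + c) v -> derivable (fun y => f (y + c)) x v.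
Proof.
rewrite /derivable => h; suff <- : (fun h : R => h^-1 *: (f (h *: v + (x + c)) - f (x + c))) =
  (fun h : R => h^-1 *: (f (h *: v + x + c) - f (x + c))) by exact: h.
by apply/funext => t; rewrite addrA.
Qed.

Lemma partial_translate f i x c :
  partial i (fun y => f (y + c)) x = partial i f (x + c).
Proof.
rewrite /partial /derive; congr (lim _).
rewrite (_ : (fun h : R => h^-1 *: (f (h *: e i + x + c) - f (x + c))) =
  (fun h : R => h^-1 *: (f (h *: e i + (x + c)) - f (x + c)))) //.
by apply/funext => t; rewrite addrA.
Qed.

Lemma is_derive_line f y v (s : R) : derivable f (y + s *: v) v ->
  is_derive s 1 (fun t : R => f (y + t *: v)) ('D_v f (y + s *: v)).
Proof.
move=> df.
have E : (fun h : R => h^-1 *: (f (y + (h *: 1 + s) *: v) - f (y + s *: v))) =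
    (fun h : R => h^-1 *: (f (h *: v + (y + s *: v)) - f (y + s *: v))).
  by apply/funext => h; rewrite [h *: 1]mulr1 scalerDl addrCA.
by apply: DeriveDef; rewrite /derivable /derive E.
Qed.

Lemma mean_value_line f y i (a : R) :
  (forall s : R, `|s| <= `|a| -> derivable f (y + s *: e i) (e i)) ->
  exists2 s : R, `|s| <= `|a| & f (y + a *: e i) - f y = a * partial i f (y + s *: e i).
Proof.
move=> df.
pose phi (t : R) := f (y + t *: e i); pose dphi (t : R) := partial i f (y + t *: e i).
have phi' (s : R) : `|s| <= `|a| -> is_derive s 1 phi (dphi s).
  by move=> /df /is_derive_line.
have phi0 : f y = phi 0 by rewrite /phi scale0r addr0.
have cphi (b c : R) : (forall t, t \in `[b, c] -> `|t| <= `|a|) ->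
    {within `[b, c], continuous phi}.
  move=> h; apply: derivable_within_continuous => t /h ta.
  by have [] := phi' t ta.
have [a0|a0|a0] := ltrgtP 0 a; last first.
- by exists 0; rewrite ?normr0// -a0 scale0r addr0 subrr mul0r.
- have [|||s + E] := @MVT R phi dphi a 0.
  + by [].
  + move=> t; rewrite in_itv/= => /andP[t0 ta]; apply: phi'.
    by rewrite !ltr0_norm// lerN2 ltW.
  + apply: cphi => t; rewrite in_itv/= => /andP[t0 ta].
    by rewrite ler0_norm// ltr0_norm// lerN2.
  rewrite in_itv/= => /andP[s0 sa]; exists s; first by rewrite !ltr0_norm// lerN2 ltW.
  by rewrite phi0 -/(phi a) -opprB E sub0r mulrN opprK mulrC.
- have [|||s + E] := @MVT R phi dphi 0 a.
  + by [].
  + move=> t; rewrite in_itv/= => /andP[t0 ta]; apply: phi'.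
    by rewrite !gtr0_norm// ltW.
  + apply: cphi => t; rewrite in_itv/= => /andP[t0 ta].
    by rewrite ger0_norm// gtr0_norm.
  rewrite in_itv/= => /andP[s0 sa]; exists s; first by rewrite !gtr0_norm// ltW.
  by rewrite phi0 -/(phi a) E subr0 mulrC.
Qed.

Lemma Ck0_near U f x (eps : R) : open U -> U x -> Ck_on 0 U f -> 0 < eps ->
  \forall y \near x, `|f y - f x| < eps.
Proof.
move=> oU Ux hf e0; have /cvgrPdist_lt/(_ _ e0) := Ck_cont hf Ux.
by apply: filterS => y; rewrite distrC.
Qed.

(** Going from [x] to [x + h] one coordinate at a time, each step is governed by the mean value
    theorem in one direction, and continuity of the partial derivatives replaces the intermediate
    point by [x]. *)
Lemma C1_increment U f x (eps : R) : open U -> Ck_on 1 U f -> U x -> 0 < eps ->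
  \forall h \near (0 : 'rV[R]_n),
    `|f (x + h) - f x - row_pairing (fun i => partial i f x) h| <= eps * `|h|.
Proof.
move=> oU hf Ux eps0.
(* Each of the [n] steps may cost eps / (n + 1) times the norm of [h]; the successor in the
   denominator covers n = 0. *)
have eps'0 : 0 < eps / n.+1%:R by rewrite divr_gt0.
have nU : \forall y \near x, U y by exact: open_nbhs_nbhs.
have nP : \forall y \near x, forall i, `|partial i f y - partial i f x| < eps / n.+1%:R.
  have H i := Ck0_near oU Ux (Ck_partial i hf) eps'0.
  exact: filter_forall H.
have [d /= d0 hd] := (nbhs_ballP _ _).1 (filterI nU nP).
have {}hd y : `|y - x| < d -> U y /\ forall i, `|partial i f y - partial i f x| < eps / n.+1%:R.
  by move=> yd; apply: hd; rewrite -ball_normE/= distrC.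
apply/nbhs_ballP; exists d => //= h; rewrite -ball_normE/= sub0r normrN => hd'.
(* [p k] has already received the first [k] coordinates of [h]. In the maximum norm the whole path
   stays within [|h|] of [x]. *)
pose p (k : nat) : 'rV[R]_n := x + \row_i (if (i < k)%N then h 0 i else 0).
have p0 : p 0%N = x.
  by rewrite /p -[RHS]addr0; congr (_ + _); apply/rowP => i; rewrite !mxE.
have pn : p n = x + h.
  by congr (_ + _); apply/rowP => i; rewrite !mxE ltn_ord.
have pS (i : 'I_n) : p i.+1 = p i + h 0 i *: e i.
  rewrite /p -addrA; congr (_ + _); apply/rowP => k; rewrite !mxE eqxx/= ltnS leq_eqVlt.
  case: eqP => [/val_inj ->|ki]; first by rewrite eqxx ltnn mulr1 add0r.
  by case: eqP => [ki'|_]; [rewrite ki' in ki|rewrite mulr0 addr0].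
have step (i : 'I_n) : `|f (p i.+1) - f (p i) - h 0 i * partial i f x| <= eps / n.+1%:R * `|h|.
  have near (s : R) : `|s| <= `|h 0 i| -> `|p i + s *: e i - x| < d.
    move=> sh; apply: le_lt_trans hd'; apply: rV_norm_le => // k.
    rewrite /p addrAC [x + _]addrC addrK !mxE eqxx/=.
    have [->|ki] := eqVneq k i.
      by rewrite ltnn add0r mulr1; exact: le_trans sh (rV_norm_ge _ _).
    by rewrite mulr0 addr0; case: ifP => _; [exact: rV_norm_ge|rewrite normr0].
  have df (s : R) : `|s| <= `|h 0 i| -> derivable f (p i + s *: e i) (e i).
    by move=> sh; exact: (Ck_derivable i hf (hd _ (near s sh)).1).
  rewrite pS; have [s sh ->] := mean_value_line df.
  rewrite -mulrBr normrM mulrC; apply: ler_pM => //; last exact: rV_norm_ge.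
  by apply: ltW; exact: (hd _ (near s sh)).2.
have -> : f (x + h) - f x - row_pairing (fun i => partial i f x) h =
    \sum_(i < n) (f (p i.+1) - f (p i) - h 0 i * partial i f x).
  rewrite big_split/= sumrN; congr (_ - _).
  rewrite -pn -[in f x]p0.
  by rewrite -(big_mkord xpredT (fun k => f (p k.+1) - f (p k))) telescope_sumr.
apply: le_trans (ler_norm_sum _ _ _) _.
apply: le_trans (ler_sum _ (fun i _ => step i)) _.
rewrite sumr_const card_ord -[leLHS]mulr_natr mulrAC ler_wpM2r//.
by rewrite mulrAC -mulrA ler_piMr ?(ltW eps0)// ler_pdivrMr// mul1r ler_nat.
Qed.

Lemma C1_diff U f x : open U -> Ck_on 1 U f -> U x ->
  differentiable f x /\ 'd f x = row_pairing (fun i => partial i f x) :> (_ -> _).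
Proof.
move=> oU hf Ux; set L := row_pairing _.
have cL : continuous L.
  move=> v; apply: continuous_bigsum => i.
  by apply: continuousM; [exact: matrix_normedtype.coord_continuous|exact: cst_continuous].
(* The differential is a chosen linear map: uniqueness first identifies it with [L], and only then
   can the criterion for differentiability be checked. *)
have [dE diffE] : 'd f x = L :> (_ -> _) /\ differentiable f x.
  have /= uniq := @diff_unique _ _ _ f L x cL.
  have crit := diff_locallyP x f.
  have o : f \o shift x = cst (f x) + L +o_ (0 : 'rV[R]_n) id.
    apply/eqaddoP => eps eps0; have := C1_increment oU hf Ux eps0.
    apply: filterS => h hh.
    rewrite -[X in `|X| <= _]/(f (h + x) - (f x + L h)) opprD addrA [h + x]addrC.
    exact: hh.
  have dE := uniq o; split=> //; apply/crit; rewrite dE; split; [exact: cL|exact: o].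
by split.
Qed.

(** The mixed difference is the increment along [e i] of the function f(y + a e_j) - f(y). One
    application of the mean value theorem in each direction produces the mixed derivative at a
    nearby point. *)
Lemma second_difference U f x i j (a d : R) : Ck_on 2 U f ->
  (forall y, `|y - x| < d -> U y) -> 0 < a -> a + a < d ->
  exists z, `|z - x| < d /\
    f (x + a *: e i + a *: e j) - f (x + a *: e i) - (f (x + a *: e j) - f x) =
    a * (a * partial j (partial i f) z).
Proof.
move=> hf xU a0 ad.
have near (s t : R) : `|s| <= `|a| -> `|t| <= `|a| -> `|x + s *: e i + t *: e j - x| < d.
  move=> sa ta; apply: le_lt_trans ad; rewrite -[X in X - x]addrA [x + _]addrC addrK.
  apply: le_trans (ler_normD _ _) _; rewrite !normrZ -(gtr0_norm a0).
  by apply: lerD; rewrite -[leRHS]mulr1; apply: ler_pM => //; exact: norm_delta.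
have a0' : `|(0 : R)| <= `|a| by rewrite normr0.
have Ua (s t : R) : `|s| <= `|a| -> `|t| <= `|a| -> U (x + s *: e i + t *: e j).
  by move=> *; apply: xU; exact: near.
have Us (s : R) : `|s| <= `|a| -> U (x + s *: e i).
  by move=> sa; have := Ua s 0 sa a0'; rewrite scale0r addr0.
pose g y := f (y + a *: e j) - f y.
have dg (s : R) : `|s| <= `|a| -> derivable g (x + s *: e i) (e i).
  move=> sa; apply: derivableB; last exact: (Ck_derivable i (Ck_pred hf) (Us _ sa)).
  by apply: derivable_translate; exact: (Ck_derivable i (Ck_pred hf) (Ua _ _ sa (lexx _))).
have [s sa Es] := mean_value_line dg.
have dif (t : R) : `|t| <= `|a| -> derivable (partial i f) (x + s *: e i + t *: e j) (e j).
  by move=> ta; exact: (Ck_derivable j (Ck_partial i hf) (Ua _ _ sa ta)).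
have [t ta Et] := mean_value_line dif.
exists (x + s *: e i + t *: e j); split; first exact: near.
rewrite -Et -[LHS]/(g (x + a *: e i) - g x) Es; congr (_ * _).
rewrite partialB ?partial_translate//.
  by apply: derivable_translate; exact: (Ck_derivable i (Ck_pred hf) (Ua _ _ sa (lexx _))).
exact: (Ck_derivable i (Ck_pred hf) (Us _ sa)).
Qed.

Let swapB (A B C D : R) : A - B - (C - D) = A - C - (B - D).
Proof. by ring. Qed.

Let close2 (p q b c eps : R) : c = b -> `|b - p| <= eps / 2 -> `|c - q| <= eps / 2 ->
  `|p - q| <= eps.
Proof.
move=> -> h1 h2; rewrite (_ : p - q = (b - q) - (b - p)); last by ring.
by apply: le_trans (ler_normB _ _) _; rewrite [leRHS]splitr lerD.
Qed.

(** Schwarz's theorem: the mixed difference is symmetric in [i] and [j], so the two mixed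
    derivatives agree at two points close to [x], and continuity moves both points to [x]. *)
Lemma partialC U f x i j : open U -> Ck_on 2 U f -> U x ->
  partial i (partial j f) x = partial j (partial i f) x.
Proof.
move=> oU hf Ux; apply/eqP; rewrite -subr_eq0 -normr_le0; apply/ler_addgt0Pr => eps eps0.
rewrite add0r.
have nU : \forall y \near x, U y by exact: open_nbhs_nbhs.
have e2 : 0 < eps / 2 by rewrite divr_gt0.
have n1 k l : \forall y \near x, `|partial k (partial l f) y - partial k (partial l f) x| < eps / 2.
  exact: (Ck0_near oU Ux (Ck_partial k (Ck_partial l hf)) e2).
have [d /= d0 hd] := (nbhs_ballP _ _).1 (filterI nU (filterI (n1 i j) (n1 j i))).
have {}hd y : `|y - x| < d -> U y /\
    `|partial i (partial j f) y - partial i (partial j f) x| < eps / 2 /\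
    `|partial j (partial i f) y - partial j (partial i f) x| < eps / 2.
  by move=> yd; apply: hd; rewrite -ball_normE/= distrC.
have xU y : `|y - x| < d -> U y by move=> /hd[].
pose a := d / 3.
have a0 : 0 < a by rewrite divr_gt0.
have ad : a + a < d.
  by rewrite -mulr2n -mulr_natr /a -mulrA gtr_pMr// mulrC ltr_pdivrMr// mul1r ltr_nat.
have [z [zd Ez]] := second_difference i j hf xU a0 ad.
have [w [wd Ew]] := second_difference j i hf xU a0 ad.
have Exx : x + a *: e j + a *: e i = x + a *: e i + a *: e j := addrAC _ _ _.
rewrite {}Exx in Ew.
have E : partial j (partial i f) z = partial i (partial j f) w.
  apply: (mulfI (lt0r_neq0 a0)); apply: (mulfI (lt0r_neq0 a0)).
  exact: etrans (esym Ez) (etrans (swapB _ _ _ _) Ew).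
have [_ [h1 _]] := hd _ wd; have [_ [_ h2]] := hd _ zd.
exact: close2 E (ltW h1) (ltW h2).
Qed.

End C1.

(** * Chain rule for C^k maps *)

Section ChainRule.
Context {R : realType} {n : nat}.
Implicit Types (U V : set 'rV[R]_n) (f g : 'rV[R]_n -> R) (i j : 'I_n) (x y : 'rV[R]_n).
Implicit Type phi : 'rV[R]_n -> 'rV[R]_n.

Local Notation e i := (delta_mx 0 i : 'rV[R]_n).

Lemma C1_map_diff U phi x : open U -> U x ->
  (forall j, Ck_on 1 U (fun y => phi y 0 j)) -> differentiable phi x.
Proof.
move=> oU Ux hphi.
have -> : phi = \sum_(j < n) (fun y => phi y 0 j *: e j).
  apply/funext => y; rewrite [LHS]row_sum_delta fct_sumE.
  exact: erefl.
apply: differentiable_sum => j; apply: differentiableZl.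
exact: (C1_diff oU (hphi j) Ux).1.
Qed.

Lemma jacobianE U phi x i j : open U -> U x ->
  (forall j, Ck_on 1 U (fun y => phi y 0 j)) ->
  jacobian phi x i j = partial i (fun y => phi y 0 j) x.
Proof.
move=> oU Ux hphi; have dphi := C1_map_diff oU Ux hphi.
have := @deriveEjacobian _ _ _ _ _ (e i) dphi.
rewrite (derive_mx (@diff_derivable _ _ _ _ _ (e i) dphi)) -rowE => /rowP/(_ j).
by rewrite !mxE => <-.
Qed.

Lemma partial_comp U V phi f x i : open U -> open V -> U x -> V (phi x) ->
  (forall j, Ck_on 1 U (fun y => phi y 0 j)) -> Ck_on 1 V f ->
  derivable (f \o phi) x (e i) /\
  partial i (f \o phi) x = \sum_(a < n) jacobian phi x i a * partial a f (phi x).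
Proof.
move=> oU oV Ux Vx hphi hf; have dphi := C1_map_diff oU Ux hphi.
have [df dfE] := C1_diff oV hf Vx.
have dc : differentiable (f \o phi) x by exact: differentiable_comp.
split; first exact: diff_derivable.
rewrite /partial (deriveE _ dc) (diff_comp dphi df) /= -(deriveE _ dphi).
rewrite dfE (deriveEjacobian _ dphi) -rowE.
by apply: eq_bigr => a _; rewrite mxE.
Qed.

Lemma Ck_comp k U V phi f : open U -> open V -> (forall x, U x -> V (phi x)) ->
  (forall x, U x -> {for x, continuous phi}) ->
  (forall j, Ck_on k U (fun y => phi y 0 j)) -> Ck_on k V f ->
  Ck_on k U (f \o phi).
Proof.
move=> oU oV UV cphi; elim: k f => [|k IH] f hphi hf.
  by split=> // x Ux; apply: continuous_comp; [exact: cphi|exact: Ck_cont hf (UV _ Ux)].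
have hphi1 j : Ck_on 1 U (fun y => phi y 0 j) by exact: Ck_le (hphi j).
have hf1 : Ck_on 1 V f by exact: Ck_le hf.
apply: Ck_intro.
- by move=> x Ux; apply: continuous_comp; [exact: cphi|exact: Ck_cont hf (UV _ Ux)].
- by move=> i x Ux; have [] := partial_comp i oU oV Ux (UV _ Ux) hphi1 hf1.
- move=> i; apply: (@Ck_eq _ _ k U
    (fun x => \sum_(a < n) partial i (fun y => phi y 0 a) x * (partial a f \o phi) x)) => //.
    move=> x; rewrite inE => Ux.
    have [_ ->] := partial_comp i oU oV Ux (UV _ Ux) hphi1 hf1.
    by apply: eq_bigr => a _; rewrite (jacobianE i a oU Ux hphi1).
  apply: Ck_sum => // a; apply: CkM => //; first exact: Ck_partial.
  by apply: IH => [j|]; [exact: Ck_pred|exact: Ck_partial].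
Qed.

End ChainRule.

(** * Matrix-valued functions *)

HB.lock Definition partial_mx (R : realType) (n p q : nat) (i : 'I_n)
    (X : 'rV[R]_n -> 'M[R]_(p, q)) (x : 'rV[R]_n) : 'M[R]_(p, q) :=
  \matrix_(a, b) partial i (fun y => X y a b) x.

Lemma partial_mxE (R : realType) (n p q : nat) (i : 'I_n)
    (X : 'rV[R]_n -> 'M[R]_(p, q)) (x : 'rV[R]_n) a b :
  partial_mx i X x a b = partial i (fun y => X y a b) x.
Proof. by rewrite partial_mx.unlock mxE. Qed.

Definition Ck_mx (R : realType) (n p q k : nat) (U : set 'rV[R]_n)
    (X : 'rV[R]_n -> 'M[R]_(p, q)) : Prop :=
  forall a b, Ck_on k U (fun y => X y a b).

Section MatrixCalculus.
Context {R : realType} {n : nat}.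
Implicit Types (U : set 'rV[R]_n) (i : 'I_n) (x : 'rV[R]_n).

Local Notation e i := (delta_mx 0 i : 'rV[R]_n).

Lemma Ck_mx_le k l U p q (X : 'rV[R]_n -> 'M[R]_(p, q)) : (k <= l)%N ->
  Ck_mx l U X -> Ck_mx k U X.
Proof. by move=> kl hX a b; exact: Ck_le kl (hX a b). Qed.

Lemma Ck_mx_eq k U p q (X Y : 'rV[R]_n -> 'M[R]_(p, q)) : open U ->
  {in U, X =1 Y} -> Ck_mx k U X -> Ck_mx k U Y.
Proof. by move=> oU XY hX a b; apply: Ck_eq (hX a b) => // y yU; rewrite XY. Qed.

Lemma Ck_mx_tr k U p q (X : 'rV[R]_n -> 'M[R]_(p, q)) :
  Ck_mx k U X -> Ck_mx k U (fun y => (X y)^T).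
Proof.
move=> hX a b; rewrite (_ : (fun y => _) = fun y => X y b a); first exact: hX.
by apply/funext => y; rewrite mxE.
Qed.

Lemma Ck_mx_add k U p q (X Y : 'rV[R]_n -> 'M[R]_(p, q)) : open U ->
  Ck_mx k U X -> Ck_mx k U Y -> Ck_mx k U (fun y => X y + Y y).
Proof.
move=> oU hX hY a b; apply: (Ck_eq oU) (CkD oU (hX a b) (hY a b)) => y _.
by rewrite mxE.
Qed.

Lemma Ck_mx_mul k U p q r (X : 'rV[R]_n -> 'M[R]_(p, q)) (Y : 'rV[R]_n -> 'M[R]_(q, r)) :
  open U -> Ck_mx k U X -> Ck_mx k U Y -> Ck_mx k U (fun y => X y *m Y y).
Proof.
move=> oU hX hY a b.
apply: (@Ck_eq _ _ k U (fun y => \sum_c X y a c * Y y c b)) => //.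
  by move=> y _; rewrite mxE.
by apply: Ck_sum => // c; exact: CkM.
Qed.

Lemma Ck_mx_scale k U p q (f : 'rV[R]_n -> R) (X : 'rV[R]_n -> 'M[R]_(p, q)) : open U ->
  Ck_on k U f -> Ck_mx k U X -> Ck_mx k U (fun y => f y *: X y).
Proof.
move=> oU hf hX a b; apply: (Ck_eq oU) (CkM oU hf (hX a b)) => y _.
by rewrite mxE.
Qed.

Lemma Ck_mx_sum k U p q (I : Type) (r : seq I) (X : I -> 'rV[R]_n -> 'M[R]_(p, q)) :
  open U -> (forall c, Ck_mx k U (X c)) -> Ck_mx k U (fun y => \sum_(c <- r) X c y).
Proof.
move=> oU hX a b; apply: (@Ck_eq _ _ k U (fun y => \sum_(c <- r) X c y a b)) => //.
  by move=> y _; rewrite summxE.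
by apply: Ck_sum => // c; exact: hX.
Qed.

Lemma Ck_mx_partial k U p q i (X : 'rV[R]_n -> 'M[R]_(p, q)) :
  Ck_mx k.+1 U X -> Ck_mx k U (partial_mx i X).
Proof.
move=> hX a b; rewrite (_ : (fun y => _) = partial i (fun y => X y a b)).
  exact: Ck_partial.
by apply/funext => y; rewrite partial_mxE.
Qed.

Lemma Ck_det k U p (X : 'rV[R]_n -> 'M[R]_p) : open U ->
  Ck_mx k U X -> Ck_on k U (fun y => \det (X y)).
Proof.
move=> oU hX; apply: Ck_sum => // s; apply: CkZ => //.
by apply: Ck_prod => // i; exact: hX.
Qed.

(** Cramer's rule: the entries are cofactors divided by the determinant. Positivity of the
    determinant is what [Ck_inv], obtained from real powers, asks for. *)
Lemma Ck_mx_inv k U p (X : 'rV[R]_n -> 'M[R]_p) : open U ->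
  (forall y, U y -> 0 < \det (X y)) ->
  Ck_mx k U X -> Ck_mx k U (fun y => invmx (X y)).
Proof.
move=> oU hdet hX a b.
apply: (@Ck_eq _ _ k U (fun y => (\det (X y))^-1 * ((-1) ^+ (b + a) *
    \det (row' b (col' a (X y)))))) => //.
  move=> y; rewrite inE => Uy; rewrite /invmx unitmxE unitfE gt_eqF ?hdet//.
  by rewrite !mxE.
apply: CkM => //; first by apply: Ck_inv => //; exact: Ck_det.
apply: CkZ => //; apply: Ck_det => // c d.
rewrite (_ : (fun y => _) = fun y => X y (lift b c) (lift a d)); first exact: hX.
by apply/funext => y; rewrite !mxE.
Qed.

Section AtPoint.
Variables (U : set 'rV[R]_n) (i : 'I_n) (x : 'rV[R]_n).
Hypotheses (oU : open U) (Ux : U x).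

Lemma partial_mx_eq p q (X Y : 'rV[R]_n -> 'M[R]_(p, q)) : {in U, X =1 Y} ->
  partial_mx i X x = partial_mx i Y x.
Proof.
move=> XY; apply/matrixP => a b; rewrite !(mxE, partial_mxE); apply: partial_near_eq.
by apply: (open_near_eq oU Ux) => y yU; rewrite XY.
Qed.

Lemma partial_mx_cst p q (X : 'M[R]_(p, q)) : partial_mx i (fun=> X) x = 0.
Proof. by apply/matrixP => a b; rewrite !(mxE, partial_mxE) partial_cst. Qed.

Lemma partial_mx_tr p q (X : 'rV[R]_n -> 'M[R]_(p, q)) :
  partial_mx i (fun y => (X y)^T) x = (partial_mx i X x)^T.
Proof.
apply/matrixP => a b; rewrite !(mxE, partial_mxE); congr (partial i _ x).
by apply/funext => y; rewrite mxE.
Qed.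

Lemma partial_mxD p q (X Y : 'rV[R]_n -> 'M[R]_(p, q)) : Ck_mx 1 U X -> Ck_mx 1 U Y ->
  partial_mx i (fun y => X y + Y y) x = partial_mx i X x + partial_mx i Y x.
Proof.
move=> hX hY; apply/matrixP => a b; rewrite !(mxE, partial_mxE).
rewrite -(partialD (Ck_derivable i (hX a b) Ux) (Ck_derivable i (hY a b) Ux)).
by congr (partial i _ x); apply/funext => y; rewrite mxE.
Qed.

Lemma partial_mxM p q r (X : 'rV[R]_n -> 'M[R]_(p, q)) (Y : 'rV[R]_n -> 'M[R]_(q, r)) :
  Ck_mx 1 U X -> Ck_mx 1 U Y ->
  partial_mx i (fun y => X y *m Y y) x = partial_mx i X x *m Y x + X x *m partial_mx i Y x.
Proof.
move=> hX hY; apply/matrixP => a b; rewrite !(mxE, partial_mxE).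
have dX c := Ck_derivable i (hX a c) Ux.
have dY c := Ck_derivable i (hY c b) Ux.
rewrite (_ : (fun y => _) = fun y => \sum_c X y a c * Y y c b); last first.
  by apply/funext => y; rewrite mxE.
rewrite (partial_sum _ (fun c => derivableMr (dX c) (dY c))).
rewrite -big_split/=; apply: eq_bigr => c _.
by rewrite (partialM (dX c) (dY c)) !(mxE, partial_mxE).
Qed.

Lemma partial_mxZ p q (f : 'rV[R]_n -> R) (X : 'rV[R]_n -> 'M[R]_(p, q)) :
  Ck_on 1 U f -> Ck_mx 1 U X ->
  partial_mx i (fun y => f y *: X y) x = partial i f x *: X x + f x *: partial_mx i X x.
Proof.
move=> hf hX; apply/matrixP => a b; rewrite !(mxE, partial_mxE).
rewrite -(partialM (Ck_derivable i hf Ux) (Ck_derivable i (hX a b) Ux)).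
by congr (partial i _ x); apply/funext => y; rewrite mxE.
Qed.

Lemma partial_mx_sum p q (I : Type) (r : seq I) (X : I -> 'rV[R]_n -> 'M[R]_(p, q)) :
  (forall c, Ck_mx 1 U (X c)) ->
  partial_mx i (fun y => \sum_(c <- r) X c y) x = \sum_(c <- r) partial_mx i (X c) x.
Proof.
move=> hX; apply/matrixP => a b; rewrite partial_mxE summxE.
rewrite (_ : (fun y => _) = fun y => \sum_(c <- r) X c y a b); last first.
  by apply/funext => y; rewrite summxE.
rewrite (partial_sum r (fun c => Ck_derivable i (hX c a b) Ux)).
by apply: eq_bigr => c _; rewrite partial_mxE.
Qed.

(** Differentiate X^-1 X = 1. *)
Lemma partial_mx_inv p (X : 'rV[R]_n -> 'M[R]_p) : (forall y, U y -> 0 < \det (X y)) ->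
  Ck_mx 1 U X ->
  partial_mx i (fun y => invmx (X y)) x =
  - (invmx (X x) *m partial_mx i X x *m invmx (X x)).
Proof.
move=> hdet hX.
have uX y : U y -> X y \in unitmx by move=> /hdet d0; rewrite unitmxE unitfE gt_eqF.
have hI := Ck_mx_inv oU hdet hX.
have : partial_mx i (fun y => invmx (X y) *m X y) x = 0.
  rewrite -(partial_mx_cst (1%:M : 'M[R]_p)); apply: partial_mx_eq => y; rewrite inE => Uy.
  by rewrite mulVmx// uX.
rewrite partial_mxM// => /eqP; rewrite addr_eq0 => /eqP E.
by rewrite -[LHS](mulmxK (uX _ Ux)) E mulNmx.
Qed.

Lemma partial_prod (I : eqType) (r : seq I) (F : I -> 'rV[R]_n -> R) : uniq r ->
  (forall j, Ck_on 1 U (F j)) ->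
  partial i (fun y => \prod_(j <- r) F j y) x =
  \sum_(j <- r) partial i (F j) x * \prod_(k <- r | k != j) F k x.
Proof.
move=> + hF; elim: r => [_|a r IH /= /andP[ar ur]].
  by rewrite big_nil (_ : (fun y => _) = fun=> 1) ?partial_cst//;
    apply/funext => y; rewrite big_nil.
rewrite (_ : (fun y => _) = fun y => F a y * \prod_(j <- r) F j y); last first.
  by apply/funext => y; rewrite big_cons.
rewrite (partialM (Ck_derivable i (hF a) Ux) (Ck_derivable i (Ck_prod r oU hF) Ux)).
rewrite IH// !big_cons eqxx/=; congr (_ * _ + _).
  rewrite big_seq_cond [RHS]big_seq_cond; apply: eq_bigl => j.
  by case: (boolP (j \in r)) => //= jr; apply/esym; apply: contraNneq ar => <-.
rewrite mulr_sumr [LHS]big_seq [RHS]big_seq; apply: eq_bigr => j jr.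
have aj : a != j by apply: contraNneq ar => ->.
rewrite big_cons aj; exact: mulrCA.
Qed.

(** Jacobi's formula. By multilinearity the derivative is the sum over the rows of the determinants
    in which that row is differentiated ([M a]); expanding each along its row produces the
    cofactors. *)
Lemma partial_det p (X : 'rV[R]_n -> 'M[R]_p) : Ck_mx 1 U X ->
  partial i (fun y => \det (X y)) x = \tr (partial_mx i X x *m \adj (X x)).
Proof.
move=> hX.
pose M (a : 'I_p) : 'M[R]_p :=
  \matrix_(b, c) (if b == a then partial_mx i X x b c else X x b c).
transitivity (\sum_a \det (M a)).
  rewrite /determinant partial_sum; last first.
    move=> s; apply: (Ck_derivable i (k := 0) (U := U)) => //.
    by apply: CkZ => //; apply: Ck_prod => // c; exact: hX.
  rewrite exchange_big/=; apply: eq_bigr => s _.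
  have hP : Ck_on 1 U (fun y => \prod_c X y c (s c)).
    by apply: Ck_prod => // c; exact: hX.
  rewrite (partialM (derivable_cst _ _ _) (Ck_derivable i hP Ux)).
  rewrite partial_cst mul0r add0r -mulr_sumr; congr (_ * _).
  rewrite partial_prod//; last exact: index_enum_uniq.
  apply: eq_bigr => a _; rewrite [RHS](bigD1 a)//= !(mxE, partial_mxE) eqxx; congr (_ * _).
  by apply: eq_bigr => c /negPf ca; rewrite mxE ca.
rewrite /mxtrace; apply: eq_bigr => a _; rewrite (expand_det_row _ a) mxE.
apply: eq_bigr => c _; rewrite !(mxE, partial_mxE) eqxx; congr (_ * _).
rewrite /cofactor; congr (_ * \det _); apply/matrixP => b d; rewrite !(mxE, partial_mxE).
by rewrite eq_sym (negPf (neq_lift _ _)).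
Qed.

Lemma partial_det_inv p (X : 'rV[R]_n -> 'M[R]_p) : 0 < \det (X x) -> Ck_mx 1 U X ->
  partial i (fun y => \det (X y)) x = \det (X x) * \tr (partial_mx i X x *m invmx (X x)).
Proof.
move=> d0 hX; rewrite partial_det// -mxtraceZ scalemxAr; congr (\tr (_ *m _)).
by rewrite /invmx unitmxE unitfE gt_eqF// scalerA divff ?scale1r// gt_eqF.
Qed.

End AtPoint.
End MatrixCalculus.

Lemma continuous_bigprod (R : realType) (T : topologicalType) (I : Type) (r : seq I)
    (F : I -> T -> R) (x : T) : (forall j, {for x, continuous (F j)}) ->
  {for x, continuous (fun y => \prod_(j <- r) F j y)}.
Proof.
move=> h; elim: r => [|a r IH].
  rewrite (_ : (fun y => _) = fun=> 1); first exact: cst_continuous.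
  by apply/funext => y; rewrite big_nil.
rewrite (_ : (fun y => _) = fun y => F a y * \prod_(j <- r) F j y).
  exact: continuousM (h a) IH.
by apply/funext => y; rewrite big_cons.
Qed.

(** Along the segment from the identity to [G] the quadratic form stays positive, hence the matrices
    stay invertible, and the determinant cannot leave the sign of its initial value 1. *)
Lemma posdef_det_gt0 (R : realType) (n : nat) (G : 'M[R]_n) :
  (forall v : 'rV[R]_n, v != 0 -> 0 < (v *m G *m v^T) 0 0) -> 0 < \det G.
Proof.
move=> hG; pose P (t : R) : 'M[R]_n := (1 - t) *: 1%:M + t *: G.
have Pdet t : 0 <= t <= 1 -> \det (P t) != 0.
  move=> /andP[t0 t1]; apply/negP => /det0P[v v0 /(congr1 (fun w => (w *m v^T) 0 0))].
  rewrite mul0mx [RHS]mxE /P mulmxDr mulmxDl -!scalemxAr mulmx1 -!scalemxAl !mxE => /eqP.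
  have v2 : 0 < \sum_j v 0 j * v^T j 0.
    rewrite lt_def sumr_ge0 ?andbT; last by move=> j _; rewrite mxE -expr2 sqr_ge0.
    apply: contra v0; rewrite psumr_eq0; last by move=> j _; rewrite mxE -expr2 sqr_ge0.
    move=> /allP h; apply/eqP/rowP => j; have := h j (mem_index_enum j).
    by rewrite !mxE mulf_eq0 orbb => /eqP.
  have vG := hG v v0; rewrite mxE in vG.
  rewrite gt_eqF//; move: t0; rewrite le_eqVlt => /predU1P[<-|t0].
    by rewrite subr0 mul1r mul0r addr0.
  by apply: ltr_wpDl; [rewrite mulr_ge0 ?subr_ge0// ltW|rewrite mulr_gt0].
have P0 : \det (P 0) = 1 by rewrite /P subr0 scale1r scale0r addr0 det1.
have P1 : \det (P 1) = \det G by rewrite /P subrr scale0r scale1r add0r.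
rewrite -P1 ltNge; apply/negP => P1n.
have cP : {within `[0, 1], continuous (fun t => \det (P t))}.
  apply: continuous_subspaceT => t; apply: continuous_bigsum => s.
  apply: continuousM; first exact: cst_continuous.
  apply: continuous_bigprod => a.
  rewrite (_ : (fun y => _) = fun y => (1 - y) * 1%:M a (s a) + y * G a (s a)); last first.
    by apply/funext => y; rewrite !mxE.
  apply: continuousD; apply: continuousM; [|exact: cst_continuous| |exact: cst_continuous].
    by apply: continuousB => //; exact: cst_continuous.
  by [].
have [|c] := @IVT R (fun t => \det (P t)) 0 1 0 ler01 cP.
  by rewrite P0 ge_min le_max P1n ler01 orbT.
by rewrite in_itv/= => /Pdet /eqP.
Qed.

(** * Curvature in a chart *)

Local Opaque partial.

(** A metric in coordinates, with definiteness recorded through the determinant, in the form that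
    inverses and volume densities require. *)
Record local_metric (R : realType) (n : nat) (U : set 'rV[R]_n)
    (G : 'rV[R]_n -> 'M[R]_n) : Prop := LocalMetric {
  local_metric_open : open U ;
  local_metric_sym : forall x, U x -> (G x)^T = G x ;
  local_metric_det : forall x, U x -> 0 < \det (G x) ;
  local_metric_C2 : Ck_mx 2 U G
}.

(* Row j holds the components of the covariant derivative of d/dx_j along
   d/dx_i, so that curvature and its behaviour under changes of coordinates and
   of scale become matrix identities. *)
HB.lock Definition connection (R : realType) (n : nat) (G : 'rV[R]_n -> 'M[R]_n) (i : 'I_n)
    (x : 'rV[R]_n) : 'M[R]_n := \matrix_(j, k) christoffel G k i j x.

(** Christoffel symbols of the first kind: [connection] with its upper index lowered by the metric,
    see [connection_mul]. *)
HB.lock Definition lowered_connection (R : realType) (n : nat) (G : 'rV[R]_n -> 'M[R]_n) (i : 'I_n)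
    (x : 'rV[R]_n) : 'M[R]_n :=
  \matrix_(j, l) (2^-1 * (partial i (fun y => G y j l) x + partial j (fun y => G y i l) x
     - partial l (fun y => G y i j) x)).

Lemma connection_entry (R : realType) (n : nat) (G : 'rV[R]_n -> 'M[R]_n) i x j k :
  connection G i x j k = christoffel G k i j x.
Proof. by rewrite connection.unlock mxE. Qed.

Lemma lowered_connection_entry (R : realType) (n : nat) (G : 'rV[R]_n -> 'M[R]_n) i x j l :
  lowered_connection G i x j l = 2^-1 * (partial i (fun y => G y j l) x
    + partial j (fun y => G y i l) x - partial l (fun y => G y i j) x).
Proof. by rewrite lowered_connection.unlock mxE. Qed.

(** Row [k] holds the components of R(d/dx_i, d/dx_j) d/dx_k. The products appear with the signs
    opposite to the usual column convention, because the frame is acted on from the left. *)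
HB.lock Definition curvature (R : realType) (n : nat) (G : 'rV[R]_n -> 'M[R]_n) (i j : 'I_n)
    (x : 'rV[R]_n) : 'M[R]_n :=
  partial_mx i (connection G j) x - partial_mx j (connection G i) x
  - connection G i x *m connection G j x + connection G j x *m connection G i x.

HB.lock Definition grad_pairing (R : realType) (n : nat) (G : 'rV[R]_n -> 'M[R]_n)
    (f h : 'rV[R]_n -> R) (x : 'rV[R]_n) : R :=
  \sum_(i < n) \sum_(j < n) invmx (G x) i j * (partial i f x * partial j h x).

HB.lock Definition hessian (R : realType) (n : nat) (G : 'rV[R]_n -> 'M[R]_n)
    (f : 'rV[R]_n -> R) (x : 'rV[R]_n) : 'M[R]_n :=
  \matrix_(i, j) (partial i (partial j f) x - \sum_(k < n) christoffel G k i j x * partial k f x).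

HB.lock Definition laplacian (R : realType) (n : nat) (G : 'rV[R]_n -> 'M[R]_n)
    (f : 'rV[R]_n -> R) (x : 'rV[R]_n) : R := \tr (hessian G f x *m invmx (G x)).

HB.lock Definition gradient (R : realType) (n : nat) (f : 'rV[R]_n -> R) (x : 'rV[R]_n) : 'cV[R]_n :=
  \col_i partial i f x.

Lemma gradient_entry (R : realType) (n : nat) (f : 'rV[R]_n -> R) (x : 'rV[R]_n) i k :
  gradient f x i k = partial i f x.
Proof. by rewrite gradient.unlock mxE. Qed.

Lemma grad_pairingE (R : realType) (n : nat) (G : 'rV[R]_n -> 'M[R]_n) f h x :
  grad_pairing G f h x = ((gradient f x)^T *m invmx (G x) *m gradient h x) 0 0.
Proof.
rewrite grad_pairing.unlock mxE exchange_big; apply: eq_bigr => j _.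
rewrite mxE mulr_suml gradient_entry; apply: eq_bigr => i _.
by rewrite mxE gradient_entry mulrA [_ * partial i f x]mulrC.
Qed.

Section LocalMetric.
Context {R : realType} {n : nat}.
Variables (U : set 'rV[R]_n) (G : 'rV[R]_n -> 'M[R]_n).
Hypothesis hG : local_metric U G.
Implicit Types (i j k l : 'I_n) (x : 'rV[R]_n).

Let oU := local_metric_open hG.
Let C2G := local_metric_C2 hG.
Let C1G : Ck_mx 1 U G := Ck_mx_le (leqnSn 1) C2G.

Lemma local_metric_unit x : U x -> G x \in unitmx.
Proof. by move=> Ux; rewrite unitmxE unitfE gt_eqF// (local_metric_det hG). Qed.

Lemma local_metric_inv_sym x : U x -> (invmx (G x))^T = invmx (G x).
Proof. by move=> Ux; rewrite trmx_inv (local_metric_sym hG). Qed.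

Lemma metric_entry_sym x i j : U x -> G x i j = G x j i.
Proof. by move=> Ux; rewrite -{1}(local_metric_sym hG Ux) mxE. Qed.

Lemma metric_inv_entry_sym x i j : U x -> invmx (G x) i j = invmx (G x) j i.
Proof. by move=> Ux; rewrite -{1}(local_metric_inv_sym Ux) mxE. Qed.

Lemma partial_metric_sym x i j l : U x ->
  partial i (fun y => G y j l) x = partial i (fun y => G y l j) x.
Proof.
move=> Ux; apply: partial_near_eq; apply: (open_near_eq oU Ux) => y; rewrite inE => Uy.
exact: metric_entry_sym.
Qed.

Lemma connectionE i x : U x ->
  connection G i x = lowered_connection G i x *m invmx (G x).
Proof.
move=> Ux; apply/matrixP => j k; rewrite connection_entry mxE /christoffel mulr_sumr.
apply: eq_bigr => l _; rewrite lowered_connection_entry (metric_inv_entry_sym _ _ Ux).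
by rewrite mulrA mulrAC.
Qed.

Lemma connection_mul i x : U x -> connection G i x *m G x = lowered_connection G i x.
Proof. by move=> Ux; rewrite connectionE// mulmxKV// local_metric_unit. Qed.

(** Allows a connection to be identified after multiplication by the metric, where only first-kind
    symbols, free of inverses, occur. *)
Lemma connection_unique i x A : U x -> A *m G x = lowered_connection G i x ->
  A = connection G i x.
Proof. by move=> Ux E; rewrite connectionE// -E mulmxK// local_metric_unit. Qed.

Lemma christoffelC k i j x : U x -> christoffel G k i j x = christoffel G k j i x.
Proof.
move=> Ux; rewrite /christoffel; congr (_ * _); apply: eq_bigr => l _; congr (_ * _).
by rewrite (partial_metric_sym l i j Ux) [X in X - _]addrC.
Qed.

(** Compatibility of the Levi-Civita connection with the metric: in the sum of a first-kind matrix
    and its transpose everything but one derivative of [G] cancels. *)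
Lemma partial_metric k x : U x ->
  partial_mx k G x = connection G k x *m G x + G x *m (connection G k x)^T.
Proof.
move=> Ux; rewrite -[in G x *m _](local_metric_sym hG Ux) -trmx_mul connection_mul//.
apply/matrixP => j l; rewrite !mxE !lowered_connection_entry partial_mxE.
rewrite (partial_metric_sym k l j Ux) (partial_metric_sym l k j Ux).
by rewrite (partial_metric_sym j k l Ux); field.
Qed.

Lemma partial_metric_inv k x : U x ->
  partial_mx k (fun y => invmx (G y)) x =
  - (invmx (G x) *m connection G k x) - (connection G k x)^T *m invmx (G x).
Proof.
move=> Ux; rewrite (partial_mx_inv k oU Ux (local_metric_det hG) C1G).
rewrite partial_metric// mulmxDr mulmxDl -!mulmxA mulmxV ?local_metric_unit// mulmx1.
by rewrite mulKmx ?local_metric_unit// opprD.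
Qed.

Lemma Ck_metric_inv : Ck_mx 2 U (fun y => invmx (G y)).
Proof. exact: Ck_mx_inv oU (local_metric_det hG) C2G. Qed.

Lemma Ck_christoffel k i j : Ck_on 1 U (christoffel G k i j).
Proof.
apply: CkZ => //; apply: Ck_sum => // l; apply: CkM => //.
  exact: (Ck_mx_le (leqnSn 1) Ck_metric_inv).
by apply: CkB => //; [apply: CkD => //|]; apply: Ck_partial; exact: C2G.
Qed.

Lemma Ck_connection i : Ck_mx 1 U (connection G i).
Proof.
move=> j k; rewrite (_ : (fun y => _) = christoffel G k i j); first exact: Ck_christoffel.
by apply/funext => y; rewrite connection_entry.
Qed.

Local Opaque partial christoffel.

Let mx4E (A B C D : 'M[R]_n) a b :
  (A - B - C + D) a b = A a b - B a b - C a b + D a b.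
Proof. by rewrite !mxE. Qed.

Let congr4 (a b c d a' b' c' d' : R) : a = a' -> b = b' -> c = c' -> d = d' ->
  a - b - c + d = a' - b' - c' + d'.
Proof. by move=> -> -> -> ->. Qed.

Let assemble (p q t p' q' s1 s2 r : R) : p = p' -> q = q' -> t = s2 - s1 ->
  r = p' - q' - s1 + s2 -> p - q + t = r.
Proof. by move=> -> -> -> ->; ring. Qed.

(** The trace over Z of R(Z, d/dx_j) d/dx_i. The coordinate formula differs from the matrix one by
    the order of lower indices, which [christoffelC] exchanges, also under a derivative because it
    holds on a neighbourhood. *)
Lemma ricciE i j x : U x -> ricci G i j x = \sum_k curvature G k j x i k.
Proof.
move=> Ux.
have E a b c d : partial a (christoffel G b c d) x = partial a (christoffel G b d c) x.
  apply: partial_near_eq; apply: (open_near_eq oU Ux) => y; rewrite inE => Uy.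
  exact: christoffelC.
have F a b c d : partial_mx a (connection G b) x c d = partial a (christoffel G d b c) x.
  by rewrite partial_mxE; congr (partial a _ x); apply/funext => y; rewrite connection_entry.
have M a b c d : (connection G a x *m connection G b x) c d =
    \sum_l christoffel G l a c x * christoffel G d b l x.
  by rewrite mxE; apply: eq_bigr => l _; rewrite !connection_entry.
rewrite /ricci -big_split/=; apply: eq_bigr => k _.
rewrite curvature.unlock.
refine (assemble (E k k i j) (E j k i k) _
  (etrans (mx4E _ _ _ _ i k) (congr4 (F k j i k) (F j k i k) (M k j i k) (M j k i k)))).
rewrite sumrB; congr (_ - _); apply: eq_bigr => l _.
  by rewrite (christoffelC l i j Ux) mulrC.
by rewrite (christoffelC l i k Ux) mulrC.
Qed.

End LocalMetric.

(** * Change of coordinates *)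

(** Pullback along [phi] of a matrix-valued 1-form with coefficients [X b]: the form index is
    transformed, the matrix indices are not. *)
HB.lock Definition pullback (R : realType) (n p q : nat) (phi : 'rV[R]_n -> 'rV[R]_n)
    (J : 'rV[R]_n -> 'M[R]_n) (X : 'I_n -> 'rV[R]_n -> 'M[R]_(p, q)) (i : 'I_n)
    (x : 'rV[R]_n) : 'M[R]_(p, q) :=
  \sum_b J x i b *: X b (phi x).

Section ChangeOfCoordinates.
Context {R : realType} {n : nat}.
Variables (U V : set 'rV[R]_n) (phi : 'rV[R]_n -> 'rV[R]_n).
Variables (G H : 'rV[R]_n -> 'M[R]_n).
Hypotheses (hG : local_metric U G) (hH : local_metric V H).
Hypothesis UV : forall x, U x -> V (phi x).
Hypothesis cphi : forall x, U x -> {for x, continuous phi}.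
Hypothesis hphi : forall j, Ck_on 3 U (fun y => phi y 0 j).
Variable J : 'rV[R]_n -> 'M[R]_n.
Hypothesis JE : forall x, U x -> J x = jacobian phi x.
Hypothesis GH : forall x, U x -> G x = J x *m H (phi x) *m (J x)^T.
Implicit Types (i j k l a b c : 'I_n) (x : 'rV[R]_n).

Let oU := local_metric_open hG.
Let oV := local_metric_open hH.
Let hphi1 j : Ck_on 1 U (fun y => phi y 0 j) := Ck_le (isT : (1 <= 3)%N) (hphi j).

(** The reason for three derivatives of [phi]: curvature differentiates connection matrices, whose
    transformation law already contains a derivative of [J]. *)
Lemma Ck_jacobian : Ck_mx 2 U J.
Proof.
move=> i j; apply: (Ck_eq oU) (Ck_partial i (hphi j)) => y; rewrite inE => Uy.
by rewrite JE// (jacobianE i j oU Uy hphi1).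
Qed.

Let C1J : Ck_mx 1 U J := Ck_mx_le (leqnSn 1) Ck_jacobian.

Lemma partial_jacobianC i j a x : U x -> partial_mx i J x j a = partial_mx j J x i a.
Proof.
move=> Ux.
have E k l : partial_mx k J x l a = partial k (partial l (fun y => phi y 0 a)) x.
  rewrite partial_mxE; apply: partial_near_eq; apply: (open_near_eq oU Ux) => y.
  by rewrite inE => Uy; rewrite JE// (jacobianE l a oU Uy hphi1).
rewrite (E i j) (E j i); apply: partialC oU _ Ux.
exact: Ck_le (isT : (2 <= 3)%N) (hphi a).
Qed.

Lemma jacobian_unit x : U x -> J x \in unitmx.
Proof.
move=> Ux; have := local_metric_det hG Ux; rewrite GH// !det_mulmx det_tr => d0.
by rewrite unitmxE unitfE; apply: contraTneq d0 => ->; rewrite mulr0 ltxx.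
Qed.

Lemma Ck_mx_comp (m : nat) p q (X : 'rV[R]_n -> 'M[R]_(p, q)) : (m <= 3)%N ->
  Ck_mx m V X -> Ck_mx m U (fun y => X (phi y)).
Proof.
move=> k3 hX a b; apply: (Ck_comp oU oV UV cphi _ (hX a b)) => j.
exact: Ck_le k3 (hphi j).
Qed.

Lemma partial_mx_comp p q i (X : 'rV[R]_n -> 'M[R]_(p, q)) x : U x -> Ck_mx 1 V X ->
  partial_mx i (fun y => X (phi y)) x = pullback phi J (fun b => partial_mx b X) i x.
Proof.
move=> Ux hX; apply/matrixP => a b; rewrite partial_mxE pullback.unlock summxE.
have [_ E] := partial_comp i oU oV Ux (UV Ux) hphi1 (hX a b).
by rewrite [LHS]E; apply: eq_bigr => c _; rewrite [RHS]mxE partial_mxE JE.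
Qed.

Lemma partial_pullback p q k i (X : 'I_n -> 'rV[R]_n -> 'M[R]_(p, q)) x : U x ->
  (forall b, Ck_mx 1 V (X b)) ->
  partial_mx k (pullback phi J X i) x = \sum_b (partial_mx k J x i b *: X b (phi x)
     + J x i b *: pullback phi J (fun c => partial_mx c (X b)) k x).
Proof.
move=> Ux hX.
have hXphi b := Ck_mx_comp (m := 1) isT (hX b).
rewrite [X in partial_mx k X x](_ : _ = fun y => \sum_b J y i b *: X b (phi y)); last first.
  by apply/funext => y; rewrite pullback.unlock.
rewrite (partial_mx_sum k Ux _ (fun b => Ck_mx_scale oU (C1J i b) (hXphi b))).
apply: eq_bigr => b _.
by rewrite (partial_mxZ k Ux (C1J i b) (hXphi b)) (partial_mx_comp k Ux (hX b)) partial_mxE.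
Qed.

Lemma Ck_pullback p q i (X : 'I_n -> 'rV[R]_n -> 'M[R]_(p, q)) :
  (forall b, Ck_mx 1 V (X b)) -> Ck_mx 1 U (pullback phi J X i).
Proof.
rewrite pullback.unlock => hX; apply: Ck_mx_sum => // b; apply: Ck_mx_scale => //.
by apply: Ck_mx_comp.
Qed.

(** A covariant 3-tensor pulled back by [J]. The derivatives of [G] split into such terms, where [H]
    is differentiated, and into terms [X], where [J] is. *)
Let T (F : 'I_n -> 'M[R]_n) x i j l : R := \sum_b \sum_c \sum_a
  J x i b * J x j c * J x l a * F b c a.

Let TE (F : 'I_n -> 'M[R]_n) x i j l :
  (J x *m (\sum_b J x i b *: F b) *m (J x)^T) j l = T F x i j l.
Proof.
rewrite mulmx_sumr mulmx_suml summxE; apply: eq_bigr => b _.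
rewrite -scalemxAr -scalemxAl mxE -mulmxA mxE mulr_sumr; apply: eq_bigr => c _.
rewrite mxE mulr_sumr mulr_sumr; apply: eq_bigr => a _.
by rewrite mxE; ring.
Qed.

Let X x i j l : R := (partial_mx i J x *m H (phi x) *m (J x)^T) j l.

Let XC x i j l : U x -> X x i j l = X x j i l.
Proof.
move=> Ux; rewrite /X -!mulmxA mxE [RHS]mxE.
by apply: eq_bigr => a _; rewrite (partial_jacobianC _ _ _ Ux).
Qed.

Let dG x i j l : U x -> partial i (fun y => G y j l) x =
  X x i j l + T (fun b => partial_mx b H (phi x)) x i j l + X x i l j.
Proof.
move=> Ux.
have C1H := Ck_mx_le (leqnSn 1) (local_metric_C2 hH).
have hHphi := Ck_mx_comp (m := 1) isT C1H.
have E : partial_mx i G x = partial_mx i J x *m H (phi x) *m (J x)^T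
   + J x *m pullback phi J (fun b => partial_mx b H) i x *m (J x)^T
   + J x *m H (phi x) *m (partial_mx i J x)^T.
  rewrite (@partial_mx_eq _ _ U i x oU Ux _ _ G (fun y => J y *m H (phi y) *m (J y)^T)).
    rewrite (partial_mxM i Ux (Ck_mx_mul oU C1J hHphi) (Ck_mx_tr C1J)).
    rewrite (partial_mxM i Ux C1J hHphi) partial_mx_tr mulmxDl.
    by rewrite (partial_mx_comp i Ux C1H).
  by move=> y; rewrite inE => Uy; exact: GH.
transitivity (partial_mx i G x j l); first by rewrite partial_mxE.
rewrite E mxE mxE pullback.unlock TE; congr (_ + _ + _).
rewrite -[in LHS](local_metric_sym hH (UV Ux)) -{1}[J x]trmxK -trmx_mul.
by rewrite -trmx_mul mxE mulmxA.
Qed.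

Let half (x1 x2 x3 t1 t2 t3 : R) :
  2^-1 * ((x1 + t1 + x2) + (x1 + t2 + x3) - (x2 + t3 + x3)) =
  x1 + 2^-1 * (t1 + t2 - t3).
Proof. by field. Qed.

(** Of the six terms with a derivative of [J], four cancel in pairs by symmetry of second
    derivatives and the other two coincide. The terms with derivatives of [H] recombine into its
    first-kind symbols once the summation indices are renamed. *)
Lemma lowered_connection_change i x : U x ->
  lowered_connection G i x =
  (partial_mx i J x + J x *m pullback phi J (connection H) i x) *m (H (phi x) *m (J x)^T).
Proof.
move=> Ux; apply/matrixP => j l.
rewrite lowered_connection_entry (dG i j l Ux) (dG j i l Ux) (dG l i j Ux).
rewrite (XC j i l Ux) (XC i l j Ux) (XC j l i Ux) half.
rewrite mulmxDl mxE mulmxA -/(X x i j l); congr (_ + _).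
rewrite pullback.unlock mulmxA -[J x *m _ *m H _]mulmxA mulmx_suml.
under [in RHS]eq_bigr do rewrite -scalemxAl (connection_mul hH _ (UV Ux)).
rewrite TE.
have T2 : T (fun b => partial_mx b H (phi x)) x j i l =
    \sum_b \sum_c \sum_a J x i b * J x j c * J x l a * partial_mx c H (phi x) b a.
  rewrite /T exchange_big; apply: eq_bigr => b _; apply: eq_bigr => c _.
  by apply: eq_bigr => a _; rewrite [J x j c * _]mulrC.
have T3 : T (fun b => partial_mx b H (phi x)) x l i j =
    \sum_b \sum_c \sum_a J x i b * J x j c * J x l a * partial_mx a H (phi x) b c.
  rewrite /T exchange_big; apply: eq_bigr => b _; rewrite exchange_big.
  by apply: eq_bigr => c _; apply: eq_bigr => a _; congr (_ * _); ring.
rewrite T2 T3 /T -!big_split/= -sumrB mulr_sumr; apply: eq_bigr => b _.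
rewrite -!big_split/= -sumrB mulr_sumr; apply: eq_bigr => c _.
rewrite -!big_split/= -sumrB mulr_sumr; apply: eq_bigr => a _.
by rewrite lowered_connection_entry !partial_mxE; ring.
Qed.

(** The gauge law for connection matrices, kept free of the inverse of [J] so that it can be
    differentiated as it stands. *)
Lemma connection_change i x : U x ->
  connection G i x *m J x = partial_mx i J x + J x *m pullback phi J (connection H) i x.
Proof.
move=> Ux; have uJ := jacobian_unit Ux.
have uHJ : H (phi x) *m (J x)^T \in unitmx.
  by rewrite unitmx_mul (local_metric_unit hH (UV Ux)) unitmx_tr.
apply: (can_inj (mulmxK uHJ)); rewrite -(lowered_connection_change i Ux).
by rewrite -mulmxA [J x *m _]mulmxA -GH// (connection_mul hG).
Qed.

Let additive_identity (q a b c d e a' b' e' : 'M[R]_n) :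
  (q + (a + b) - c) - (q + (a' + b') - d) - (d + (a + e)) + (c + (a' + e')) =
  b - b' - e + e'.
Proof. by apply/matrixP => r s; rewrite !mxE; ring. Qed.

(** [P] stands for derivatives of [J], [B] for pulled-back connections and [Q] for the second
    derivative of [J], which enters both differentiated gauge laws equally and drops out of their
    difference. *)
Let curvature_algebra (J0 Ak Ai Pk Pi Bk Bi dkAi diAk dkBi diBk Q : 'M[R]_n) :
  Ak *m J0 = Pk + J0 *m Bk -> Ai *m J0 = Pi + J0 *m Bi ->
  dkAi *m J0 + Ai *m Pk = Q + (Pk *m Bi + J0 *m dkBi) ->
  diAk *m J0 + Ak *m Pi = Q + (Pi *m Bk + J0 *m diBk) ->
  (dkAi - diAk - Ak *m Ai + Ai *m Ak) *m J0 =
  J0 *m (dkBi - diBk - Bk *m Bi + Bi *m Bk).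
Proof.
move=> EAk EAi /(canRL (addrK _)) Ek /(canRL (addrK _)) Ei.
rewrite mulmxDl 2!mulmxBl Ek Ei -[Ak *m Ai *m _]mulmxA -[Ai *m Ak *m _]mulmxA EAi EAk.
rewrite [Ak *m (_ + _)]mulmxDr [Ai *m (_ + _)]mulmxDr !mulmxA EAi EAk !mulmxDl.
rewrite mulmxDr 2!mulmxBr !mulmxA; exact: additive_identity.
Qed.

(** Antisymmetrising the derivative of [connection_change] leaves no derivative of [J]: the second
    derivatives cancel by symmetry, and so do the terms in which the Jacobian inside the pullback is
    differentiated. *)
Lemma curvature_change k i x : U x ->
  curvature G k i x *m J x =
  J x *m \sum_a \sum_b (J x k a * J x i b) *: curvature H a b (phi x).
Proof.
move=> Ux.
have C1G c : Ck_mx 1 U (connection G c) := Ck_connection hG c.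
have C1H c : Ck_mx 1 V (connection H c) := Ck_connection hH c.
have C1P c : Ck_mx 1 U (partial_mx c J) := Ck_mx_partial c Ck_jacobian.
have C1B c : Ck_mx 1 U (pullback phi J (connection H) c) := Ck_pullback c C1H.
have E c d : partial_mx c (connection G d) x *m J x + connection G d x *m partial_mx c J x =
    partial_mx c (partial_mx d J) x +
    (partial_mx c J x *m pullback phi J (connection H) d x +
     J x *m partial_mx c (pullback phi J (connection H) d) x).
  rewrite -(partial_mxM c Ux (C1G d) C1J) -(partial_mxM c Ux C1J (C1B d)).
  rewrite -(partial_mxD c Ux (C1P d) (Ck_mx_mul oU C1J (C1B d))).
  by apply: (partial_mx_eq c oU Ux) => y; rewrite inE => Uy; exact: connection_change.
have PC c d : partial_mx c (partial_mx d J) x = partial_mx d (partial_mx c J) x.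
  apply/matrixP => a b; rewrite !partial_mxE.
  have P c' d' : partial c' (fun y => partial_mx d' J y a b) x =
      partial c' (partial d' (fun y => J y a b)) x.
    by congr (partial c' _ x); apply/funext => y; rewrite partial_mxE.
  by rewrite (P c d) (P d c); exact: partialC oU (Ck_jacobian a b) Ux.
have Ek := E k i; have Ei := E i k; rewrite (PC i k) in Ei.
rewrite curvature.unlock.
rewrite (curvature_algebra (connection_change k Ux) (connection_change i Ux) Ek Ei).
congr (_ *m _).
rewrite (partial_pullback k i Ux C1H) (partial_pullback i k Ux C1H) !big_split/=.
have -> : \sum_b partial_mx i J x k b *: connection H b (phi x) =
    \sum_b partial_mx k J x i b *: connection H b (phi x).
  by apply: eq_bigr => b _; rewrite (partial_jacobianC i k b Ux).
rewrite opprD addrACA subrr add0r.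
have D c d : \sum_b J x d b *: pullback phi J (fun a => partial_mx a (connection H b)) c x =
    \sum_a \sum_b (J x c a * J x d b) *: partial_mx a (connection H b) (phi x).
  rewrite pullback.unlock exchange_big; apply: eq_bigr => b _.
  by rewrite scaler_sumr; apply: eq_bigr => a _; rewrite scalerA mulrC.
have M c d : pullback phi J (connection H) c x *m pullback phi J (connection H) d x =
    \sum_a \sum_b (J x c a * J x d b) *: (connection H a (phi x) *m connection H b (phi x)).
  rewrite pullback.unlock mulmx_suml; apply: eq_bigr => a _.
  rewrite mulmx_sumr; apply: eq_bigr => b _.
  by rewrite -scalemxAl -scalemxAr scalerA.
rewrite (D k i) (D i k) (M k i) (M i k).
rewrite [X in _ - X - _ + _]exchange_big [X in _ - _ - _ + X]exchange_big/=.
rewrite -!sumrB -big_split/=; apply: eq_bigr => a _.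
rewrite -!sumrB -big_split/=; apply: eq_bigr => b _.
by rewrite [J x i b * _]mulrC -!scalerBr -scalerDr.
Qed.

(** Curvature is conjugated by [J] in its matrix indices. In the trace over [k] the inverse of [J]
    from the conjugation meets the factor [J x k a] of the form index, and both disappear. *)
Lemma ricci_change x : U x ->
  \matrix_(i, j) ricci G i j x = J x *m (\matrix_(i, j) ricci H i j (phi x)) *m (J x)^T.
Proof.
move=> Ux; have uJ := jacobian_unit Ux.
apply/matrixP => i j; rewrite mxE (ricciE hG)//.
have -> : \sum_k curvature G k j x i k =
    \sum_b J x j b * \sum_a (J x *m curvature H a b (phi x)) i a.
  have E k : curvature G k j x i k = \sum_b J x j b *
      \sum_a (J x *m curvature H a b (phi x) *m invmx (J x)) i k * J x k a.
    rewrite -[curvature G k j x](mulmxK uJ) curvature_change//.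
    transitivity (\sum_a \sum_b J x k a * J x j b *
        (J x *m curvature H a b (phi x) *m invmx (J x)) i k).
      rewrite mulmx_sumr mulmx_suml summxE; apply: eq_bigr => a _.
      rewrite mulmx_sumr mulmx_suml summxE; apply: eq_bigr => b _.
      by rewrite -scalemxAr -scalemxAl mxE.
    rewrite exchange_big; apply: eq_bigr => b _; rewrite mulr_sumr.
    by apply: eq_bigr => a _; rewrite [J x k a * _]mulrC -mulrA [J x k a * _]mulrC.
  rewrite (eq_bigr _ (fun k _ => E k)) exchange_big; apply: eq_bigr => b _.
  rewrite -mulr_sumr exchange_big; congr (_ * _); apply: eq_bigr => a _.
  rewrite -[J x *m curvature H a b (phi x) in RHS](mulmxKV uJ) mxE.
  by [].
rewrite mxE; apply: eq_bigr => b _; rewrite [(J x)^T b j]mxE mulrC; congr (_ * _).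
under eq_bigr do rewrite mxE.
rewrite exchange_big mxE; apply: eq_bigr => c _.
rewrite [X in _ = _ * X]mxE (ricciE hH _ _ (UV Ux)) [RHS]mulr_sumr.
exact: erefl.
Qed.

Lemma metric_inv_change x : U x ->
  (J x)^T *m invmx (G x) *m J x = invmx (H (phi x)).
Proof.
move=> Ux; have uH := local_metric_unit hH (UV Ux).
have uJT : (J x)^T \in unitmx by rewrite unitmx_tr jacobian_unit.
apply: (can_inj (mulmxK uH)); rewrite mulVmx//.
apply: (can_inj (mulmxK uJT)); rewrite mul1mx -!mulmxA [J x *m (_ *m _)]mulmxA -GH//.
by rewrite mulVmx ?mulmx1// (local_metric_unit hG).
Qed.

Lemma grad_pairing_change f h x : U x -> Ck_on 1 V f -> Ck_on 1 V h ->
  grad_pairing G (f \o phi) (h \o phi) x = grad_pairing H f h (phi x).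
Proof.
move=> Ux hf hh.
have E g : Ck_on 1 V g -> gradient (g \o phi) x = J x *m gradient g (phi x).
  move=> hg; apply/matrixP => i c; rewrite gradient_entry mxE JE//.
  have [_ E] := partial_comp i oU oV Ux (UV Ux) hphi1 hg.
  by rewrite [LHS]E; apply: eq_bigr => a _; rewrite gradient_entry.
rewrite !grad_pairingE !E// -metric_inv_change// trmx_mul -!mulmxA.
by rewrite [_ *m (J x *m gradient h _)]mulmxA.
Qed.

Lemma scalar_change x : U x ->
  local_scalar_curvature G x = local_scalar_curvature H (phi x).
Proof.
move=> Ux; have uJ := jacobian_unit Ux.
have E (K : 'rV[R]_n -> 'M[R]_n) y : local_scalar_curvature K y =
    \tr (invmx (K y) *m (\matrix_(i, j) ricci K i j y)^T).
  rewrite /local_scalar_curvature /mxtrace; apply: eq_bigr => i _; rewrite mxE.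
  by apply: eq_bigr => j _; rewrite !mxE.
rewrite !E ricci_change// !trmx_mul trmxK !mulmxA mxtrace_mulC !mulmxA.
by rewrite -[in LHS]mulmxA [in LHS]mulmxA metric_inv_change.
Qed.

End ChangeOfCoordinates.

(** * Conformal change *)

Lemma mx11_row_col (R : realType) (n : nat) (s : 'rV[R]_n) (p : 'cV[R]_n) :
  s *m p = ((s *m p) 0 0)%:M.
Proof. by rewrite [LHS]mx11_scalar. Qed.

(* The metric is scaled by w, where w^-1 dw = 2 p for a closed 1-form p. This
   keeps exponents out of the computation: they only enter through p. *)
Section ConformalChange.
Context {R : realType} {n : nat}.
Variables (U : set 'rV[R]_n) (G : 'rV[R]_n -> 'M[R]_n).
Hypothesis hG : local_metric U G.
Variables (w : 'rV[R]_n -> R) (p : 'rV[R]_n -> 'cV[R]_n) (W : 'rV[R]_n -> 'M[R]_n).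
Hypotheses (hw : Ck_on 2 U w) (w0 : forall x, U x -> 0 < w x).
Hypothesis hp : Ck_mx 1 U p.
Hypothesis dw : forall i x, U x -> partial i w x = 2 * p x i 0 * w x.
Hypothesis closed_p : forall i j x, U x ->
  partial i (fun y => p y j 0) x = partial j (fun y => p y i 0) x.
Hypothesis WE : forall x, W x = w x *: G x.
Implicit Types (i j k l m : 'I_n) (x : 'rV[R]_n).

Let oU := local_metric_open hG.
Let C1G : Ck_mx 1 U G := Ck_mx_le (leqnSn 1) (local_metric_C2 hG).
Let C1I : Ck_mx 1 U (fun y => invmx (G y)) := Ck_mx_le (leqnSn 1) (Ck_metric_inv hG).

Lemma conformal_local_metric : local_metric U W.
Proof.
split; first exact: oU.
- move=> x Ux; have G_sym := local_metric_sym hG Ux.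
  by rewrite WE linearZ/= G_sym.
- move=> x Ux; have G_det := local_metric_det hG Ux.
  by rewrite WE detZ; apply: mulr_gt0 G_det; exact: exprn_gt0 (w0 Ux).
- have WG : {in U, (fun y => w y *: G y) =1 W} by move=> y _; exact: esym (WE y).
  exact: Ck_mx_eq oU WG (Ck_mx_scale oU hw (local_metric_C2 hG)).
Qed.

Let hW := conformal_local_metric.

(** [s] is [p] with its index raised, [g j] the j-th coordinate field with its index lowered. In
    indices [C] is the classical delta^k_i p_j + delta^k_j p_i - g_ij p^k; its scalar part is kept
    apart from [D] because scalar matrices drop out of commutators. *)
Let s x : 'rV[R]_n := (p x)^T *m invmx (G x).
Let g j x : 'cV[R]_n := col j (G x).
Let e j : 'rV[R]_n := delta_mx 0 j.
Let D j x : 'M[R]_n := p x *m e j - g j x *m s x.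
(* The difference of the two connections, see connection_conformal. *)
Let C j x : 'M[R]_n := p x j 0 *: 1%:M + D j x.
Let A := connection G.
(* The covariant derivative of p. *)
Let h k x : 'cV[R]_n := partial_mx k p x - A k x *m p x.
Let N x : R := (s x *m p x) 0 0.

Let partial_W i j l x : U x -> partial i (fun y => W y j l) x =
  w x * partial i (fun y => G y j l) x + w x * (2 * (p x i 0 * G x j l)).
Proof.
move=> Ux; rewrite (_ : (fun y => _) = fun y => w y * G y j l); last first.
  by apply/funext => y; rewrite WE mxE.
rewrite (partialM (Ck_derivable i hw Ux) (Ck_derivable i (C1G j l) Ux)) dw//.
by ring.
Qed.

Let half_sum (c a1 a2 a3 b1 b2 b3 : R) :
  2^-1 * ((c * a1 + c * (2 * b1)) + (c * a2 + c * (2 * b2)) - (c * a3 + c * (2 * b3))) =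
  c * (2^-1 * (a1 + a2 - a3) + (b1 + b2 - b3)).
Proof. by field. Qed.

Let sG x : U x -> s x *m G x = (p x)^T.
Proof. by move=> Ux; rewrite /s mulmxKV// (local_metric_unit hG). Qed.

(** By [connection_unique] it suffices to compare first-kind symbols, to which the scale factor
    contributes its logarithmic derivative 2 p. *)
Lemma connection_conformal i x : U x -> connection W i x = A i x + C i x.
Proof.
move=> Ux; apply/esym; apply: (connection_unique hW Ux).
rewrite WE -scalemxAr mulmxDl (connection_mul hG)//.
apply/matrixP => j l; rewrite lowered_connection_entry !partial_W// half_sum.
rewrite mxE [X in _ * X]mxE lowered_connection_entry; congr (_ * (_ + _)).
rewrite /C /D mulmxDl -scalemxAl mul1mx mulmxBl -[p x *m _ *m _]mulmxA -[g i x *m _ *m _]mulmxA.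
rewrite (sG Ux).
rewrite -rowE ![in LHS]mxE !big_ord1 !mxE (metric_entry_sym hG j i Ux).
by ring.
Qed.

Let e_conn j k x : e j *m A k x = \sum_m A k x j m *: e m.
Proof. by rewrite -rowE [LHS]row_sum_delta; apply: eq_bigr => m _; rewrite mxE. Qed.

Let C1s : Ck_mx 1 U s.
Proof. by apply: Ck_mx_mul => //; exact: Ck_mx_tr. Qed.

Let C1g j : Ck_mx 1 U (g j).
Proof.
move=> a b; rewrite (_ : (fun y => _) = fun y => G y a j); first exact: C1G.
by apply/funext => y; rewrite mxE.
Qed.

Let partial_g k j x : U x ->
  partial_mx k (g j) x = A k x *m g j x + \sum_m A k x j m *: g m x.
Proof.
move=> Ux.
have -> : partial_mx k (g j) x = col j (partial_mx k G x).
  apply/matrixP => a b; rewrite partial_mxE mxE partial_mxE; congr (partial k _ x).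
  by apply/funext => y; rewrite mxE.
rewrite (partial_metric hG k Ux) linearD/=; congr (_ + _).
  by apply/matrixP => a b; rewrite !mxE; apply: eq_bigr => c _; rewrite !mxE.
apply/matrixP => a b; rewrite summxE !mxE; apply: eq_bigr => m _.
by rewrite !mxE mulrC.
Qed.

Let partial_p k x : partial_mx k p x = A k x *m p x + h k x.
Proof. by rewrite /h addrC subrK. Qed.

Let cancel_first (x1 x2 x3 : 'rV[R]_n) : x1 + x2 + (- x3 - x1) = x2 - x3.
Proof. by apply/matrixP => a b; rewrite !mxE; ring. Qed.

Let leibniz_identity (A0 : 'M[R]_n) (p0 h0 g0 S0 : 'cV[R]_n) (e0 s0 t0 : 'rV[R]_n) :
  (A0 *m p0 + h0) *m e0 - ((A0 *m g0 + S0) *m s0 + g0 *m (t0 - s0 *m A0)) =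
  A0 *m (p0 *m e0 - g0 *m s0) - (p0 *m e0 - g0 *m s0) *m A0
  + (p0 *m (e0 *m A0) - S0 *m s0) + (h0 *m e0 - g0 *m t0).
Proof.
rewrite !(mulmxDl, mulmxDr, mulNmx, mulmxN) !mulmxA.
move: (A0 *m p0 *m e0) (h0 *m e0) (A0 *m g0 *m s0) (S0 *m s0) => x1 x2 x3 x4.
move: (g0 *m t0) (g0 *m s0 *m A0) (p0 *m e0 *m A0) => x5 x6 x7.
by apply/matrixP => a b; rewrite !mxE; ring.
Qed.

Let partial_s k x : U x ->
  partial_mx k s x = (h k x)^T *m invmx (G x) - s x *m A k x.
Proof.
move=> Ux; have E := partial_mxM k Ux (Ck_mx_tr hp) C1I.
rewrite [LHS]E partial_mx_tr partial_p (partial_metric_inv hG k Ux) linearD/= trmx_mul.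
rewrite mulmxDl mulmxBr mulmxN !mulmxA; exact: cancel_first.
Qed.

(** The commutator with [A k] accounts for the two matrix indices and the sum over [m] for the form
    index. What remains is the covariant derivative of [D j]: since the metric is parallel, it is
    [D j] with [p] replaced by [h k]. *)
Let partial_D k j x : U x ->
  partial_mx k (D j) x = A k x *m D j x - D j x *m A k x + \sum_m A k x j m *: D m x
    + (h k x *m e j - g j x *m ((h k x)^T *m invmx (G x))).
Proof.
move=> Ux.
have C1e : Ck_mx 1 U (fun=> e j) by move=> a b; exact: Ck_cst.
have C1ng : Ck_mx 1 U (fun y => - g j y).
  move=> a b; rewrite (_ : (fun y => _) = fun y => - (g j y a b)).
    exact: CkN oU (C1g j a b).
  by apply/funext => y; rewrite mxE.
have Epe := partial_mxM k Ux hp C1e; rewrite partial_mx_cst mulmx0 addr0 in Epe.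
have Egs := partial_mxM k Ux C1ng C1s.
have Eng : partial_mx k (fun y => - g j y) x = - partial_mx k (g j) x.
  apply/matrixP => a b; rewrite partial_mxE mxE partial_mxE.
  rewrite -(partialN (Ck_derivable k (C1g j a b) Ux)).
  by congr (partial k _ x); apply/funext => y; rewrite mxE.
have ED : D j = fun y => p y *m e j + (- g j y) *m s y.
  by apply/funext => y; rewrite /D mulNmx.
have -> : partial_mx k (D j) x = partial_mx k p x *m e j
   - (partial_mx k (g j) x *m s x + g j x *m partial_mx k s x).
  rewrite ED (partial_mxD k Ux (Ck_mx_mul oU hp C1e) (Ck_mx_mul oU C1ng C1s)).
  by rewrite Epe Egs Eng !mulNmx opprD.
have -> : \sum_m A k x j m *: D m x =
    p x *m (e j *m A k x) - (\sum_m A k x j m *: g m x) *m s x.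
  rewrite e_conn mulmx_sumr mulmx_suml -sumrB; apply: eq_bigr => m _.
  by rewrite scalerBr -scalemxAr -scalemxAl.
rewrite partial_p (partial_g k j Ux) (partial_s k Ux); exact: leibniz_identity.
Qed.

(** The covariant derivative of [C j] along d/dx_k, that is, [C j] with [h k] in place of [p]. *)
Let E k j x : 'M[R]_n :=
  h k x j 0 *: 1%:M + (h k x *m e j - g j x *m ((h k x)^T *m invmx (G x))).

Let C1D j : Ck_mx 1 U (D j).
Proof.
have C1e : Ck_mx 1 U (fun=> e j) by move=> a b; exact: Ck_cst.
move=> a b; apply: (Ck_eq oU) (CkB oU (Ck_mx_mul oU hp C1e a b)
  (Ck_mx_mul oU (C1g j) C1s a b)) => y _.
by rewrite /D [RHS]mxE [X in _ = _ + X]mxE.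
Qed.

Let C1p1 j : Ck_mx 1 U (fun y => p y j 0 *: (1%:M : 'M[R]_n)).
Proof.
have C1c : Ck_mx 1 U (fun=> 1%:M : 'M[R]_n) by move=> a b; exact: Ck_cst.
exact: Ck_mx_scale oU (hp j 0) C1c.
Qed.

Let regroup (A0 D0 S0 E0 : 'M[R]_n) (c d sg : R) :
  (sg + d) *: 1%:M + (A0 *m D0 - D0 *m A0 + S0 + E0) =
  A0 *m (c *: 1%:M + D0) - (c *: 1%:M + D0) *m A0 + (sg *: 1%:M + S0) + (d *: 1%:M + E0).
Proof.
rewrite mulmxDr mulmxDl -scalemxAr -scalemxAl mul1mx mulmx1.
move: (A0 *m D0) (D0 *m A0) => x1 x2.
by apply/matrixP => a b; rewrite !mxE; ring.
Qed.

Let scalar_commutator (a b : R) (X Y : 'M[R]_n) :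
  X *m Y - Y *m X = (a *: 1%:M + X) *m (b *: 1%:M + Y) - (b *: 1%:M + Y) *m (a *: 1%:M + X).
Proof.
rewrite !(mulmxDl, mulmxDr) -!scalemxAl -!scalemxAr !mul1mx !mulmx1.
move: (X *m Y) (Y *m X) => x1 x2.
by apply/matrixP => c d; rewrite !mxE; ring.
Qed.

Let curvature_identity (dkj djk Ak Aj Ck Cj S Ekj Ejk : 'M[R]_n) :
  dkj + (Ak *m Cj - Cj *m Ak + S + Ekj) - (djk + (Aj *m Ck - Ck *m Aj + S + Ejk))
  - (Ak + Ck) *m (Aj + Cj) + (Aj + Cj) *m (Ak + Ck) =
  dkj - djk - Ak *m Aj + Aj *m Ak + (Ekj - Ejk) + (Cj *m Ck - Ck *m Cj).
Proof.
rewrite !(mulmxDl, mulmxDr).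
move: (Ak *m Cj) (Cj *m Ak) (Aj *m Ck) (Ck *m Aj) => x1 x2 x3 x4.
move: (Ak *m Aj) (Aj *m Ak) (Ck *m Cj) (Cj *m Ck) => x5 x6 x7 x8.
by apply/matrixP => c d; rewrite !mxE; ring.
Qed.

Let partial_C k j x : U x ->
  partial_mx k (C j) x = A k x *m C j x - C j x *m A k x + \sum_m A k x j m *: C m x
    + E k j x.
Proof.
move=> Ux.
have C1c : Ck_mx 1 U (fun=> 1%:M : 'M[R]_n) by move=> a b; exact: Ck_cst.
have Ep : partial k (fun y => p y j 0) x = \sum_m A k x j m * p x m 0 + h k x j 0.
  by rewrite -partial_mxE partial_p mxE [X in X + _]mxE.
rewrite (partial_mxD k Ux (C1p1 j) (C1D j)) partial_D//.
rewrite (partial_mxZ k Ux (hp j 0) C1c) partial_mx_cst scaler0 addr0 Ep /C /E.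
have -> : \sum_m A k x j m *: (p x m 0 *: 1%:M + D m x) =
    (\sum_m A k x j m * p x m 0) *: 1%:M + \sum_m A k x j m *: D m x.
  rewrite scaler_suml -big_split/=; apply: eq_bigr => m _.
  by rewrite scalerDr scalerA.
exact: regroup.
Qed.

Let AC k j m x : U x -> A k x j m = A j x k m.
Proof. by move=> Ux; rewrite /A !connection_entry (christoffelC hG). Qed.

(** [p] is closed and the connection has no torsion. *)
Let hC k j x : U x -> h k x j 0 = h j x k 0.
Proof.
move=> Ux; rewrite /h !mxE !partial_mxE (closed_p k j Ux); congr (_ - _).
by apply: eq_bigr => m _; rewrite (AC k j m Ux).
Qed.

(** Adding [C] to a connection adds to its curvature the antisymmetrised covariant derivative of [C]
    and a commutator. The sums over [m] agree by the symmetry of the lower indices and cancel. *)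
Lemma curvature_conformal k j x : U x -> curvature W k j x =
  curvature G k j x + (E k j x - E j k x) + (D j x *m D k x - D k x *m D j x).
Proof.
move=> Ux.
have C1C c : Ck_mx 1 U (C c) := Ck_mx_add oU (C1p1 c) (C1D c).
have dW c d : partial_mx c (connection W d) x = partial_mx c (A d) x + partial_mx c (C d) x.
  rewrite -(partial_mxD c Ux (Ck_connection hG d) (C1C d)).
  by apply: (partial_mx_eq c oU Ux) => y; rewrite inE => Uy; exact: connection_conformal.
rewrite curvature.unlock !dW !connection_conformal// !partial_C//.
have -> : \sum_m A k x j m *: C m x = \sum_m A j x k m *: C m x.
  by apply: eq_bigr => m _; rewrite AC.
have -> : D j x *m D k x - D k x *m D j x = C j x *m C k x - C k x *m C j x.
  exact: scalar_commutator.
exact: curvature_identity.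
Qed.

Let ep j x : (e j *m p x) = (p x j 0)%:M.
Proof. by rewrite mx11_row_col -rowE mxE. Qed.

Let eg j k x : (e j *m g k x) = (G x j k)%:M.
Proof. by rewrite mx11_row_col -rowE !mxE. Qed.

Let sg k x : U x -> s x *m g k x = (p x k 0)%:M.
Proof.
move=> Ux; rewrite mx11_row_col /g colE mulmxA sG// -colE.
by rewrite !mxE.
Qed.

Let outer_entry (a b c d : R) (p0 g0 : 'cV[R]_n) (s0 : 'rV[R]_n) k i l :
  ((a *: p0 - b *: g0) *m (e k) - (c *: p0 - d *: g0) *m s0) i l =
  (a * p0 i 0 - b * g0 i 0) * (k == l)%:R - (c * p0 i 0 - d * g0 i 0) * s0 0 l.
Proof. by rewrite !mxE !big_ord1 !mxE eqxx/= [l == k]eq_sym; ring. Qed.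

Let DD j k i l x : U x -> (D j x *m D k x) i l =
  (p x j 0 * p x i 0 - N x * G x i j) * (k == l)%:R
  - (p x i 0 * G x j k - p x k 0 * G x i j) * s x 0 l.
Proof.
move=> Ux.
have Dp : D j x *m p x = p x j 0 *: p x - N x *: g j x.
  rewrite /D mulmxBl -[p x *m _ *m _]mulmxA -[g j x *m _ *m _]mulmxA ep.
  rewrite [s x *m p x]mx11_row_col.
  by rewrite !mul_mx_scalar.
have Dg : D j x *m g k x = G x j k *: p x - p x k 0 *: g j x.
  by rewrite /D mulmxBl -[p x *m _ *m _]mulmxA -[g j x *m _ *m _]mulmxA eg sg// !mul_mx_scalar.
have gE : g j x i 0 = G x i j by rewrite mxE.
by rewrite {2}/D mulmxBr [D j x *m (p x *m _)]mulmxA [D j x *m (g k x *m _)]mulmxA Dp Dg outer_entry gE; ring.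
Qed.

(** The Laplacian of f when [p] is the differential of f. *)
Let lap x : R := \sum_k \sum_l h k x l 0 * invmx (G x) l k.

(** Trace of [curvature_conformal]: the factors [n] are traces of the identity, the other terms
    contractions with a Kronecker delta or of the metric with its inverse. In usual notation the
    right-hand side is Ric - (n - 2)(nabla p - p p) - (div p + (n - 2)|p|^2) g. *)
Lemma ricci_conformal i j x : U x -> ricci W i j x = ricci G i j x
  + ((2 - n%:R) * h j x i 0 - G x i j * lap x)
  + (n%:R - 2) * (p x i 0 * p x j 0 - N x * G x i j).
Proof.
move=> Ux; rewrite (ricciE hW i j Ux) (ricciE hG i j Ux).
have delta (F : 'I_n -> R) a : \sum_k F k * (a == k)%:R = F a.
  rewrite (bigD1 a)//= eqxx mulr1 big1 ?addr0// => k /negPf ka.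
  by rewrite eq_sym ka mulr0.
have sumG a : \sum_k G x a k * s x 0 k = p x a 0.
  have := congr1 (fun M : 'rV_n => M 0 a) (sG Ux); rewrite !mxE => <-.
  by apply: eq_bigr => k _; rewrite mulrC (metric_entry_sym hG a k Ux).
have sump : \sum_k p x k 0 * s x 0 k = N x.
  by rewrite /N mxE; apply: eq_bigr => k _; rewrite mulrC.
have E_entry c d l : E c d x i l =
    h c x d 0 * (i == l)%:R + h c x i 0 * (d == l)%:R
    - G x i d * ((h c x)^T *m invmx (G x)) 0 l.
  by rewrite /E; move: ((h c x)^T *m invmx (G x)) => t0; move: (h c x) => h0;
    rewrite !mxE !big_ord1 !mxE eqxx/= [l == d]eq_sym; ring.
have lapE : \sum_k ((h k x)^T *m invmx (G x)) 0 k = lap x.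
  by apply: eq_bigr => k _; rewrite mxE; apply: eq_bigr => l _; rewrite mxE.
have hG_cancel a : \sum_k G x a k * ((h j x)^T *m invmx (G x)) 0 k = h j x a 0.
  have uG := local_metric_unit hG Ux.
  transitivity (((h j x)^T *m invmx (G x) *m G x) 0 a).
    rewrite [RHS]mxE; apply: eq_bigr => k _.
    by rewrite mulrC (metric_entry_sym hG a k Ux).
  by rewrite mulmxKV// mxE.
have sumE1 : \sum_k E k j x i k = h i x j 0 + h j x i 0 - G x i j * lap x.
  rewrite (eq_bigr _ (fun k _ => E_entry k j k)) !big_split/= sumrN -mulr_sumr lapE.
  by rewrite (delta (fun k => h k x j 0)) (delta (fun k => h k x i 0)).
have sumE2 : \sum_k E j k x i k = n%:R * h j x i 0.
  rewrite (eq_bigr _ (fun k _ => E_entry j k k)) !big_split/= sumrN hG_cancel.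
  rewrite (delta (fun k => h j x k 0)) addrAC subrr add0r.
  under eq_bigr do rewrite eqxx mulr1.
  by rewrite sumr_const card_ord mulr_natl.
have sumD1 : \sum_k (D j x *m D k x) i k = n%:R * (p x j 0 * p x i 0 - N x * G x i j)
    - p x i 0 * p x j 0 + G x i j * N x.
  rewrite (eq_bigr _ (fun k _ => DD j k i k Ux)) sumrB.
  under eq_bigr do rewrite eqxx mulr1.
  rewrite sumr_const card_ord -[X in X - _]mulr_natl -addrA; congr (_ + _).
  under eq_bigr do rewrite mulrBl -mulrA mulrAC [X in _ - X]mulrC.
  by rewrite sumrB -!mulr_sumr sumG sump; ring.
have sumD2 : \sum_k (D k x *m D j x) i k = p x i 0 * p x j 0 - N x * G x i j.
  rewrite (eq_bigr _ (fun k _ => DD k j i k Ux)) sumrB.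
  rewrite (delta (fun k => p x k 0 * p x i 0 - N x * G x i k)).
  under eq_bigr => k _ do rewrite mulrBl -!mulrA (metric_entry_sym hG k j Ux).
  by rewrite sumrB -!mulr_sumr !sumG; ring.
transitivity (\sum_k (curvature G k j x i k + (E k j x i k - E j k x i k)
    + ((D j x *m D k x) i k - (D k x *m D j x) i k))).
  apply: eq_bigr => k _; rewrite (curvature_conformal k j Ux).
  by move: (curvature G k j x) (E k j x) (E j k x) => ? ? ?; move: (D j x *m D k x) (D k x *m D j x) => ? ?; rewrite !mxE.
rewrite !big_split/= !sumrN sumE1 sumE2 sumD1 sumD2 (hC i j Ux).
by ring.
Qed.

(** Contraction of [ricci_conformal] with the inverse metric. For w = exp(2 f) and p = df this is
    the classical R - 2 (n - 1) Delta f - (n - 1)(n - 2) |df|^2. *)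
Lemma scalar_conformal x : U x -> w x * local_scalar_curvature W x =
  local_scalar_curvature G x - 2 * (n%:R - 1) * lap x
  - (n%:R - 1) * (n%:R - 2) * N x.
Proof.
move=> Ux; rewrite /local_scalar_curvature.
have uG := local_metric_unit hG Ux.
have wn0 : w x != 0 by rewrite gt_eqF// w0.
have IW a b : w x * invmx (W x) a b = invmx (G x) a b.
  have uwG : w x *: G x \in unitmx by rewrite unitmxZ// unitfE.
  by rewrite WE (invmxZ uwG) mxE mulrA divff// mul1r.
pose I a b := invmx (G x) a b.
have tG : \sum_i \sum_j I i j * G x i j = n%:R.
  transitivity (\tr (invmx (G x) *m G x)); last by rewrite mulVmx// mxtrace1.
  apply: eq_bigr => i _; rewrite mxE; apply: eq_bigr => j _.
  by rewrite (metric_entry_sym hG i j Ux).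
have tp : \sum_i \sum_j I i j * (p x i 0 * p x j 0) = N x.
  rewrite /N mxE exchange_big; apply: eq_bigr => j _.
  rewrite mxE mulr_suml; apply: eq_bigr => i _.
  by rewrite mxE /I; ring.
have th : \sum_i \sum_j I i j * h j x i 0 = lap x.
  rewrite exchange_big; apply: eq_bigr => j _; apply: eq_bigr => i _.
  by rewrite mulrC.
transitivity (\sum_i \sum_j (I i j * ricci G i j x + ((2 - n%:R) * (I i j * h j x i 0)
    - lap x * (I i j * G x i j)) + (n%:R - 2) * (I i j * (p x i 0 * p x j 0)
    - N x * (I i j * G x i j)))).
  rewrite mulr_sumr; apply: eq_bigr => i _; rewrite mulr_sumr; apply: eq_bigr => j _.
  by rewrite mulrA IW (ricci_conformal i j Ux) /I; ring.
under eq_bigr do rewrite !big_split/= sumrN -!mulr_sumr big_split/= sumrN -!mulr_sumr.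
rewrite !big_split/= sumrN -!mulr_sumr big_split/= sumrN -!mulr_sumr.
by rewrite tG tp th; ring.
Qed.

End ConformalChange.

Local Transparent partial christoffel.

Lemma partial_inv (R : realType) (n : nat) (f : 'rV[R]_n -> R) i x : f x != 0 ->
  derivable f x (delta_mx 0 i) ->
  partial i (fun y => (f y)^-1) x = - (f x) ^- 2 * partial i f x.
Proof. by move=> fx0 df; rewrite /partial (deriveV fx0 df). Qed.

Local Opaque partial christoffel.

Lemma laplacianE (R : realType) (n : nat) (G : 'rV[R]_n -> 'M[R]_n) u x :
  laplacian G u x = \sum_i \sum_j hessian G u x i j * invmx (G x) j i.
Proof.
by rewrite laplacian.unlock /mxtrace; apply: eq_bigr => i _; rewrite mxE.
Qed.

Lemma hessian_entry (R : realType) (n : nat) (G : 'rV[R]_n -> 'M[R]_n) u x i j :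
  hessian G u x i j = partial i (partial j u) x -
    \sum_k christoffel G k i j x * partial k u x.
Proof. by rewrite hessian.unlock mxE. Qed.

(** * The conformal factor u^(4/(n-2)) *)

Section PowerConformal.
Context {R : realType} {n : nat}.
Hypothesis n3 : (3 <= n)%N.
Variables (U : set 'rV[R]_n) (G : 'rV[R]_n -> 'M[R]_n).
Hypothesis hG : local_metric U G.
Variable (u : 'rV[R]_n -> R).
Hypotheses (hu : Ck_on 2 U u) (u0 : forall x, U x -> 0 < u x).

Let oU := local_metric_open hG.
(** As w = u^q with q = 2 a, half of the logarithmic derivative of w is a du / u: this is the form
    [p] below. *)
Let a : R := 2 / (n%:R - 2).
Let q : R := 4 / (n%:R - 2).
Let p (x : 'rV[R]_n) : 'cV[R]_n := \col_i (a * (partial i u x * (u x)^-1)).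
Let w (x : 'rV[R]_n) : R := u x `^ q.

Let n2 : n%:R - 2 != 0 :> R.
Proof. by rewrite subr_eq0 eqr_nat gtn_eqF. Qed.

Let hdu i : Ck_on 1 U (partial i u) := Ck_partial i hu.
Let hu1 : Ck_on 1 U u := Ck_pred hu.
Let hv : Ck_on 1 U (fun y => (u y)^-1) := Ck_inv oU u0 hu1.

Let pE j : (fun y => p y j 0) = (fun y => a * (partial j u y * (u y)^-1)).
Proof. by apply/funext => y; rewrite mxE. Qed.

Let hp : Ck_mx 1 U p.
Proof.
move=> i j; rewrite (ord1 j) pE.
exact: CkZ oU (CkM oU (hdu i) hv).
Qed.

Let hw : Ck_on 2 U w := Ck_powR q oU u0 hu.

Let w0 x : U x -> 0 < w x.
Proof. by move=> Ux; apply: powR_gt0; exact: u0. Qed.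

Let dw i x : U x -> partial i w x = 2 * p x i 0 * w x.
Proof.
move=> Ux; have ux0 := u0 Ux.
have E := partial_comp1 (is_derive1_powR q ux0) (Ck_derivable i hu Ux).
rewrite [LHS]E mxE /w powRB ?(gt_eqF ux0) ?implybT// powRr1 ?ltW//.
by rewrite /q /a; field; rewrite n2 gt_eqF.
Qed.

Let quotient_rule (b v di dj dij : R) :
  b * (dij * v + dj * (- v ^+ 2 * di)) = b * (dij * v - v ^+ 2 * (di * dj)).
Proof. by ring. Qed.

Let dp i j x : U x -> partial i (fun y => p y j 0) x =
  a * (partial i (partial j u) x * (u x)^-1 - (u x)^-1 ^+ 2 * (partial i u x * partial j u x)).
Proof.
move=> Ux; have un0 : u x != 0 by rewrite gt_eqF// u0.
have dM := CkM oU (hdu j) hv.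
rewrite pE (partialM (derivable_cst _ _ _) (Ck_derivable i dM Ux)) partial_cst mul0r add0r.
rewrite (partialM (Ck_derivable i (hdu j) Ux) (Ck_derivable i hv Ux)).
rewrite (partial_inv un0 (Ck_derivable i hu1 Ux)) -exprVn; exact: quotient_rule.
Qed.

Let swap_terms (A B b v v2 C D : R) : A = B ->
  b * (A * v - v2 * (C * D)) = b * (B * v - v2 * (D * C)).
Proof. by move=> ->; rewrite [C * D]mulrC. Qed.

Let closed_p i j x : U x ->
  partial i (fun y => p y j 0) x = partial j (fun y => p y i 0) x.
Proof.
move=> Ux.
refine (etrans (dp i j Ux) (etrans _ (esym (dp j i Ux)))).
exact: (swap_terms _ _ _ _ _ (partialC i j oU hu Ux)).
Qed.

Let scaled_quadratic (c : R) (v : 'cV[R]_n) (B : 'M[R]_n) :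
  ((c *: v)^T *m B *m (c *: v)) 0 0 = c ^+ 2 * (v^T *m B *m v) 0 0.
Proof.
have -> : (c *: v)^T = c *: v^T by rewrite linearZ.
by rewrite -!scalemxAl -scalemxAr scalerA [LHS]mxE.
Qed.

(** The exponent 4 / (n - 2) is the one for which the terms in |du|^2 / u^2 cancel: the Laplacian of
    a log u contributes the coefficient 2 (n - 1) a, the quadratic term -(n - 1)(n - 2) a^2, and a =
    2 / (n - 2). *)
Lemma scalar_conformal_power x : U x ->
  w x * u x * local_scalar_curvature (fun x => w x *: G x) x =
  u x * local_scalar_curvature G x - 4 * (n%:R - 1) / (n%:R - 2) * laplacian G u x.
Proof.
move=> Ux; have un0 : u x != 0 by rewrite gt_eqF// u0.
rewrite mulrAC (scalar_conformal hG hw w0 hp dw closed_p (fun=> erefl) Ux).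
have -> : (((p x)^T *m invmx (G x)) *m p x) 0 0 = a ^+ 2 * (u x) ^- 2 * grad_pairing G u u x.
  rewrite grad_pairingE.
  have -> : p x = (a * (u x)^-1) *: gradient u x.
    by apply/matrixP => i j; rewrite !mxE gradient_entry; ring.
  by rewrite scaled_quadratic exprMn exprVn.
have -> : \sum_k \sum_l (partial_mx k p x - connection G k x *m p x) l 0 * invmx (G x) l k =
    a * (u x)^-1 * laplacian G u x - a * (u x) ^- 2 * grad_pairing G u u x.
  rewrite laplacianE grad_pairing.unlock !mulr_sumr -sumrB; apply: eq_bigr => k _.
  rewrite !mulr_sumr -sumrB; apply: eq_bigr => l _.
  rewrite mxE [X in _ + X]mxE [X in _ - X]mxE partial_mxE dp// hessian_entry.
  have -> : \sum_j connection G k x l j * p x j 0 =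
      a * (u x)^-1 * \sum_m christoffel G m k l x * partial m u x.
    rewrite mulr_sumr; apply: eq_bigr => m _; rewrite mxE connection_entry; ring.
  rewrite (metric_inv_entry_sym hG k l Ux); field.
  exact: un0.
by rewrite /a; field; rewrite n2 un0.
Qed.

End PowerConformal.

(** * Divergence form of the Laplacian *)

Section Divergence.
Context {R : realType} {n : nat}.
Variables (U : set 'rV[R]_n) (G : 'rV[R]_n -> 'M[R]_n).
Hypothesis hG : local_metric U G.
Implicit Types (u v : 'rV[R]_n -> R) (i j k : 'I_n) (x y : 'rV[R]_n).

Let oU := local_metric_open hG.
Let C1G : Ck_mx 1 U G := Ck_mx_le (leqnSn 1) (local_metric_C2 hG).
Let C1I : Ck_mx 1 U (fun y => invmx (G y)) := Ck_mx_le (leqnSn 1) (Ck_metric_inv hG).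
Let A := connection G.

Definition volume_density y : R := Num.sqrt (\det (G y)).

Lemma volume_density_gt0 x : U x -> 0 < volume_density x.
Proof. by move=> Ux; rewrite sqrtr_gt0 (local_metric_det hG). Qed.

Lemma Ck_volume_density : Ck_on 2 U volume_density.
Proof.
exact: Ck_sqrt oU (local_metric_det hG) (Ck_det oU (local_metric_C2 hG)).
Qed.

Let C1rho : Ck_on 1 U volume_density := Ck_pred Ck_volume_density.

(** The square of the density is the determinant. Jacobi's formula and metric compatibility give the
    trace of the connection twice, which absorbs the 2 from the square. *)
Lemma partial_volume_density i x : U x ->
  partial i volume_density x = volume_density x * \tr (connection G i x).
Proof.
move=> Ux; have rho0 := volume_density_gt0 Ux; have uG := local_metric_unit hG Ux.
have drho := Ck_derivable i C1rho Ux.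
have sq y : U y -> volume_density y * volume_density y = \det (G y).
  by move=> Uy; rewrite -expr2 sqr_sqrtr// ltW// (local_metric_det hG).
have : partial i (fun y => volume_density y * volume_density y) x =
    partial i (fun y => \det (G y)) x.
  by apply: partial_near_eq; apply: (open_near_eq oU Ux) => y; rewrite inE; exact: sq.
rewrite (partialM drho drho) (partial_det_inv i oU Ux (local_metric_det hG Ux) C1G).
have -> : \tr (partial_mx i G x *m invmx (G x)) =
    \tr (connection G i x) + \tr (connection G i x).
  rewrite (partial_metric hG i Ux) mulmxDl mulmxK// [LHS]linearD/=; congr (_ + _).
  by rewrite mxtrace_mulC mulmxA mulVmx// mul1mx mxtrace_tr.
rewrite -(sq x Ux).
move: (partial i _ x) (\tr _) rho0 => d t; move: (volume_density x) => r r0 E.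
by apply: (mulIf (lt0r_neq0 r0)); lra.
Qed.

(** The field v grad u times the volume density: its Euclidean divergence is the density times its
    Riemannian divergence. *)
Definition flux (v u : 'rV[R]_n -> R) i y : R :=
  v y * (volume_density y * (invmx (G y) *m gradient u y) i 0).

Let C1grad u : Ck_on 2 U u -> Ck_mx 1 U (gradient u).
Proof.
move=> hu i j; rewrite (_ : (fun y => _) = partial i u); first exact: Ck_partial.
by apply/funext => y; rewrite gradient_entry.
Qed.

Lemma Ck_flux v u i : Ck_on 1 U v -> Ck_on 2 U u -> Ck_on 1 U (flux v u i).
Proof.
move=> hv hu; have hX := Ck_mx_mul oU C1I (C1grad hu).
exact: CkM oU hv (CkM oU C1rho (hX i 0)).
Qed.

Let sum_flux (r vx : R) (V T D X : 'I_n -> R) (L g : R) :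
  \sum_i V i * X i = g -> \sum_i (T i * X i + D i) = L ->
  \sum_i (V i * (r * X i) + vx * (r * T i * X i + r * D i)) = r * (vx * L + g).
Proof.
move=> <- <-; rewrite mulrDr !mulr_sumr -big_split/=; apply: eq_bigr => i _; ring.
Qed.

Let regroup_flux (B C : 'M[R]_n) (y z : 'cV[R]_n) :
  (- (B *m C) - C^T *m B) *m y + B *m z = - C^T *m (B *m y) + B *m (z - C *m y).
Proof.
rewrite mulmxBl mulmxBr !mulNmx !mulmxA.
move: (B *m C *m y) (C^T *m B *m y) (B *m z) => x1 x2 x3.
by apply/matrixP => a b; rewrite !mxE; ring.
Qed.

(** Differentiating the density gives traces of connection matrices, differentiating the inverse
    metric gives contractions of them. By symmetry of the lower indices one family cancels part of
    the other, and the rest completes second derivatives of [u] to the Hessian. *)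
Lemma divergence_flux v u x : U x -> Ck_on 1 U v -> Ck_on 2 U u ->
  \sum_i partial i (flux v u i) x =
  volume_density x * (v x * laplacian G u x + grad_pairing G v u x).
Proof.
move=> Ux hv hu; have hX := Ck_mx_mul oU C1I (C1grad hu).
pose X := invmx (G x) *m gradient u x.
pose dX i := partial_mx i (fun y => invmx (G y) *m gradient u y) x.
have E i : partial i (flux v u i) x = partial i v x * (volume_density x * X i 0)
    + v x * (volume_density x * \tr (A i x) * X i 0 + volume_density x * dX i i 0).
  have hrX := CkM oU C1rho (hX i 0).
  rewrite (partialM (Ck_derivable i hv Ux) (Ck_derivable i hrX Ux)).
  rewrite (partialM (Ck_derivable i C1rho Ux) (Ck_derivable i (hX i 0) Ux)).
  by rewrite (partial_volume_density i Ux) /dX partial_mxE.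
rewrite (eq_bigr _ (fun i _ => E i)); apply: sum_flux.
  rewrite grad_pairingE -mulmxA mxE; apply: eq_bigr => i _.
  by rewrite [X in _ = X * _]mxE gradient_entry.
have dXE i : dX i = - (A i x)^T *m X + invmx (G x) *m (partial_mx i (gradient u) x - A i x *m gradient u x).
  rewrite /dX (partial_mxM i Ux C1I (C1grad hu)) (partial_metric_inv hG i Ux).
  exact: regroup_flux.
have hE i l : (partial_mx i (gradient u) x - A i x *m gradient u x) l 0 = hessian G u x i l.
  rewrite mxE [X in _ + X]mxE [X in _ - X]mxE partial_mxE hessian_entry.
  congr (_ - _); last by apply: eq_bigr => k _; rewrite connection_entry gradient_entry.
  by congr (partial i _ x); apply/funext => y; rewrite gradient_entry.
have AX i : (A i x)^T *m X = \col_l \sum_k A i x k l * X k 0.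
  by apply/matrixP => a b; rewrite !mxE (ord1 b); apply: eq_bigr => k _; rewrite mxE.
transitivity (\sum_i (\tr (A i x) * X i 0 - \sum_k A i x k i * X k 0)
   + \sum_i \sum_l invmx (G x) i l * hessian G u x i l).
  rewrite -big_split/=; apply: eq_bigr => i _; rewrite dXE mulNmx AX -addrA; congr (_ + _).
  rewrite mxE [X in X + _]mxE [X in - X]mxE; congr (_ + _).
  by rewrite mxE; apply: eq_bigr => l _; rewrite hE.
rewrite laplacianE sumrB [X in _ - X]exchange_big/= [X in X - _](_ : _ =
    \sum_i \sum_k A k x i k * X i 0); last first.
  apply: eq_bigr => i _; rewrite mulr_suml; apply: eq_bigr => k _.
  by rewrite /A !connection_entry (christoffelC hG).
rewrite subrr add0r; apply: eq_bigr => i _; apply: eq_bigr => l _.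
by rewrite mulrC (metric_inv_entry_sym hG).
Qed.

End Divergence.

(** * Lebesgue measure on R^n *)

Local Transparent partial christoffel.

Lemma borel_open (M : ptopologicalType) (A : set M) : open A -> measurable (A : set (borel M)).
Proof. exact: sub_sigma_algebra. Qed.

Lemma borel_closed (M : ptopologicalType) (A : set M) :
  closed A -> measurable (A : set (borel M)).
Proof. by move=> cA; rewrite -(setCK A); apply: measurableC; apply: borel_open; exact: closed_openC. Qed.

Lemma measurable_fun_borel d (T : measurableType d) (N : ptopologicalType) (D : set T)
    (f : T -> borel N) :
  (forall O : set N, open O -> measurable (D `&` f @^-1` O)) -> measurable_fun D f.
Proof.
move=> h; apply: (@measurability _ _ T (borel N) D f (@open N)) => //.
move=> _ [V oV <-]; exact: h.
Qed.

Lemma continuous_borel (R : realType) (M : ptopologicalType) (f : M -> R) : continuous f ->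
  measurable_fun [set: borel M] (f : borel M -> R).
Proof.
move=> /continuousP cf; apply: (measurability _ (RGenOpens.measurableE R)).
move=> _ [_ [a [b ->] <-]]; rewrite setTI; apply: borel_open.
exact/cf/interval_open.
Qed.

(** * Borel sets of R^n and products *)

Section SeparableRow.
Context {R : realType} {n : nat}.

Lemma dense_rat_row (x : 'rV[R]_n) (e : R) : 0 < e ->
  exists c : 'rV[rat]_n, `|x - map_mx ratr c| < e.
Proof.
move=> e0.
have h i : exists q : rat, ratr q \in `]x 0 i - e / 2, x 0 i[.
  by apply: rat_in_itvoo; rewrite gtrBl divr_gt0.
exists (\row_i sval (cid (h i))); apply: (@le_lt_trans _ _ (e / 2)); last first.
  by rewrite ltr_pdivrMr// ltr_pMr// ltr1n.
apply: rV_norm_le => [|i]; first by rewrite divr_ge0 ?ltW.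
rewrite !mxE; case: cid => q /=; rewrite in_itv/= => /andP[q1 q2].
by rewrite ger0_norm ?subr_ge0 ?ltW//; rewrite ltrBlDl -ltrBlDr.
Qed.

Let rational_ball (ck : 'rV[rat]_n * nat) : set 'rV[R]_n :=
  ball (map_mx ratr ck.1 : 'rV[R]_n) (ck.2.+1%:R^-1).

(** A rational centre within 1 / (k + 1) < e / 2 of [x] gives a ball of that radius which contains
    [x] and stays within [e] of it; countably many such balls exist. *)
Lemma open_rational_balls (O : set 'rV[R]_n) : open O ->
  O = \bigcup_(ck in [set ck | rational_ball ck `<=` O]) rational_ball ck.
Proof.
move=> oO; apply/seteqP; split=> [x Ox|x [ck /= sub]]; last exact: sub.
have /nbhs_ballP[e /= e0 xeO] : nbhs x O by exact: open_nbhs_nbhs.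
have [k ke] : exists k : nat, k.+1%:R^-1 < e / 2.
  have [k _ hk] := near_infty_natSinv_lt (PosNum (divr_gt0 e0 (ltr0n R 2))).
  by exists k; have := hk k (leqnn k).
have k0 : 0 < (k.+1%:R : R)^-1 by rewrite invr_gt0.
have [c xc] := dense_rat_row x k0.
exists (c, k) => /=; last by rewrite /rational_ball /= -ball_normE /= distrC.
move=> y; rewrite /rational_ball /= -ball_normE /= => yc; apply: xeO.
rewrite -ball_normE /= -(subrKA (map_mx ratr c)).
apply: (le_lt_trans (ler_normD _ _)); rewrite (splitr e).
by apply: ltrD; exact: lt_trans ke.
Qed.

(** Only balls need be tested, because an open set is a countable union of rational ones, here
    enumerated by [unpickle]. *)
Lemma measurable_preimage_open d (T : measurableType d) (f : T -> 'rV[R]_n) :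
  (forall c r, measurable (f @^-1` ball (c : 'rV[R]_n) r)) ->
  forall O, open O -> measurable (f @^-1` O).
Proof.
move=> hf O oO; rewrite (open_rational_balls oO) preimage_bigcup.
rewrite (_ : \bigcup_(_ in _) _ = \bigcup_k (if unpickle k is Some ck then
    (if `[< rational_ball ck `<=` O >] then f @^-1` rational_ball ck else set0) else set0)).
  apply: bigcupT_measurable => k; case: unpickle => // ck; case: ifP => // _.
  exact: hf.
apply/seteqP; split=> x.
  move=> [ck /= ckO fx]; exists (pickle ck) => //; rewrite pickleK.
  by case: asboolP.
move=> [k _]; case: unpickle => // ck; case: asboolP => // ckO fx.
by exists ck.
Qed.

End SeparableRow.

(* Syntactically the vectors that occur in lebesgue_integral_rV. *)
HB.lock Definition cons_row (R : realType) (m : nat) (tx : R * 'rV[R]_m) : 'rV[R]_m.+1 :=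
  row_mx (const_mx tx.1 : 'rV[R]_1) tx.2.

Section ConsRow.
Context {R : realType} {m : nat}.
Implicit Types (t r s : R) (x y : 'rV[R]_m).

Lemma cons_row0 t x : cons_row (t, x) 0 ord0 = t.
Proof.
rewrite [@cons_row]cons_row.unlock; transitivity (row_mx (const_mx t : 'rV[R]_1) x 0 (lshift m (ord0 : 'I_1))).
  by congr (fun_of_matrix _ _ _); exact/val_inj.
by rewrite row_mxEl mxE.
Qed.

Lemma cons_rowS t x i : cons_row (t, x) 0 (lift ord0 i) = x 0 i.
Proof.
rewrite [@cons_row]cons_row.unlock; transitivity (row_mx (const_mx t : 'rV[R]_1) x 0 (rshift 1 i)).
  by congr (fun_of_matrix _ _ _); exact/val_inj.
by rewrite row_mxEr.
Qed.

Lemma cons_row_eq (y : 'rV[R]_m.+1) (t : R) (x : 'rV[R]_m) : y 0 ord0 = t ->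
  (forall i, y 0 (lift ord0 i) = x 0 i) -> y = cons_row (t, x).
Proof.
move=> y0 yS; apply/rowP => j; case: (unliftP ord0 j) => [i|] ->.
  by rewrite yS cons_rowS.
by rewrite y0 cons_row0.
Qed.

Lemma cons_row_norm_le t x r : `|cons_row (t, x)| <= r <-> `|t| <= r /\ `|x| <= r.
Proof.
split=> [h|[ht hx]].
  have r0 : 0 <= r by exact: le_trans h.
  split; first by rewrite -(cons_row0 t x); exact: le_trans (rV_norm_ge _ _) h.
  by apply: rV_norm_le => // i; rewrite -(cons_rowS t x); exact: le_trans (rV_norm_ge _ _) h.
apply: rV_norm_le => [|j]; first exact: le_trans ht.
case: (unliftP ord0 j) => [i|] ->; last by rewrite cons_row0.
by rewrite cons_rowS; exact: le_trans (rV_norm_ge _ _) hx.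
Qed.

Lemma cons_rowB t x t' x' : cons_row (t, x) - cons_row (t', x') = cons_row (t - t', x - x').
Proof.
apply: cons_row_eq => [|i]; first by rewrite !mxE !cons_row0.
by rewrite [LHS]mxE [X in _ + X]mxE !cons_rowS !mxE.
Qed.

Lemma cons_row_norm t x : `|cons_row (t, x)| = Num.max `|t| `|x|.
Proof.
apply/le_anti/andP; split.
  by apply/cons_row_norm_le; rewrite !le_max !lexx orbT.
by have /cons_row_norm_le[h1 h2] := lexx `|cons_row (t, x)|; rewrite ge_max h1.
Qed.

Lemma continuous_cons_row_r t : continuous (fun x => cons_row (t, x)).
Proof.
move=> x B /nbhs_ballP[e /= e0 eB]; apply/nbhs_ballP; exists e => //= y xy; apply: eB.
by move: xy; rewrite -!ball_normE/= => xy; rewrite cons_rowB subrr cons_row_norm normr0 gt_max e0.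
Qed.

Lemma continuous_cons_row_l x : continuous (fun t => cons_row (t, x)).
Proof.
move=> t B /nbhs_ballP[e /= e0 eB]; apply/nbhs_ballP; exists e => //= s ts; apply: eB.
by move: ts; rewrite -!ball_normE/= => ts; rewrite cons_rowB subrr cons_row_norm normr0 gt_max e0 ts.
Qed.

(** In the maximum norm the preimage of a ball is a product of two balls. *)
Lemma measurable_cons_row :
  measurable_fun [set: (measurableTypeR R * borel 'rV[R]_m)%type]
    (@cons_row R m : (measurableTypeR R * borel 'rV[R]_m)%type -> borel 'rV[R]_m.+1).
Proof.
apply: measurable_fun_borel => O oO; rewrite setTI; move: O oO.
apply: measurable_preimage_open => c r.
pose c0 := c 0 ord0; pose c1 : 'rV[R]_m := \row_i c 0 (lift ord0 i).
have -> : c = cons_row (c0, c1) by apply: cons_row_eq => // i; rewrite mxE.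
rewrite (_ : _ @^-1` _ = ball (c0 : R) r `*` ball (c1 : 'rV[R]_m) r).
  apply: measurableX; first exact: measurable_ball.
  by apply: borel_open; exact: ball_open.
apply/seteqP; split=> -[t x] /=; rewrite -!ball_normE/= cons_rowB cons_row_norm gt_max.
  by move=> /andP[].
by move=> [-> ->].
Qed.

End ConsRow.

Section MeasureLemmas.
Context d (T : measurableType d) (R : realType).
Implicit Types (mu : {measure set T -> \bar R}) (A : set T) (g : T -> R).

Lemma integrable_bounded_support mu A g (M : R) : measurable A -> (mu A < +oo)%E ->
  measurable_fun setT g -> (forall x, `|g x| <= M) -> (forall x, ~ A x -> g x = 0) ->
  mu.-integrable setT (EFin \o g).
Proof.
move=> mA Afin mg gM g0; apply/integrableP; split; first exact/measurable_EFinP.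
rewrite (_ : (fun x => _) = (fun x => `|(EFin \o g) x|%E) \_ A); last first.
  apply/funext => x; rewrite patchE; case: ifPn => // /negP; rewrite inE => /g0 /= ->.
  by rewrite normr0.
rewrite -integral_mkcond.
apply: (@le_lt_trans _ _ (\int[mu]_(x in A) (cst M%:E) x)%E).
  apply: ge0_le_integral => //.
  - apply: measurableT_comp => //; apply: measurable_funTS; exact/measurable_EFinP.
  - by move=> x _; rewrite /= lee_fin.
rewrite integral_cst//.
have [->|/set0P[x _]] := eqVneq A set0; first by rewrite measure0 mule0.
by rewrite lte_mul_pinfty ?lee_fin//; exact: le_trans (gM x).
Qed.

Section SigmaFiniteCopy.
Variables (mu : {measure set T -> \bar R}) (h : sigma_finite setT mu).
(** [mu] again, under a name that carries the proof of sigma-finiteness, so that product measures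
    can be formed with it. *)
Definition sigma_finite_copy (_ : sigma_finite setT mu) : set T -> \bar R := mu.
HB.instance Definition _ := Measure.copy (sigma_finite_copy h) mu.
HB.instance Definition _ := @Measure_isSigmaFinite.Build _ _ _ (sigma_finite_copy h) h.
End SigmaFiniteCopy.

End MeasureLemmas.

(* lebesgue_integral_rV as integration against a measure; the last clause is all
   that Green's identity needs of Fubini's theorem. *)
Record euclidean_measure (R : realType) (n : nat)
    (lam : {measure set (borel 'rV[R]_n) -> \bar R}) : Prop := EuclideanMeasure {
  euclidean_integral : forall f : borel 'rV[R]_n -> \bar R, measurable_fun setT f ->
    (forall x, 0 <= f x)%E -> (\int[lam]_x f x)%E = lebesgue_integral_rV f ;
  euclidean_ball : forall r : R, (lam [set x : 'rV[R]_n | (`|x| <= r)%R] < +oo)%E ;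
  euclidean_divergence : forall (F : 'rV[R]_n -> R) i r, Ck_on 1 setT F ->
    (forall x, r < `|x| -> F x = 0) -> (\int[lam]_x (partial i F x)%:E)%E = 0%E
}.

Section EuclideanMeasure.
Context {R : realType}.

Lemma closed_norm_ball n r : closed [set x : 'rV[R]_n | `|x| <= r].
Proof.
rewrite (_ : [set x | _] = (fun x : 'rV[R]_n => `|x|) @^-1` [set t | t <= r])//.
apply: closed_comp; last exact: closed_le.
by move=> x _; exact: norm_continuous.
Qed.

Lemma measurable_norm_ball n r :
  measurable ([set x : 'rV[R]_n | `|x| <= r] : set (borel 'rV[R]_n)).
Proof. by apply: borel_closed; exact: closed_norm_ball. Qed.

Lemma euclidean_sigma_finite n (lam : {measure set (borel 'rV[R]_n) -> \bar R}) :
  euclidean_measure lam -> sigma_finite setT lam.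
Proof.
move=> hlam; exists (fun k => [set x : 'rV[R]_n | `|x| <= k%:R]).
  apply/seteqP; split=> // x _; exists (Num.truncn `|x|).+1 => //=.
  by apply: ltW; apply: truncnS_gt.
by move=> k; split; [exact: measurable_norm_ball|exact: euclidean_ball].
Qed.

Lemma continuous_supp_bounded n (g : 'rV[R]_n -> R) r : continuous g ->
  (forall x, r < `|x| -> g x = 0) -> exists M, forall x, `|g x| <= M.
Proof.
move=> cg g0; set B := [set x : 'rV[R]_n | `|x| <= `|r|].
have cB : compact B.
  apply: bounded_closed_compact; last exact: closed_norm_ball.
  exists `|r|; split; first exact: num_real.
  by move=> M rM x /= /le_trans; apply; exact: ltW.
have [||c _ hc] := @compact_EVT_max _ R (fun x => `|g x|) B _ cB.
- by exists 0; rewrite /B/= normr0.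
- apply: continuous_subspaceT => x; apply: continuous_comp; first exact: cg.
  exact: norm_continuous.
exists `|g c| => x; have [xr|xr] := leP `|x| `|r|.
  by apply: hc; rewrite inE.
by rewrite g0 ?normr0//; exact: le_lt_trans (ler_norm r) xr.
Qed.

Lemma partial_supp n (F : 'rV[R]_n -> R) i r x : (forall x, r < `|x| -> F x = 0) ->
  r < `|x| -> partial i F x = 0.
Proof.
move=> F0 rx; rewrite -(partial_cst (0 : R) i x); apply: partial_near_eq.
have oV : open [set y : 'rV[R]_n | r < `|y|].
  rewrite (_ : [set y | _] = (fun y : 'rV[R]_n => `|y|) @^-1` [set t | r < t])//.
  apply: open_comp; last exact: open_gt.
  by move=> y _; exact: norm_continuous.
by apply: (open_near_eq oV) => // y; rewrite inE; exact: F0.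
Qed.

Section Sections.
Context {m : nat}.
Implicit Types (F : 'rV[R]_m.+1 -> R) (t s : R) (x : 'rV[R]_m).

Lemma cons_row_line0 t s x : s *: delta_mx 0 ord0 + cons_row (t, x) = cons_row (s + t, x).
Proof.
apply: cons_row_eq => [|i]; rewrite [LHS]mxE [X in X + _]mxE mxE eqxx/=.
  by rewrite mulr1 cons_row0.
by rewrite cons_rowS mulr0 add0r.
Qed.

Lemma cons_row_lineS t s x (j : 'I_m) :
  s *: delta_mx 0 (lift ord0 j) + cons_row (t, x) = cons_row (t, s *: delta_mx 0 j + x).
Proof.
apply: cons_row_eq => [|i]; rewrite [LHS]mxE [X in X + _]mxE mxE eqxx/=.
  by rewrite mulr0 add0r cons_row0.
by rewrite cons_rowS !mxE eqxx/= (inj_eq (@lift_inj _ ord0)).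
Qed.

(** Difference quotients of [F] in the direction [lift ord0 j] are literally those of the section in
    the direction [j]. *)
Lemma section_cons_row F t : Ck_on 1 setT F ->
  Ck_on 1 setT (fun x => F (cons_row (t, x))) /\
  forall j x, partial (lift ord0 j) F (cons_row (t, x)) =
    partial j (fun x => F (cons_row (t, x))) x.
Proof.
move=> hF.
have q j x : (fun h : R => h^-1 *: (F (h *: delta_mx 0 (lift ord0 j) + cons_row (t, x))
      - F (cons_row (t, x)))) =
    (fun h : R => h^-1 *: (F (cons_row (t, h *: delta_mx 0 j + x)) - F (cons_row (t, x)))).
  by apply/funext => h; rewrite cons_row_lineS.
have E j x : partial (lift ord0 j) F (cons_row (t, x)) =
    partial j (fun x => F (cons_row (t, x))) x.
  by rewrite /partial /derive q.
have cF : forall x, [set: 'rV[R]_m] x -> {for x, continuous (fun x => F (cons_row (t, x)))}.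
  move=> x _; apply: (@continuous_comp _ _ _ (fun x => cons_row (t, x)) F).
    exact: continuous_cons_row_r.
  exact: Ck_cont hF _.
split=> //; apply: Ck_intro => // [j x _|j].
  by have := Ck_derivable (lift ord0 j) hF (I : setT (cons_row (t, x)));
    rewrite /derivable q.
split=> // x _; rewrite (_ : partial j _ = fun x => partial (lift ord0 j) F (cons_row (t, x))).
  apply: (@continuous_comp _ _ _ (fun x => cons_row (t, x))).
    exact: continuous_cons_row_r.
  exact: Ck_cont (Ck_partial (lift ord0 j) hF) _.
by apply/funext => y; rewrite E.
Qed.

(** The fundamental theorem of calculus on an interval whose end points lie outside the support. *)
Lemma integral_partial_ord0 F r x : Ck_on 1 setT F ->
  (forall y, r < `|y| -> F y = 0) ->
  (\int[@lebesgue_measure R]_t (partial ord0 F (cons_row (t, x)))%:E = 0)%E.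
Proof.
(* The radius [r] may be negative; [b] is positive and exceeds it strictly. *)
move=> hF F0; pose b : R := `|r| + 1; pose phi t := F (cons_row (t, x)).
pose g t := partial ord0 F (cons_row (t, x)).
have b0 : 0 < b by rewrite ltr_wpDl.
have rb : r < b by apply: le_lt_trans (ler_norm r) _; rewrite ltrDl.
have phi0 t : r < `|t| -> phi t = 0.
  by move=> rt; rewrite /phi F0// cons_row_norm lt_max rt.
have g0 t : r < `|t| -> g t = 0.
  by move=> rt; apply: (@partial_supp _ F ord0 r (cons_row (t, x)) F0);
    rewrite cons_row_norm lt_max rt.
have dphi t : is_derive t 1 phi (g t).
  have q : (fun h : R => h^-1 *: (F (h *: delta_mx 0 ord0 + cons_row (t, x))
      - F (cons_row (t, x)))) = (fun h : R => h^-1 *: (phi (h *: 1 + t) - phi t)).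
    by apply/funext => h; rewrite cons_row_line0 [h *: 1]mulr1.
  have d := Ck_derivable ord0 hF (I : setT (cons_row (t, x))).
  by apply: DeriveDef; [move: d; rewrite /derivable q|rewrite /g /partial /derive q].
have cg : continuous g.
  move=> t; apply: (@continuous_comp _ _ _ (fun t => cons_row (t, x)) (partial ord0 F)).
    exact: continuous_cons_row_l.
  exact: Ck_cont (Ck_partial ord0 hF) _.
have cphi : continuous phi.
  move=> t; apply: (@continuous_comp _ _ _ (fun t => cons_row (t, x)) F).
    exact: continuous_cons_row_l.
  exact: Ck_cont hF _.
transitivity (\int[@lebesgue_measure R]_(t in `[(- b)%R, b]) (g t)%:E)%E.
  rewrite [RHS]integral_mkcond; apply: eq_integral => t _; rewrite patchE.
  case: ifPn => // /negP tb; rewrite -/(g t) g0//; apply: lt_le_trans rb _.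
  rewrite leNgt; apply/negP => /ltW tb'; apply: tb.
  by rewrite inE /= in_itv/= -ler_norml.
rewrite (@continuous_FTC2 _ g phi).
- rewrite phi0 ?gtr0_norm// phi0; first by rewrite sube0.
  by rewrite normrN gtr0_norm.
- by rewrite gtrN.
- exact: continuous_subspaceT.
- split=> [t _||].
  + by have [] := dphi t.
  + exact/cvg_at_right_filter/cphi.
  + exact/cvg_at_left_filter/cphi.
- by move=> t _; rewrite derive1E; have [] := dphi t.
Qed.

End Sections.

(** * Induction step from R^m to R^(m+1) *)

Section Step.
Variables (m : nat) (lam : {sigma_finite_measure set (borel 'rV[R]_m) -> \bar R}).
Hypothesis hlam : euclidean_measure lam.

Let prod := (@lebesgue_measure R \x lam)%E.
Let psi : (measurableTypeR R * borel 'rV[R]_m)%type -> borel 'rV[R]_m.+1 := @cons_row R m.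
Let mpsi : measurable_fun setT psi := measurable_cons_row.

(** Lebesgue measure as the image of a product measure: Tonelli's theorem turns integration against
    it into the recursion of [lebesgue_integral_rV]. *)
Definition cons_measure : set (borel 'rV[R]_m.+1) -> \bar R := pushforward prod psi.
HB.instance Definition _ := Measure.copy cons_measure
  (@measure_function_pushforward__canonical__measure_function_Measure _ _ _ _ _ prod psi mpsi).

Let cons_integral (f : borel 'rV[R]_m.+1 -> \bar R) : measurable_fun setT f ->
  (forall x, 0 <= f x)%E -> (\int[cons_measure]_x f x)%E = lebesgue_integral_rV f.
Proof.
move=> mf f0.
have mfpsi : measurable_fun setT (f \o psi) by exact: measurableT_comp.
rewrite ge0_integral_pushforward// preimage_setT fubini_tonelli1//=.
apply: eq_integral => t _; rewrite /fubini_F.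
rewrite (euclidean_integral hlam (measurable_fun_pair2 t mfpsi)); last first.
  by move=> x; exact: f0.
by rewrite /psi [@cons_row]cons_row.unlock.
Qed.

Let cons_ball (r : R) : (cons_measure [set x : 'rV[R]_m.+1 | (`|x| <= r)%R] < +oo)%E.
Proof.
rewrite /cons_measure /pushforward (_ : psi @^-1` _ =
    `[- r, r]%classic `*` [set x : 'rV[R]_m | `|x| <= r]); last first.
  apply/seteqP; split=> -[t x] /=; rewrite in_itv/= -ler_norml.
    by move/cons_row_norm_le.
  by move=> h; exact/cons_row_norm_le.
rewrite /prod product_measure1E//; last exact: measurable_norm_ball.
rewrite lte_mul_pinfty//; last exact: euclidean_ball.
suff H : @lebesgue_measure R `[- r, r]%classic \is a fin_num by exact: H.
by rewrite lebesgue_measure_itv/=; case: ifP.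
Qed.

Let integrable_cons (g : 'rV[R]_m.+1 -> R) r : continuous g ->
  (forall x, r < `|x| -> g x = 0) -> prod.-integrable setT (EFin \o g \o psi).
Proof.
move=> cg g0; have [M gM] := continuous_supp_bounded cg g0.
apply: (@integrable_bounded_support _ _ _ _ (psi @^-1` [set x : 'rV[R]_m.+1 | `|x| <= r])
    (g \o psi) M) => //.
- by rewrite -[X in measurable X]setTI; apply: mpsi => //; exact: measurable_norm_ball.
- exact: cons_ball.
- by apply: measurableT_comp => //; exact: continuous_borel.
- by move=> tx; exact: gM.
- by move=> -[t x] /= /negP; rewrite -ltNge; exact: g0.
Qed.

(** The order of integration follows the direction. For the first coordinate [t] is integrated
    first, by [integral_partial_ord0]; for the others [x] is, and the induction hypothesis applies
    to the sections. *)
Let cons_divergence (F : 'rV[R]_m.+1 -> R) i r : Ck_on 1 setT F ->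
  (forall x, r < `|x| -> F x = 0) -> (\int[cons_measure]_x (partial i F x)%:E)%E = 0%E.
Proof.
move=> hF F0.
have cg : continuous (partial i F) by move=> x; exact: Ck_cont (Ck_partial i hF) _.
have g0 x : r < `|x| -> partial i F x = 0 by exact: partial_supp.
have ig := integrable_cons cg g0.
rewrite integral_pushforward//; last first.
  by apply/measurable_EFinP; exact: continuous_borel.
rewrite preimage_setT.
case: (unliftP ord0 i) => [j|] iE; last first.
  rewrite -integral21_prod_meas1//; apply: integral0_eq => x _; rewrite /fubini_G.
  by rewrite iE; exact: (integral_partial_ord0 x hF F0).
rewrite -integral12_prod_meas1//; apply: integral0_eq => t _; rewrite /fubini_F.
have [hFt partialF] := section_cons_row t hF.
rewrite -(euclidean_divergence hlam j (r := r) hFt); last first.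
  by move=> x rx; rewrite /= F0// cons_row_norm lt_max rx orbT.
by apply: eq_integral => x _; rewrite -partialF iE.
Qed.

Lemma euclidean_cons_measure : euclidean_measure cons_measure.
Proof. split; [exact: cons_integral|exact: cons_ball|exact: cons_divergence]. Qed.

End Step.

(** In dimension 0 the measure is the unit mass at the only point, and the divergence clause is void
    for want of an index. *)
Lemma euclidean_measure_exists n :
  exists lam : {sigma_finite_measure set (borel 'rV[R]_n) -> \bar R}, euclidean_measure lam.
Proof.
elim: n => [|m [lam hlam]].
  exists (\d_ (0 : borel 'rV[R]_0)) ; split.
  - move=> f mf f0; rewrite integral_dirac// diracT mul1e.
    by [].
  - move=> r; set B := [set x | _].
    suff : (\d_ (0%R : borel 'rV[R]_0) B < +oo :> \bar R)%E by [].
    by rewrite diracE ltry.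
  - by move=> F [].
have h := euclidean_cons_measure hlam.
by exists (sigma_finite_copy (euclidean_sigma_finite h)).
Qed.

End EuclideanMeasure.

(** * Tensors and functions on the manifold *)

Section Charts.
Context {R : realType} {n : nat} {M : ptopologicalType} (A : smooth_atlas R n M).
Implicit Types (c d : chart R n M) (p : M) (x : 'rV[R]_n) (g : tensor_field R n M).

Definition chart_image c : set 'rV[R]_n := coord c @` dom c.
Definition metric_in g c x : 'M[R]_n := g c (param c x).

Lemma chart_imageP c x : chart_image c x -> dom c (param c x) /\ coord c (param c x) = x.
Proof. by move=> [p dp <-]; rewrite coordK. Qed.

Lemma chart_image_coord c p : dom c p -> chart_image c (coord c p).
Proof. by move=> dp; exists p. Qed.

Lemma local_metric_chart g c : C2_metric A g -> charts A c ->
  local_metric (chart_image c) (metric_in g c).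
Proof.
move=> hg hc; split.
- exact: img_open.
- by move=> x /chart_imageP[dp _]; exact: (metric_sym hg hc dp).
- move=> x /chart_imageP[dp _]; apply: posdef_det_gt0.
  exact: (metric_pos hg hc dp).
- by move=> i j; exact: (metric_C2 hg hc i j).
Qed.

Definition overlap c d : set 'rV[R]_n := coord c @` (dom c `&` dom d).

Lemma overlapP c d x : overlap c d x <-> chart_image c x /\ dom d (param c x).
Proof.
split=> [[p [cp dp] <-]|[/chart_imageP[cx xE] dx]].
  by split; [exact: chart_image_coord|rewrite coordK].
by exists (param c x).
Qed.

Lemma open_overlap c d : open (overlap c d).
Proof.
have -> : overlap c d = chart_image c `&` (param c @^-1` dom d).
  by apply/seteqP; split=> x /overlapP.
rewrite openE => x [cx dx]; apply: filterI.
  by apply: open_nbhs_nbhs; split => //; exact: img_open.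
have cp := @param_continuous _ _ _ c x cx.
by apply: cp; apply: open_nbhs_nbhs; split => //; exact: dom_open.
Qed.

Section Transition.
Variables (c d : chart R n M).
Hypotheses (hc : charts A c) (hd : charts A d).

Lemma transition_image x : overlap c d x -> chart_image d (transition c d x).
Proof. by move=> /overlapP[_ dx]; exact: chart_image_coord. Qed.

Lemma transition_continuous x : overlap c d x -> {for x, continuous (transition c d)}.
Proof.
move=> /overlapP[cx dx]; apply: continuous_comp; first exact: param_continuous.
exact: coord_continuous.
Qed.

Lemma transition_Ck k j : Ck_on k (overlap c d) (fun y => transition c d y 0 j).
Proof. exact: (charts_compatible hc hd k j). Qed.

Lemma param_transition x : overlap c d x -> param d (transition c d x) = param c x.
Proof. by move=> /overlapP[_ dx]; rewrite /transition/= coordK. Qed.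

Lemma overlap_local_metric g : C2_metric A g -> local_metric (overlap c d) (metric_in g c).
Proof.
move=> hg; have hl := local_metric_chart hg hc.
have sub : overlap c d `<=` chart_image c by move=> x /overlapP[].
split; first exact: open_overlap.
- by move=> x /sub; exact: (local_metric_sym hl).
- by move=> x /sub; exact: (local_metric_det hl).
- by move=> i j; apply: Ck_sub sub _; exact: (local_metric_C2 hl i j).
Qed.

Lemma metric_transition g x : C2_metric A g -> overlap c d x ->
  metric_in g c x = jacobian (transition c d) x *m metric_in g d (transition c d x)
    *m (jacobian (transition c d) x)^T.
Proof.
move=> hg hx; have /overlapP[/chart_imageP[cx xE] dx] := hx.
rewrite /metric_in (param_transition hx).
have /= := metric_change hg hc hd cx dx.
by rewrite xE.
Qed.

Lemma scalar_curvature_overlap g p : C2_metric A g -> dom c p -> dom d p ->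
  local_scalar_curvature (metric_in g c) (coord c p) =
  local_scalar_curvature (metric_in g d) (coord d p).
Proof.
move=> hg cp dp; have ov : overlap c d (coord c p) by exists p.
have E := @scalar_change _ _ (overlap c d) (chart_image d) (transition c d)
  _ _ (overlap_local_metric hg) (local_metric_chart hg hd) transition_image
  transition_continuous (transition_Ck 3) (jacobian (transition c d))
  (fun _ _ => erefl) (fun x => @metric_transition g x hg) _ ov.
by rewrite E /transition/= coordK.
Qed.

Lemma grad_pairing_overlap g (f h : M -> R) p : C2_metric A g -> dom c p -> dom d p ->
  Ck_on 1 (chart_image d) (f \o param d) -> Ck_on 1 (chart_image d) (h \o param d) ->
  grad_pairing (metric_in g c) (f \o param c) (h \o param c) (coord c p) =
  grad_pairing (metric_in g d) (f \o param d) (h \o param d) (coord d p).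
Proof.
move=> hg cp dp hf hh; have ov : overlap c d (coord c p) by exists p.
have E := @grad_pairing_change _ _ (overlap c d) (chart_image d) (transition c d)
  _ _ (overlap_local_metric hg) (local_metric_chart hg hd) transition_image
  (transition_Ck 3) (jacobian (transition c d))
  (fun _ _ => erefl) (fun x => @metric_transition g x hg) _ _ _ ov hf hh.
have -> : coord d p = transition c d (coord c p) by rewrite /transition/= coordK.
rewrite -E !grad_pairingE.
have G (k : M -> R) : gradient (k \o param c) (coord c p) =
    gradient ((k \o param d) \o transition c d) (coord c p).
  have N : {in overlap c d, k \o param c =1 (k \o param d) \o transition c d}.
    by move=> y; rewrite inE => oy; rewrite /= -(param_transition oy).
  apply/matrixP => i j; rewrite !gradient_entry.
  have Q := open_near_eq (@open_overlap c d) ov N.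
  exact: (@partial_near_eq _ _ _ _ i _ Q).
by rewrite !G.
Qed.

End Transition.

Lemma chart_at_charts p : charts A (chart_at A p).
Proof. by rewrite /chart_at; case: cid2. Qed.

Lemma chart_at_dom p : dom (chart_at A p) p.
Proof. by rewrite /chart_at; case: cid2. Qed.

Lemma scalar_curvature_chart g c p : C2_metric A g -> charts A c -> dom c p ->
  scalar_curvature A g p = local_scalar_curvature (metric_in g c) (coord c p).
Proof.
move=> hg hc cp.
exact: (scalar_curvature_overlap (chart_at_charts p) hc hg (chart_at_dom p) cp).
Qed.

Lemma conformal_C2_metric (u : M -> R) g : C2_function A u -> (forall p, 0 < u p) ->
  C2_metric A g -> C2_metric A (conformal u g).
Proof.
move=> hu u0 hg; split.
- by move=> c p hc cp; rewrite /conformal linearZ/= (metric_sym hg).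
- move=> c p hc cp v v0; rewrite /conformal -scalemxAr -scalemxAl mxE.
  by rewrite mulr_gt0 ?powR_gt0//; exact: (metric_pos hg hc cp v0).
- move=> c hc i j; have oU : open (coord c @` dom c) := @img_open _ _ _ c.
  have hp := Ck_powR (4 / (n%:R - 2)) oU (fun x _ => u0 (param c x)) (hu c hc).
  apply: (Ck_eq oU) (CkM oU hp (metric_C2 hg hc i j)) => x _.
  by rewrite /conformal mxE.
- move=> c d p hc hd cp dp /=; rewrite /conformal (metric_change hg hc hd cp dp)/=.
  by rewrite -scalemxAr -scalemxAl.
Qed.

End Charts.

Import HBNNSimple.

(** * Measures with a density *)

Section Density.
Context d (T : measurableType d) (R : realType).
Variables (mu : {measure set T -> \bar R}) (h : T -> R).
Hypotheses (mh : measurable_fun setT h) (h0 : forall x, 0 <= h x).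

(** The two proofs are arguments so that the measure structure can be attached to the expression. *)
Definition density_measure (_ : measurable_fun setT h) (_ : forall x, 0 <= h x) :
    set T -> \bar R := fun B => (\int[mu]_(x in B) (h x)%:E)%E.

Local Notation nu := (density_measure mh h0).

Let density0 : nu set0 = 0%E.
Proof. exact: integral_set0. Qed.

Let density_ge0 B : (0 <= nu B)%E.
Proof. by apply: integral_ge0 => x _; rewrite lee_fin. Qed.

Let density_sigma_additive : semi_sigma_additive nu.
Proof.
move=> /= F mF tF mUF; apply: cvg_toP.
  apply: ereal_nondecreasing_is_cvgn => m n mn.
  by apply: lee_sum_nneg_natr => // k _ _; apply: integral_ge0 => x _; rewrite lee_fin.
rewrite /density_measure ge0_integral_bigcup//=.
- by apply/measurable_funTS/measurable_EFinP.
- by move=> x _; rewrite lee_fin.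
Qed.

HB.instance Definition _ := isMeasure.Build _ _ _ nu
  density0 density_ge0 density_sigma_additive.

Let integral_density_nnsfun (f : {nnsfun T >-> R}) :
  (\int[nu]_x (f x)%:E = \int[mu]_x ((f x)%:E * (h x)%:E))%E.
Proof.
rewrite integralT_nnsfun sintegralE.
transitivity (\int[mu]_x (\sum_(k \in range f) (k * \1_(f @^-1` [set k]) x)%:E * (h x)%:E))%E.
  rewrite ge0_integral_fsum//.
  - apply: eq_fsbigr => k /[!inE] -[x0 _ kE].
    have k0 : 0 <= k by rewrite -kE.
    have mk : measurable (f @^-1` [set k]) by exact: measurable_sfunP.
    transitivity (\int[mu]_x (k%:E * (((EFin \o h) \_ (f @^-1` [set k])) x)))%E.
      rewrite ge0_integralZl//.
      - by rewrite -integral_mkcond.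
      - by apply/(measurable_restrictT _ mk).1; apply: measurable_funTS; exact/measurable_EFinP.
      - by move=> x _; apply: erestrict_ge0 => y _; rewrite /= lee_fin.
    apply: eq_integral => x _; rewrite patchE indicE.
    by case: (x \in _); rewrite ?mulr1 ?mulr0 ?mul0e ?mule0.
  - move=> k; apply: emeasurable_funM; apply/measurable_EFinP => //.
    exact: measurable_funM.
  - by move=> k x _; rewrite mule_ge0 ?lee_fin//; exact: nnfun_muleindic_ge0.
apply: eq_integral => x _; rewrite [in RHS]fimfunE -fsumEFin//.
rewrite ge0_mule_fsuml//.
by move=> k; exact: nnfun_muleindic_ge0.
Qed.

(** Simple functions by linearity, then monotone convergence on both sides. *)
Lemma integral_density (f : T -> \bar R) : measurable_fun setT f -> (forall x, 0 <= f x)%E ->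
  (\int[nu]_x f x = \int[mu]_x (f x * (h x)%:E))%E.
Proof.
move=> mf f0; pose f_ := nnsfun_approx measurableT mf.
have cf x : (f_ n x)%:E @[n --> \oo] --> f x.
  by apply: cvg_nnsfun_approx => //.
have ndf x : {homo (fun n => f_ n x) : m n / (m <= n)%N >-> m <= n}.
  by move=> m n mn; exact/lefP/nd_nnsfun_approx.
transitivity (limn (fun n => \int[nu]_x (f_ n x)%:E)%E).
  rewrite -monotone_convergence//.
  - by apply: eq_integral => x _; apply/esym/cvg_lim.
  - by move=> n; exact/measurable_EFinP/measurable_funP.
  - by move=> n x _; rewrite lee_fin.
  - by move=> x _ m n mn; rewrite lee_fin; exact: ndf.
transitivity (limn (fun n => \int[mu]_x ((f_ n x)%:E * (h x)%:E))%E).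
  by congr (limn _); apply/funext => n; exact: integral_density_nnsfun.
rewrite -monotone_convergence//.
- by apply: eq_integral => x _; apply/cvg_lim => //; exact: cvgeZr.
- by move=> n; apply: emeasurable_funM; apply/measurable_EFinP => //; exact: measurable_funP.
- by move=> n x _; rewrite mule_ge0// lee_fin.
- by move=> x _ m n mn; rewrite lee_wpmul2r// lee_fin//; exact: ndf.
Qed.

End Density.

Section LocalContinuity.
Context (R : realType) (n : nat) (U : set 'rV[R]_n) (G : 'rV[R]_n -> 'M[R]_n).
Hypothesis hG : local_metric U G.
Let oU := local_metric_open hG.

Lemma Ck_ricci i j : Ck_on 0 U (ricci G i j).
Proof.
have C k a b : Ck_on 1 U (christoffel G k a b) by exact: Ck_christoffel.
have C' k a b : Ck_on 0 U (christoffel G k a b) := Ck_pred (C k a b).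
apply: (CkD oU).
  apply: (Ck_sum _ oU) => k; apply: (CkB oU); exact: (Ck_partial _ (C _ _ _)).
apply: (Ck_sum _ oU) => k; apply: (Ck_sum _ oU) => l; apply: (CkB oU).
  exact: (CkM oU (C' _ _ _) (C' _ _ _)).
exact: (CkM oU (C' _ _ _) (C' _ _ _)).
Qed.

Lemma Ck_scalar_curvature : Ck_on 0 U (local_scalar_curvature G).
Proof.
apply: (Ck_sum _ oU) => i; apply: (Ck_sum _ oU) => j; apply: (CkM oU); last exact: Ck_ricci.
exact: (Ck_le (isT : (0 <= 2)%N) (Ck_metric_inv hG i j)).
Qed.

Lemma Ck_grad_pairing f h : Ck_on 1 U f -> Ck_on 1 U h -> Ck_on 0 U (grad_pairing G f h).
Proof.
move=> hf hh.
have C k : Ck_on 1 U k -> Ck_mx 0 U (gradient k).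
  move=> hk i j; rewrite (_ : (fun y => _) = partial i k); first exact: Ck_partial.
  by apply/funext => y; rewrite gradient_entry.
have CI : Ck_mx 0 U (fun y => invmx (G y)) := Ck_mx_le (isT : (0 <= 2)%N) (Ck_metric_inv hG).
rewrite (_ : grad_pairing G f h = fun y => ((gradient f y)^T *m invmx (G y) *m gradient h y) 0 0).
  exact: (Ck_mx_mul oU (Ck_mx_mul oU (Ck_mx_tr (C f hf)) CI) (C h hh)).
by apply/funext => y; rewrite grad_pairingE.
Qed.

Lemma grad_pairingD f f' h x : U x -> Ck_on 1 U f -> Ck_on 1 U f' ->
  grad_pairing G (fun y => f y + f' y) h x = grad_pairing G f h x + grad_pairing G f' h x.
Proof.
move=> Ux hf hf'; rewrite !grad_pairingE.
have -> : gradient (fun y => f y + f' y) x = gradient f x + gradient f' x.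
  apply/matrixP => i j; rewrite !mxE !gradient_entry.
  exact: (partialD (Ck_derivable i hf Ux) (Ck_derivable i hf' Ux)).
by rewrite linearD !mulmxDl mxE.
Qed.

Lemma grad_pairingC f h x : U x -> grad_pairing G f h x = grad_pairing G h f x.
Proof.
move=> Ux; rewrite !grad_pairingE; set X := gradient f x; set Y := gradient h x.
transitivity ((X^T *m invmx (G x) *m Y)^T 0 0); first by rewrite [RHS]mxE.
by rewrite !trmx_mul trmxK trmx_inv (local_metric_sym hG Ux) mulmxA.
Qed.

Lemma grad_pairing0 V f h x : open V -> V x -> {in V, f =1 cst 0} -> grad_pairing G f h x = 0.
Proof.
move=> oV Vx f0; rewrite grad_pairingE (_ : gradient f x = 0).
  by rewrite trmx0 !mul0mx mxE.
apply/matrixP => i j; rewrite gradient_entry mxE -(partial_cst (0 : R) i x).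
exact: (@partial_near_eq _ _ _ _ i _ (open_near_eq oV Vx f0)).
Qed.

End LocalContinuity.

(** * Functions, gradients and Laplacians on M *)

Section ManifoldFunctions.
Context {R : realType} {n : nat} {M : ptopologicalType} (A : smooth_atlas R n M).
Variable g : tensor_field R n M.
Hypotheses (n3 : (3 <= n)%N) (hg : C2_metric A g).
Implicit Types (c d : chart R n M) (p : M) (x : 'rV[R]_n) (f h u v : M -> R).

Definition Ck_function k f := forall c, charts A c -> Ck_on k (chart_image c) (f \o param c).

Lemma Ck_functionW k f : Ck_function k.+1 f -> Ck_function k f.
Proof. by move=> hf c hc; exact: Ck_pred (hf c hc). Qed.

Lemma Ck_functionM k f h : Ck_function k f -> Ck_function k h ->
  Ck_function k (fun p => f p * h p).
Proof. by move=> hf hh c hc; exact: (CkM (@img_open _ _ _ c) (hf c hc) (hh c hc)). Qed.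

Lemma Ck_function_powR k f (a : R) : (forall p, 0 < f p) -> Ck_function k f ->
  Ck_function k (fun p => f p `^ a).
Proof.
move=> f0 hf c hc.
exact: (Ck_powR a (@img_open _ _ _ c) (fun x _ => f0 (param c x)) (hf c hc)).
Qed.

Lemma Ck_functionV k f : (forall p, 0 < f p) -> Ck_function k f ->
  Ck_function k (fun p => (f p)^-1).
Proof.
move=> f0 hf c hc.
exact: (Ck_inv (@img_open _ _ _ c) (fun x _ => f0 (param c x)) (hf c hc)).
Qed.

Lemma continuous_in_charts f : (forall c, charts A c ->
    exists2 fc, Ck_on 0 (chart_image c) fc & forall p, dom c p -> f p = fc (coord c p)) ->
  continuous f.
Proof.
move=> hf p; have [c hc cp] := charts_cover A p.
have [fc Cf fE] := hf c hc.
have near_eq : \forall q \near p, fc (coord c q) = f q.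
  have : nbhs p (dom c) by apply: open_nbhs_nbhs; split => //; exact: dom_open.
  by apply: filterS => q /fE.
apply: (near_eq_continuous near_eq); apply: continuous_comp; first exact: coord_continuous.
exact: (Ck_cont Cf (chart_image_coord cp)).
Qed.

Lemma Ck_function_continuous f : Ck_function 0 f -> continuous f.
Proof.
move=> hf; apply: continuous_in_charts => c hc; exists (f \o param c); first exact: hf.
by move=> p cp; rewrite /= coordK.
Qed.

Lemma scalar_curvature_continuous (k : tensor_field R n M) : C2_metric A k ->
  continuous (scalar_curvature A k).
Proof.
move=> hk; apply: continuous_in_charts => c hc; exists (local_scalar_curvature (metric_in k c)).
  exact: Ck_scalar_curvature (local_metric_chart hk hc).
by move=> p cp; exact: scalar_curvature_chart.
Qed.

Definition grad_on f h p : R :=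
  let c := chart_at A p in
  grad_pairing (metric_in g c) (f \o param c) (h \o param c) (coord c p).

Section Gradient.
Variables f h : M -> R.
Hypotheses (hf : Ck_function 1 f) (hh : Ck_function 1 h).

Lemma grad_on_chart c p : charts A c -> dom c p ->
  grad_on f h p = grad_pairing (metric_in g c) (f \o param c) (h \o param c) (coord c p).
Proof.
move=> hc cp; exact: (grad_pairing_overlap (chart_at_charts A p) hc hg
  (chart_at_dom A p) cp (hf hc) (hh hc)).
Qed.

Lemma grad_on_continuous : continuous (grad_on f h).
Proof.
apply: continuous_in_charts => c hc.
exists (grad_pairing (metric_in g c) (f \o param c) (h \o param c)).
  exact: (Ck_grad_pairing (local_metric_chart hg hc) (hf hc) (hh hc)).
by move=> p cp; exact: grad_on_chart.
Qed.

Lemma grad_onD k p : Ck_function 1 k ->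
  grad_on (fun q => f q + h q) k p = grad_on f k p + grad_on h k p.
Proof.
move=> hk; have hc := chart_at_charts A p.
rewrite /grad_on; set c := chart_at A p.
have E := @grad_pairingD _ _ _ (metric_in g c) (f \o param c) (h \o param c) (k \o param c).
have E' := E _ _ (chart_image_coord (chart_at_dom A p)) (hf hc) (hh hc).
exact: E'.
Qed.

End Gradient.

Lemma grad_on0 (V : set M) f h p : open V -> V p -> {in V, f =1 cst 0} -> grad_on f h p = 0.
Proof.
move=> oV Vp f0; rewrite /grad_on; set c := chart_at A p.
have cp : dom c p := chart_at_dom A p.
have oW : open (chart_image c `&` param c @^-1` V).
  rewrite openE => x [cx Vx]; apply: filterI.
    by apply: open_nbhs_nbhs; split => //; exact: img_open.
  by apply: (@param_continuous _ _ _ c x cx); exact: open_nbhs_nbhs.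
apply: (grad_pairing0 _ _ oW).
  by split; [exact: chart_image_coord|rewrite /= coordK].
by move=> x; rewrite inE => -[_ Vx]; rewrite /= f0// inE.
Qed.

(** Despite its name this is the coefficient of the conformal Laplacian, written c in the overview,
    and not the infimum Y(M, g0). *)
Definition yamabe_constant (m : nat) : R := 4 * (m%:R - 1) / (m%:R - 2).

Lemma yamabe_constant_gt0 : 0 < yamabe_constant n.
Proof.
have h : 3 <= n%:R :> R by rewrite (ler_nat R 3 n).
by apply: divr_gt0; lra.
Qed.

(* The conformal covariance of the scalar curvature makes this a chart-free
   expression of the Laplacian of u. *)
Definition laplacian_on u p : R :=
  (yamabe_constant n)^-1 * (u p * scalar_curvature A g p -
    u p `^ (4 / (n%:R - 2)) * u p * scalar_curvature A (conformal u g) p).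

Section Laplacian.
Variable u : M -> R.
Hypotheses (hu : C2_function A u) (u0 : forall p, 0 < u p).

(** [scalar_conformal_power] solved for the Laplacian. *)
Lemma laplacian_on_chart c p : charts A c -> dom c p ->
  laplacian_on u p = laplacian (metric_in g c) (u \o param c) (coord c p).
Proof.
move=> hc cp; rewrite /laplacian_on (scalar_curvature_chart hg hc cp).
rewrite (scalar_curvature_chart (conformal_C2_metric hu u0 hg) hc cp).
have := scalar_conformal_power n3 (local_metric_chart hg hc) (hu hc)
  (fun x _ => u0 (param c x)) (chart_image_coord cp).
rewrite /= (coordK cp) -/(yamabe_constant n) => E.
set L := laplacian _ _ _ in E *; apply: (@mulfI _ (yamabe_constant n)).
  by rewrite gt_eqF// yamabe_constant_gt0.
rewrite mulVKf ?gt_eqF ?yamabe_constant_gt0//.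
by apply/eqP; rewrite subr_eq addrC -subr_eq; apply/eqP; exact/esym.
Qed.

Lemma laplacian_on_continuous : continuous (laplacian_on u).
Proof.
have C0 : Ck_function 0 u by move=> c hc; exact: (Ck_le (isT : (0 <= 2)%N) (hu hc)).
have cu := Ck_function_continuous C0.
move=> p; apply: cvgM; first exact: cvg_cst.
apply: cvgB.
  by apply: cvgM; [exact: cu|exact: (scalar_curvature_continuous hg)].
apply: cvgM; last exact: (scalar_curvature_continuous (conformal_C2_metric hu u0 hg)).
apply: cvgM; last exact: cu.
exact: (Ck_function_continuous (Ck_function_powR _ u0 C0)).
Qed.

End Laplacian.
End ManifoldFunctions.

(** * Riemannian volumes *)

Lemma integral_density_real d (T : measurableType d) (R : realType)
    (mu : {measure set T -> \bar R}) (h : T -> R) (mh : measurable_fun setT h)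
    (h0 : forall x, 0 <= h x) (f : T -> R) : measurable_fun setT f ->
  (\int[density_measure mu mh h0]_x (f x)%:E = \int[mu]_x (f x * h x)%:E)%E.
Proof.
move=> mf; have mf' : measurable_fun setT (EFin \o f) by exact/measurable_EFinP.
rewrite [LHS]integralE [RHS]integralE; congr (_ - _)%E.
  rewrite integral_density//; last exact: measurable_funepos.
  by apply: eq_integral => x _; rewrite !funeposE -!EFin_max -EFinM maxr_pMl ?mul0r.
rewrite integral_density//; last exact: measurable_funeneg.
apply: eq_integral => x _; rewrite !funenegE -!EFinN -!EFin_max -EFinM maxr_pMl// mul0r.
by rewrite mulNr.
Qed.

Section Volume.
Context {R : realType} {n : nat} {M : ptopologicalType} (A : smooth_atlas R n M).
Variable lam : {sigma_finite_measure set (borel 'rV[R]_n) -> \bar R}.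
Hypothesis hlam : euclidean_measure lam.
Implicit Types (c d : chart R n M) (p : M) (x : 'rV[R]_n) (g : tensor_field R n M).
Implicit Types (mu nu : {measure set (borel M) -> \bar R}).

(** [param c] is unconstrained off the image of the chart. A constant value there makes the map
    Borel on all of R^n, so that measures can be pushed forward along it. *)
Definition total_param c : borel 'rV[R]_n -> borel M :=
  fun x => if x \in chart_image c then param c x else point.

Lemma total_paramE c x : chart_image c x -> total_param c x = param c x.
Proof. by move=> cx; rewrite /total_param mem_set. Qed.

Lemma measurable_chart_image c : measurable (chart_image c : set (borel 'rV[R]_n)).
Proof. by apply: borel_open; exact: img_open. Qed.

Lemma measurable_total_param c : measurable_fun setT (total_param c).
Proof.
apply: measurable_fun_if => //.
- apply: (measurable_fun_bool true); rewrite setTI.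
  rewrite (_ : _ @^-1` _ = chart_image c); first exact: measurable_chart_image.
  by apply/seteqP; split=> x /=; [move=> h; rewrite -inE|move=> h; rewrite mem_set].
- apply: measurable_fun_borel => O oO; apply: borel_open.
  rewrite setTI (_ : _ @^-1` _ = chart_image c); last first.
    by apply/seteqP; split=> x /=; [move=> h; rewrite -inE|move=> h; rewrite mem_set].
  rewrite openE => x [cx Ox]; apply: filterI.
    by apply: open_nbhs_nbhs; split => //; exact: img_open.
  by apply: (@param_continuous _ _ _ c x cx); exact: open_nbhs_nbhs.
Qed.

Definition chart_density g c : borel 'rV[R]_n -> R :=
  volume_density (metric_in g c) \_ (chart_image c).

Lemma chart_density_ge0 g c x : 0 <= chart_density g c x.
Proof. by rewrite /chart_density patchE; case: ifP => // _; exact: sqrtr_ge0. Qed.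

Lemma open_measurable_fun (U : set 'rV[R]_n) (f : 'rV[R]_n -> R) : open U -> Ck_on 0 U f ->
  measurable_fun (U : set (borel 'rV[R]_n)) (f : borel 'rV[R]_n -> R).
Proof.
move=> oU Cf; apply: (measurability _ (RGenOpens.measurableE R)).
move=> _ [_ [a [b ->] <-]].
suff oV : open (U `&` f @^-1` `]a, b[%classic) by exact: borel_open.
rewrite openE => x [Ux fx]; apply: filterI; first exact: open_nbhs_nbhs.
by apply: (Ck_cont Cf Ux); apply: open_nbhs_nbhs; split => //; exact: interval_open.
Qed.

Lemma measurable_chart_density g c : C2_metric A g -> charts A c ->
  measurable_fun setT (chart_density g c).
Proof.
move=> hg hc; have [H _] := measurable_restrictT
  (volume_density (metric_in g c) : borel 'rV[R]_n -> R) (measurable_chart_image c).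
apply: H; have C := Ck_le (isT : (0 <= 2)%N) (Ck_volume_density (local_metric_chart hg hc)).
exact: (open_measurable_fun (@img_open _ _ _ c) C).
Qed.

Lemma borel_dom c : measurable (dom c : set (borel M)).
Proof. by apply: borel_open; exact: dom_open. Qed.

Lemma coord_image c (B : set (borel M)) : B `<=` dom c ->
  coord c @` B = chart_image c `&` total_param c @^-1` B.
Proof.
move=> Bc; apply/seteqP; split=> x.
  move=> [p Bp <-]; have cx := chart_image_coord (Bc _ Bp).
  by split => //=; rewrite total_paramE// coordK//; exact: Bc.
move=> [cx /=]; rewrite total_paramE// => Bx; exists (param c x) => //.
by have [_ ->] := chart_imageP cx.
Qed.

Section ChartIntegral.
Variables (g : tensor_field R n M) (mu : {measure set (borel M) -> \bar R}).
Hypotheses (hg : C2_metric A g) (hmu : is_riemannian_volume A g mu).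
Variable c : chart R n M.
Hypothesis hc : charts A c.

Let mrho := measurable_chart_density hg hc.
Let nu := density_measure lam mrho (chart_density_ge0 g c).
Let mP := measurable_total_param c.
Let rho := chart_density g c.

Let volume_chart (B : set (borel M)) : measurable B -> B `<=` dom c ->
  mu B = pushforward nu (total_param c) B.
Proof.
move=> mB Bc; rewrite (hmu hc mB Bc).
have mPB : measurable (total_param c @^-1` B) by rewrite -[X in measurable X]setTI; exact: mP.
have mcB : measurable (coord c @` B : set (borel 'rV[R]_n)).
  by rewrite coord_image//; apply: measurableI => //; exact: measurable_chart_image.
have E : (fun x => (Num.sqrt (\det (g c (param c x))))%:E) \_ (coord c @` B) =
    (EFin \o rho) \_ (total_param c @^-1` B).
  apply/funext => x; rewrite !patchE coord_image// in_setI /= /rho /chart_density patchE.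
  by case: (x \in chart_image c) => //=; case: ifP.
rewrite E -(euclidean_integral hlam); last 2 first.
- have [H _] := measurable_restrictT (EFin \o rho) mPB; apply: H.
  by apply: measurable_funTS; apply/measurable_EFinP; exact: mrho.
- by move=> x; apply: erestrict_ge0 => y _; rewrite /= lee_fin chart_density_ge0.
by rewrite -integral_mkcond.
Qed.

Let chart_integral_ge0 (f : borel M -> \bar R) : measurable_fun setT f ->
  (forall p, 0 <= f p)%E -> (forall p, ~ dom c p -> f p = 0%E) ->
  (\int[mu]_p f p = \int[lam]_x (f (param c x) * (rho x)%:E))%E.
Proof.
move=> mf f0 fc.
transitivity (\int[mu]_(p in dom c) f p)%E.
  rewrite [RHS]integral_mkcond; apply: eq_integral => p _; rewrite patchE.
  by case: ifPn => // /negP; rewrite inE => /fc.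
rewrite (@eq_measure_integral _ _ _ _ (pushforward nu (total_param c)))//.
transitivity (\int[pushforward nu (total_param c)]_p f p)%E.
  rewrite [LHS]integral_mkcond; apply: eq_integral => p _; rewrite patchE.
  by case: ifPn => // /negP; rewrite inE => /fc.
rewrite ge0_integral_pushforward// preimage_setT integral_density//; last 2 first.
- exact: (measurableT_comp mf mP).
- by move=> x; exact: f0.
apply: eq_integral => x _; rewrite /= /rho /chart_density patchE.
by case: ifPn => [|_]; rewrite ?mule0// inE => cx; rewrite total_paramE.
Qed.

(** On the chart domain [mu] is the image of a measure with density. Positive and negative parts are
    treated separately, so integrability does not have to be assumed. *)
Lemma chart_integral (f : borel M -> R) : measurable_fun setT f ->
  (forall p, ~ dom c p -> f p = 0) ->
  (\int[mu]_p (f p)%:E = \int[lam]_x (f (param c x) * chart_density g c x)%:E)%E.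
Proof.
move=> mf fc; have mf' : measurable_fun setT (EFin \o f) by exact/measurable_EFinP.
rewrite [LHS]integralE [RHS]integralE; congr (_ - _)%E.
  rewrite chart_integral_ge0//.
  - apply: eq_integral => x _; rewrite !funeposE -!EFin_max -EFinM maxr_pMl ?mul0r//.
    exact: chart_density_ge0.
  - exact: measurable_funepos.
  - by move=> p cp; rewrite funeposE fc// maxxx.
rewrite chart_integral_ge0//.
- apply: eq_integral => x _; rewrite !funenegE -!EFinN -!EFin_max -EFinM maxr_pMl.
    by rewrite mul0r mulNr.
  exact: chart_density_ge0.
- exact: measurable_funeneg.
- by move=> p cp; rewrite funenegE fc// oppe0 maxxx.
Qed.

End ChartIntegral.

Section ConformalVolume.
Variables (g : tensor_field R n M) (mu : {measure set (borel M) -> \bar R}) (u : M -> R).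
Hypotheses (n3 : (3 <= n)%N) (hg : C2_metric A g) (hmu : is_riemannian_volume A g mu).
Hypotheses (hu : C2_function A u) (u0 : forall p, 0 < u p).

(** The power n / 2 of u^(4 / (n - 2)), by which the square root of the determinant of the metric is
    multiplied. *)
Definition volume_factor (p : borel M) : R := u p `^ (2 * n%:R / (n%:R - 2)).

Lemma volume_factor_ge0 p : 0 <= volume_factor p.
Proof. exact: powR_ge0. Qed.

Lemma measurable_volume_factor : measurable_fun setT volume_factor.
Proof.
apply: continuous_borel; apply: (@Ck_function_continuous _ _ _ A); apply: Ck_function_powR => //.
by move=> c hc; exact: (Ck_le (isT : (0 <= 2)%N) (hu hc)).
Qed.

Lemma sqrt_det_conformal c p :
  Num.sqrt (\det (conformal u g c p)) = volume_factor p * Num.sqrt (\det (g c p)).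
Proof.
rewrite /conformal detZ sqrtrM ?exprn_ge0 ?powR_ge0//; congr (_ * _).
have n2 : (n%:R - 2 : R) != 0.
  by rewrite subr_eq0 (eqr_nat R n 2); move: n3; case: (n) => [|[|[|]]].
rewrite -powR_mulrn ?powR_ge0// -powRrM /volume_factor.
rewrite (_ : 4 / (n%:R - 2) * n%:R = 2 * n%:R / (n%:R - 2) + 2 * n%:R / (n%:R - 2)); last by field.
rewrite powRD; last by apply/implyP => _; rewrite gt_eqF.
by rewrite -expr2 sqrtr_sqr ger0_norm// powR_ge0.
Qed.

(** This also yields existence: from a volume for [g] comes one for each conformal metric. *)
Lemma conformal_volume : is_riemannian_volume A (conformal u g)
  (density_measure mu measurable_volume_factor volume_factor_ge0).
Proof.
move=> c B hc mB Bc; rewrite /= /density_measure integral_mkcond.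
have mf : measurable_fun setT (fun p : borel M => (volume_factor \_ B) p).
  have [H _] := measurable_restrictT volume_factor mB; apply: H.
  by apply: measurable_funTS; exact: measurable_volume_factor.
transitivity (\int[mu]_p ((volume_factor \_ B) p)%:E)%E.
  by apply: eq_integral => p _; rewrite !patchE; case: ifP.
rewrite (chart_integral hg hmu hc mf); last first.
  by move=> p cp; rewrite patchE memNset// => /Bc.
have mcB : measurable (coord c @` B : set (borel 'rV[R]_n)).
  rewrite coord_image//; apply: measurableI; first exact: measurable_chart_image.
  by rewrite -[X in measurable X]setTI; exact: measurable_total_param.
set h := (X in lebesgue_integral_rV X).
have -> : h = fun x => ((volume_factor \_ B) (total_param c x) * chart_density g c x)%:E.
  apply/funext => x; rewrite /h /chart_density !patchE coord_image// in_setI /=.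
  case: (boolP (x \in chart_image c)) => [|_] /=; last by rewrite mulr0.
  rewrite inE => cx; rewrite (_ : (x \in _) = (total_param c x \in B))//.
  rewrite total_paramE//; case: ifP => _; last by rewrite mul0r.
  by rewrite sqrt_det_conformal.
rewrite -(euclidean_integral hlam).
- apply: eq_integral => x _; rewrite /chart_density !patchE.
  case: (boolP (x \in chart_image c)) => [|_]; last by rewrite !mulr0.
  by rewrite inE => cx; rewrite total_paramE.
- apply/measurable_EFinP; apply: measurable_funM; last exact: measurable_chart_density.
  exact: (measurableT_comp mf (measurable_total_param c)).
- move=> x; rewrite lee_fin mulr_ge0 ?chart_density_ge0// patchE.
  by case: ifP => // _; exact: volume_factor_ge0.
Qed.

End ConformalVolume.

(** The defining property fixes the measure on subsets of a single chart domain. Compactness leaves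
    finitely many domains, and [B] is cut along them one at a time. *)
Lemma riemannian_volume_unique g mu nu (B : set (borel M)) : compact [set: M] ->
  is_riemannian_volume A g mu -> is_riemannian_volume A g nu -> measurable B -> mu B = nu B.
Proof.
move=> cM hmu hnu; have : cover_compact [set: M] by rewrite -compact_cover.
move=> /(_ _ [set: M] (fun p => dom (chart_at A p))) [||D _ cov].
- by move=> p _; exact: dom_open.
- by move=> p _; exists p => //; exact: chart_at_dom.
have : B `<=` \bigcup_(p in [set` (finmap.enum_fset D)]) dom (chart_at A p).
  by move=> p _; have [q qD hq] := cov p I; exists q.
elim: (finmap.enum_fset D) B => [|q s IH] B Bs mB.
  by rewrite (_ : B = set0) ?measure0//; apply/seteqP; split=> // p /Bs[].
have mq := borel_dom (chart_at A q).
rewrite (measureDI mu mB mq) (measureDI nu mB mq); congr (_ + _)%E.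
  apply: IH; last exact: measurableD.
  move=> p [Bp nq]; have [r /=] := Bs p Bp.
  by rewrite inE => /orP[/eqP->//|rs rp]; exists r.
have mBq := measurableI _ _ mB mq.
have sub : B `&` dom (chart_at A q) `<=` dom (chart_at A q) by move=> p [].
have hq := chart_at_charts A q.
exact: (etrans (hmu _ _ hq mBq sub) (esym (hnu _ _ hq mBq sub))).
Qed.
End Volume.

(** * Green's identity *)

Lemma open_far (R : realType) (n : nat) (z : 'rV[R]_n) (s : R) : open [set y : 'rV[R]_n | s < `|y - z|].
Proof.
rewrite (_ : [set y | _] = (fun y : 'rV[R]_n => `|y - z|) @^-1` [set t | s < t])//.
apply: open_comp; last exact: open_gt.
move=> y _; apply: (@continuous_comp _ _ _ (fun y : 'rV[R]_n => y - z)).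
  by apply: continuousB; [move=> B; exact: id|exact: cst_continuous].
exact: norm_continuous.
Qed.

Section LocalGreen.
Context {R : realType} {n : nat} (lam : {sigma_finite_measure set (borel 'rV[R]_n) -> \bar R}).
Hypothesis hlam : euclidean_measure lam.
Variables (U : set 'rV[R]_n) (G : 'rV[R]_n -> 'M[R]_n) (x0 : 'rV[R]_n) (r : R).
Hypotheses (hG : local_metric U G) (ballU : forall y : 'rV[R]_n, `|y - x0| <= r -> U y).

Variables v u : 'rV[R]_n -> R.
Hypotheses (hv : Ck_on 1 U v) (hu : Ck_on 2 U u).
Hypothesis v0 : forall y, U y -> r < `|y - x0| -> v y = 0.

(** The flux extended by zero. It is C^1 on all of R^n, because it vanishes on the complement of a
    closed ball contained in [U], and that complement and [U] form an open cover. *)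
Let F i : 'rV[R]_n -> R := flux G v u i \_ U.
Let oU := local_metric_open hG.

Let W : set 'rV[R]_n := [set y : 'rV[R]_n | r < `|y - x0|].
Let oW : open W := @open_far R n x0 r.

Let FU i : {in U, F i =1 flux G v u i}.
Proof. by move=> y yU; rewrite /F patchE yU. Qed.

Let F0 i (y : 'rV[R]_n) : r < `|y - x0| -> F i y = 0.
Proof.
move=> ry; rewrite /F patchE; case: ifPn => //; rewrite inE => Uy.
by rewrite /flux v0// mul0r.
Qed.

Let far y : ~ U y -> r < `|y - x0|.
Proof. by move=> Uy; rewrite ltNge; apply/negP => /ballU. Qed.

Let CkF i : Ck_on 1 setT (F i).
Proof.
apply: Ck_local => [|x _]; first exact: openT.
have [Ux|Ux] := pselect (U x).
  exists U; split; [exact: oU|exact: Ux|apply: (Ck_eq oU) (Ck_flux hG i hv hu) => y yU;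
    by rewrite FU].
exists W; split; [exact: oW|exact: far|].
apply: (@Ck_eq R n 1 W (fun=> 0) (F i) oW _ (Ck_cst 1 W 0)) => y; rewrite inE => hy.
by rewrite F0.
Qed.

(** [euclidean_divergence] speaks of balls about the origin, hence the radius [|x0| + r]. *)
Let F_supp i (y : 'rV[R]_n) : `|x0| + r < `|y| -> F i y = 0.
Proof.
move=> ry; apply: F0; have := lerB_dist y x0.
by apply: lt_le_trans; rewrite ltrBrDl.
Qed.

Let divergence x : \sum_i partial i (F i) x =
  (v x * laplacian G u x + grad_pairing G v u x) * (volume_density G \_ U) x.
Proof.
have [Ux|Ux] := pselect (U x).
  rewrite patchE mem_set// mulrC -(divergence_flux hG Ux hv hu).
  apply: eq_bigr => i _; apply: partial_near_eq.
  exact: (open_near_eq oU Ux (FU i)).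
rewrite patchE memNset// mulr0; apply: big1 => i _.
rewrite -(partial_cst (0 : R) i x); apply: partial_near_eq.
by apply: (open_near_eq oW (far Ux)) => y; rewrite inE => hy; rewrite F0.
Qed.

Let integrable_divergence i :
  lam.-integrable setT (fun x : borel 'rV[R]_n => (partial i (F i) x)%:E).
Proof.
have cg : continuous (partial i (F i)) by move=> x; exact: Ck_cont (Ck_partial i (CkF i)) _.
have g0 x : `|x0| + r < `|x| -> partial i (F i) x = 0.
  exact: (partial_supp i (@F_supp i)).
have [B gB] := continuous_supp_bounded cg g0.
have E := @integrable_bounded_support _ (borel 'rV[R]_n) R lam
  [set x : 'rV[R]_n | `|x| <= `|x0| + r] (partial i (F i)) B.
apply: E.
- exact: measurable_norm_ball.
- exact: (euclidean_ball hlam).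
- exact: continuous_borel.
- exact: gB.
- by move=> x /= /negP; rewrite -ltNge; exact: g0.
Qed.

Lemma local_green :
  (\int[lam]_x ((v x * laplacian G u x + grad_pairing G v u x)
     * (volume_density G \_ U) x)%:E = 0)%E.
Proof.
transitivity (\int[lam]_x (\sum_i (partial i (F i) x)%:E))%E.
  by apply: eq_integral => x _; rewrite -divergence sumEFin.
rewrite (integral_sum measurableT integrable_divergence); apply: big1 => i _.
exact: (euclidean_divergence hlam i (CkF i) (@F_supp i)).
Qed.

End LocalGreen.

(** * C^1 cut-off functions on R^n *)

Section EuclideanBump.
Context {R : realType} {n : nat}.
Variables (x0 : 'rV[R]_n) (r : R).
Hypothesis r0 : 0 < r.

Lemma Ck_coordinate (i : 'I_n) : Ck_on 1 setT (fun y : 'rV[R]_n => y 0 i).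
Proof.
have D (j : 'I_n) (x : 'rV[R]_n) : is_derive x (delta_mx 0 j) (fun y : 'rV[R]_n => y 0 i) ((i == j)%:R).
  have E : (fun h : R => h^-1 *: ((h *: delta_mx 0 j + x) 0 i - x 0 i)) @ 0^' --> ((i == j)%:R : R).
    apply: cvg_near_cst; near=> h.
    rewrite !mxE eqxx/= -addrA [x 0 i - _]subrr addr0 [_ *: _]mulrA mulVf ?mul1r//.
    by near: h; exact: nbhs_dnbhs_neq.
  by apply: DeriveDef; [apply/cvg_ex; exists (i == j)%:R|exact: cvg_lim].
apply: Ck_intro => [x _|j x _|j].
- exact: matrix_normedtype.coord_continuous.
- by have [] := D j x.
- rewrite (_ : partial j _ = fun=> (i == j)%:R); first exact: Ck_cst.
  by apply/funext => x; have [] := D j x.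
Unshelve. all: by end_near. Qed.

(* The C^1 function max(0, t)^2, up to a factor, and its derivative. *)
Definition square_ramp (k : nat) (t : R) : R :=
  if k is 0%N then (t + `|t|) ^+ 2 else 4 * (t + `|t|).

Lemma square_ramp_is_derive (t : R) : is_derive t 1 (square_ramp 0) (square_ramp 1 t).
Proof.
have pos s : 0 <= s -> square_ramp 0 s = 4 * s ^+ 2.
  by move=> s0; rewrite /square_ramp ger0_norm//; ring.
have neg s : s <= 0 -> square_ramp 0 s = 0.
  by move=> s0; rewrite /square_ramp ler0_norm// subrr expr0n.
have [t0|t0|->] := ltgtP t 0.
- rewrite /= ltr0_norm// subrr mulr0.
  have D := @is_derive_cst R R R 0 t 1; apply: near_eq_is_derive D.
  by near=> s; rewrite neg//; apply/ltW; near: s; exact: lt_nbhsl.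
- rewrite /= gtr0_norm//.
  have I := @is_derive_id R R t 1.
  have D := @is_deriveZ _ _ _ _ 4 t 1 _ (@is_deriveM _ _ _ _ t 1 _ _ I I).
  have <- : 4 *: (t *: 1 + t *: 1) = 4 * (t + t) :> R.
    by rewrite [t *: 1]mulr1.
  apply: near_eq_is_derive D.
  near=> s; rewrite pos; first by rewrite expr2.
  apply/ltW; near: s; exact: lt_nbhsr.
rewrite /= normr0 addr0 mulr0.
(* At the corner the difference quotient is 0 on the left and 4 h on the right. *)
have E : (fun h : R => h^-1 *: (square_ramp 0 (h *: 1 + 0) - square_ramp 0 0)) @ 0^' --> (0 : R).
  apply/cvgrPdist_lt => e e0; near=> h; rewrite sub0r normrN addr0 [h *: 1]mulr1.
  rewrite (neg 0)// subr0; have [h0|h0] := leP h 0; first by rewrite neg// scaler0 normr0.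
  rewrite pos ?ltW// [_ *: _]mulrC expr2 mulrA mulfK ?gt_eqF// normrM !gtr0_norm//.
  rewrite -ltr_pdivlMl// -(gtr0_norm h0) -[X in `|X|]subr0 distrC; near: h.
  by apply: nbhs_dnbhs; apply: nbhsx_ballx; rewrite mulr_gt0// invr_gt0.
by apply: DeriveDef; [apply/cvg_ex; exists 0|exact: cvg_lim].
Unshelve. all: by end_near. Qed.

Lemma square_ramp_continuous : continuous (square_ramp 1).
Proof.
move=> t; apply: cvgM; first exact: cvg_cst.
by apply: cvgD; [exact: cvg_id|exact: norm_continuous].
Qed.

(** A product over the coordinates, because balls of the maximum norm are cubes. *)
Definition euclidean_bump (y : 'rV[R]_n) : R :=
  \prod_i square_ramp 0 (1 - (r^-1 * (y 0 i - x0 0 i)) * (r^-1 * (y 0 i - x0 0 i))).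

Lemma euclidean_bump_ge0 y : 0 <= euclidean_bump y.
Proof. by apply: prodr_ge0 => i _; exact: sqr_ge0. Qed.

Lemma euclidean_bump_center : 0 < euclidean_bump x0.
Proof.
apply: prodr_gt0 => i _; rewrite subrr mulr0 mulr0 subr0 /= normr1.
by rewrite exprn_gt0.
Qed.

Lemma Ck_euclidean_bump : Ck_on 1 setT euclidean_bump.
Proof.
have oT : open [set: 'rV[R]_n] by exact: openT.
apply: (Ck_prod _ oT) => i.
have C := CkZ r^-1 oT (CkB oT (Ck_coordinate i) (Ck_cst 1 _ (x0 0 i))).
apply: (Ck_comp1 oT _ _ (CkB oT (Ck_cst 1 _ 1) (CkM oT C C))).
  by move=> [|//] x _ _; exact: square_ramp_is_derive.
by move=> x _; exact: square_ramp_continuous.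
Qed.

Lemma euclidean_bump_support y : euclidean_bump y != 0 -> `|y - x0| <= r.
Proof.
move=> yn0; apply: rV_norm_le => [|i]; first exact: ltW.
rewrite !mxE; move: yn0; rewrite /euclidean_bump (bigD1 i)//= mulf_eq0 negb_or => /andP[+ _].
apply: contraNT; rewrite -ltNge => ri; set t := r^-1 * _.
have t1 : 1 < `|t| by rewrite /t normrM gtr0_norm ?invr_gt0// ltr_pdivlMl// mulr1.
rewrite ler0_norm ?subrr ?expr0n// subr_le0 -expr2 -real_normK ?num_real//.
by rewrite expr2; apply: mulr_ege1; exact: ltW.
Qed.

End EuclideanBump.

(** * Cut-off functions on M and Green's identity in one chart *)

Section ChartBall.
Context {R : realType} {n : nat} {M : ptopologicalType} (A : smooth_atlas R n M).
Hypothesis hM : hausdorff_space M.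
Variables (c : chart R n M) (x0 : 'rV[R]_n) (r : R).
Hypotheses (hc : charts A c) (r0 : 0 < r).
Hypothesis ballc : forall y : 'rV[R]_n, `|y - x0| <= r -> chart_image c y.

Let B : set 'rV[R]_n := [set y : 'rV[R]_n | `|y - x0| <= r].

Let compactB : compact B.
Proof.
apply: bounded_closed_compact.
  exists (`|x0| + r); split; first exact: num_real.
  move=> m rm x xB; apply: le_trans (ltW rm).
  by rewrite -(subrK x0 x) addrC; apply: le_trans (ler_normD _ _) _; rewrite lerD2l.
rewrite (_ : B = ~` [set y : 'rV[R]_n | r < `|y - x0|]); first exact: open_closedC (@open_far R n x0 r).
by apply/seteqP; split=> y; rewrite /B /= => h; [apply/negP; rewrite -leNgt|rewrite leNgt; apply/negP].
Qed.

Definition chart_ball : set M := param c @` B.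

(** The Hausdorff hypothesis enters here. Closedness in [M], and not merely in the chart domain, is
    what makes the bump extended by zero regular across the boundary of that domain. *)
Lemma chart_ball_closed : closed chart_ball.
Proof.
apply: compact_closed => //; apply: continuous_compact compactB.
apply: continuous_in_subspaceT => y; rewrite inE => /ballc cy.
exact: param_continuous.
Qed.

Lemma chart_ball_dom p : chart_ball p -> dom c p.
Proof. by move=> [y /ballc cy <-]; have [] := chart_imageP cy. Qed.

Lemma chart_ballP p : dom c p -> chart_ball p <-> `|coord c p - x0| <= r.
Proof.
move=> cp; split=> [[y By <-]|h]; last by exists (coord c p) => //; rewrite coordK.
by have [_ ->] := chart_imageP (ballc By).
Qed.

Definition chart_bump : M -> R := (euclidean_bump x0 r \o coord c) \_ (dom c).

Lemma chart_bump_ge0 p : 0 <= chart_bump p.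
Proof. by rewrite /chart_bump patchE; case: ifP => // _; exact: euclidean_bump_ge0. Qed.

Lemma chart_bump_center p : dom c p -> coord c p = x0 -> 0 < chart_bump p.
Proof.
move=> cp xE; rewrite /chart_bump patchE mem_set//= xE.
exact: euclidean_bump_center.
Qed.

Lemma chart_bump_support p : ~ chart_ball p -> chart_bump p = 0.
Proof.
move=> pK; rewrite /chart_bump patchE; case: ifPn => //; rewrite inE => cp.
apply/eqP; apply/negP => /negP /(euclidean_bump_support r0) h.
by apply: pK; apply/chart_ballP.
Qed.

(** Seen in a chart [d], a point either lies in the domain of [c], and the transition map transports
    the Euclidean bump, or it lies off the closed [chart_ball], and the bump vanishes nearby. *)
Lemma Ck_chart_bump : Ck_function A 1 chart_bump.
Proof.
move=> d hd; apply: Ck_local => [|x dx]; first exact: img_open.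
have [cx|cx] := pselect (dom c (param d x)).
  exists (overlap d c); split; [exact: open_overlap|exact/overlapP|].
  have C := Ck_comp (@open_overlap _ _ _ d c) openT (fun _ _ => I)
    (@transition_continuous _ _ _ d c) (fun j => transition_Ck hd hc 1 j)
    (Ck_euclidean_bump x0 r).
  apply: (Ck_eq (@open_overlap _ _ _ d c) _ C) => y; rewrite inE => /overlapP[dy cy].
  by rewrite /chart_bump /= patchE mem_set.
pose V := chart_image d `&` param d @^-1` (~` chart_ball).
have oV : open V.
  rewrite openE => y [dy Ky]; apply: filterI.
    by apply: open_nbhs_nbhs; split => //; exact: img_open.
  apply: (@param_continuous _ _ _ d y dy); apply: open_nbhs_nbhs; split=> //.
  exact: closed_openC chart_ball_closed.
exists V; split; [exact: oV|by split=> //= /chart_ball_dom|].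
apply: (@Ck_eq R n 1 V (fun=> 0) _ oV _ (Ck_cst 1 V 0)) => y; rewrite inE => -[_ Ky].
by rewrite /= chart_bump_support.
Qed.

Section ChartGreen.
Variables (lam : {sigma_finite_measure set (borel 'rV[R]_n) -> \bar R}).
Variables (g : tensor_field R n M) (mu : {measure set (borel M) -> \bar R}) (w u : M -> R).
Hypotheses (n3 : (3 <= n)%N) (hlam : euclidean_measure lam).
Hypotheses (hg : C2_metric A g) (hmu : is_riemannian_volume A g mu).

(** [is_riemannian_volume] says nothing about finiteness. It comes from the maximum of the
    continuous density over a compact ball. *)
Lemma chart_ball_finite : (mu (chart_ball : set (borel M)) < +oo)%E.
Proof.
have mK : measurable (chart_ball : set (borel M)) by apply: borel_closed; exact: chart_ball_closed.
have mind : measurable_fun setT (\1_chart_ball : borel M -> R) by exact: measurable_indic.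
rewrite -[X in mu X]setIT -integral_indic// (chart_integral hlam hg hmu hc mind); last first.
  by move=> p cp; rewrite indicE memNset// => /chart_ball_dom.
have crho : {within B, continuous (volume_density (metric_in g c))}.
  apply: continuous_in_subspaceT => y; rewrite inE => /ballc cy.
  exact: (Ck_cont (Ck_volume_density (local_metric_chart hg hc)) cy).
have [|y By ymax] := @compact_EVT_max _ R _ B _ compactB crho.
  by exists x0; rewrite /B /= subrr normr0 ltW.
set f := (fun x => _).
have mB : measurable (B : set (borel 'rV[R]_n)).
  by apply: borel_closed; exact: compact_closed (@norm_hausdorff _ _) compactB.
have Bf : (lam (B : set (borel 'rV[R]_n)) < +oo)%E.
  apply: (le_lt_trans _ (euclidean_ball hlam (`|x0| + r))).
  apply: le_measure; rewrite ?inE//; first exact: measurable_norm_ball.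
  move=> x xB /=; rewrite -(subrK x0 x) addrC.
  by apply: le_trans (ler_normD _ _) _; rewrite lerD2l.
pose h (x : borel 'rV[R]_n) : R := (chart_density g c \_ B) x.
have E : f = EFin \o h.
  apply/funext => x; rewrite /f /h /= /chart_density !patchE.
  have [cx|cx] := pselect (chart_image c x); last first.
    by rewrite memNset// mulr0; case: ifP.
  rewrite (mem_set cx); congr (_%:E); have [xB|xB] := pselect (B x).
    by rewrite (mem_set xB) indicE mem_set ?mul1r//; exists x.
  rewrite (memNset xB) indicE memNset ?mul0r//.
  by have [dx xE] := chart_imageP cx => /(chart_ballP dx).1; rewrite xE.
have ih : lam.-integrable setT (EFin \o h).
  apply: (@integrable_bounded_support _ (borel 'rV[R]_n) R lam B h (volume_density (metric_in g c) y)) => //.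
  - have [H _] := measurable_restrictT (chart_density g c) mB; apply: H.
    by apply: measurable_funTS; exact: (measurable_chart_density hg hc).
  - move=> x; rewrite /h /chart_density !patchE; case: ifPn => [|_]; last first.
      by rewrite normr0; exact: sqrtr_ge0.
    move=> xB; case: ifPn => [_|_]; last by rewrite normr0; exact: sqrtr_ge0.
    by rewrite ger0_norm ?sqrtr_ge0//; exact: ymax.
  - by move=> x xB; rewrite /h patchE memNset.
have := integral_fune_lt_pinfty measurableT ih.
by rewrite E.
Qed.

Hypotheses (hw : Ck_function A 1 w) (hu : C2_function A u) (u0 : forall p, 0 < u p).

Let v p : R := chart_bump p * w p.

Let hv : Ck_function A 1 v.
Proof. exact: Ck_functionM Ck_chart_bump hw. Qed.

Let hu1 : Ck_function A 1 u.
Proof. by move=> d hd; exact: Ck_pred (hu hd). Qed.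

Lemma green_chart : (\int[mu]_p (v p * laplacian_on A g u p + grad_on A g v u p)%:E = 0)%E.
Proof.
rewrite (chart_integral hlam hg hmu hc).
- rewrite -[RHS](local_green hlam (local_metric_chart hg hc) ballc (hv hc) (hu hc)).
    apply: eq_integral => x _; rewrite /chart_density !patchE.
    case: ifPn => [|_]; last by rewrite !mulr0.
    rewrite inE => cx; have [dx xE] := chart_imageP cx.
    by rewrite (laplacian_on_chart n3 hg hu u0 hc dx) (grad_on_chart hg hv hu1 hc dx) xE.
  move=> y cy ry; rewrite /= /v chart_bump_support ?mul0r//.
  have [dy yE] := chart_imageP cy.
  by move=> /(chart_ballP dy).1; rewrite yE leNgt ry.
- apply: continuous_borel => p; apply: cvgD; last exact: (grad_on_continuous hg hv hu1).
  apply: cvgM; last exact: (laplacian_on_continuous hg hu u0).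
  by apply: (@Ck_function_continuous _ _ _ A); exact: Ck_functionW.
(* Off the chart domain the bump vanishes on an open set around the point, so its gradient vanishes
   as well. *)
- move=> p cp; have pK : ~ chart_ball p by move=> /chart_ball_dom.
  rewrite /v chart_bump_support// !mul0r add0r.
  apply: (grad_on0 A g u (closed_openC chart_ball_closed) pK) => q; rewrite inE => qK.
  by rewrite chart_bump_support// mul0r.
Qed.

End ChartGreen.
End ChartBall.

(** * Patching over a finite cover *)

Section Compact.
Context {R : realType} {n : nat} {M : ptopologicalType} (A : smooth_atlas R n M).
Hypotheses (hM : hausdorff_space M) (cM : compact [set: M]).

Lemma bump_radius_exists p : exists r : R, 0 < r /\
  forall y : 'rV[R]_n, `|y - coord (chart_at A p) p| <= r -> chart_image (chart_at A p) y.
Proof.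
set c := chart_at A p; have cp : dom c p := chart_at_dom A p.
have /nbhs_ballP[e /= e0 he] : nbhs (coord c p) (chart_image c).
  by apply: open_nbhs_nbhs; split; [exact: img_open|exact: chart_image_coord].
(* Half the radius turns an open ball inside the image into a closed one. *)
exists (e / 2); split; first by rewrite divr_gt0.
move=> y ye; apply: he; rewrite -ball_normE /= distrC; apply: le_lt_trans ye _.
by rewrite ltr_pdivrMr// ltr_pMr// ltr1n.
Qed.

Definition bump_radius p : R := sval (cid (bump_radius_exists p)).

Lemma bump_radius_gt0 p : 0 < bump_radius p.
Proof. by rewrite /bump_radius; case: cid => r []. Qed.

Lemma bump_radius_ball p (y : 'rV[R]_n) :
  `|y - coord (chart_at A p) p| <= bump_radius p -> chart_image (chart_at A p) y.
Proof. by rewrite /bump_radius; case: cid => r [_] h /= /h. Qed.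

Definition bump_at q : M -> R :=
  chart_bump (chart_at A q) (coord (chart_at A q) q) (bump_radius q).

Lemma Ck_bump_at q : Ck_function A 1 (bump_at q).
Proof. exact: (Ck_chart_bump hM (chart_at_charts A q) (bump_radius_gt0 q) (@bump_radius_ball q)). Qed.

Lemma bump_at_ge0 q p : 0 <= bump_at q p.
Proof. exact: chart_bump_ge0. Qed.

Lemma bump_cover : exists s : seq M, forall p, exists2 q, q \in s & 0 < bump_at q p.
Proof.
have : cover_compact [set: M] by rewrite -compact_cover.
move=> /(_ _ [set: M] (fun q => [set p | 0 < bump_at q p])) [||D _ cov].
- move=> q _; rewrite (_ : [set p | _] = bump_at q @^-1` [set t | 0 < t])//.
  apply: open_comp; last exact: open_gt.
  by move=> p _; apply: (@Ck_function_continuous _ _ _ A); exact: Ck_functionW (Ck_bump_at q).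
- move=> p _; exists p => //=; apply: chart_bump_center => //.
  exact: chart_at_dom.
by exists (finmap.enum_fset D) => p; have [q qD hq] := cov p I; exists q.
Qed.

Variables (lam : {sigma_finite_measure set (borel 'rV[R]_n) -> \bar R}).
Variables (g : tensor_field R n M) (mu : {measure set (borel M) -> \bar R}).
Hypotheses (n3 : (3 <= n)%N) (hlam : euclidean_measure lam).
Hypotheses (hg : C2_metric A g) (hmu : is_riemannian_volume A g mu).

Lemma riemannian_volume_finite : (mu setT < +oo)%E.
Proof.
have [s hs] := bump_cover.
pose K q : set (borel M) := chart_ball (chart_at A q) (coord (chart_at A q) q) (bump_radius q).
have mK q : measurable (K q).
  by apply: borel_closed; exact: (chart_ball_closed hM (@bump_radius_ball q)).
have Kfin q : (mu (K q) < +oo)%E.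
  exact: (chart_ball_finite hM (chart_at_charts A q) (bump_radius_gt0 q) (@bump_radius_ball q)
    hlam hg hmu).
have mU (t : seq M) : measurable (\big[setU/set0]_(q <- t) K q).
  by apply: bigsetU_measurable.
have Ufin (t : seq M) : (mu (\big[setU/set0]_(q <- t) K q) < +oo)%E.
  elim: t => [|q t IH]; first by rewrite big_nil measure0.
  rewrite big_cons; apply: le_lt_trans (measureU2 mu (mK q) (mU t)) _.
  exact: lte_add_pinfty (Kfin q) IH.
rewrite (_ : setT = \big[setU/set0]_(q <- s) K q)//; apply/seteqP; split=> // p _.
have [q qs qp] := hs p; rewrite -bigcup_seq; exists q => //.
apply: contrapT => pK; move: qp; rewrite /bump_at.
by rewrite (chart_bump_support (bump_radius_gt0 q) (@bump_radius_ball q) pK) ltxx.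
Qed.

Lemma continuous_bounded (f : M -> R) : continuous f -> exists B : R, forall p, `|f p| <= B.
Proof.
move=> cf; have [||c _ hc] := @compact_EVT_max _ R (fun x => `|f x|) [set: M] _ cM.
- by exists point.
- by apply: continuous_subspaceT => x; apply: continuous_comp; [exact: cf|exact: norm_continuous].
by exists `|f c| => p; apply: hc; rewrite inE.
Qed.

Lemma integrable_continuous (f : M -> R) : continuous f ->
  mu.-integrable setT (EFin \o f : borel M -> \bar R).
Proof.
move=> cf; have [B fB] := continuous_bounded cf.
apply: (@integrable_bounded_support _ (borel M) R mu setT f B) => //.
- exact: riemannian_volume_finite.
- exact: continuous_borel.
- by move=> p np; case: np.
Qed.

Section Green.
Variables v u : M -> R.
Hypotheses (hv : Ck_function A 1 v) (hu : C2_function A u) (u0 : forall p, 0 < u p).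

Let hu1 : Ck_function A 1 u.
Proof. by move=> c hc; exact: Ck_pred (hu hc). Qed.

Let D (f : M -> R) p := f p * laplacian_on A g u p + grad_on A g f u p.

Let D_continuous f : Ck_function A 1 f -> continuous (D f).
Proof.
move=> hf p; apply: cvgD; last exact: (grad_on_continuous hg hf hu1).
apply: cvgM; last exact: (laplacian_on_continuous hg hu u0).
by apply: (@Ck_function_continuous _ _ _ A); exact: Ck_functionW.
Qed.

(** Dividing by the positive sum [S] of the bumps of a finite cover writes [v] as a sum of terms
    [bump_at q p * w p], each supported in one chart, where [green_chart] applies. *)
Theorem green : (\int[mu]_p (v p * laplacian_on A g u p + grad_on A g v u p)%:E = 0)%E.
Proof.
have [s hs] := bump_cover.
pose S p := \sum_(q <- s) bump_at q p.
have S0 p : 0 < S p.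
  have [q qs qp] := hs p; rewrite /S (big_rem q)//=.
  by apply: ltr_pwDl => //; apply: sumr_ge0 => r _; exact: bump_at_ge0.
have hS : Ck_function A 1 S.
  move=> c hc; apply: (@Ck_sum _ _ 1 (chart_image c) _ s (fun q => bump_at q \o param c)).
    exact: img_open.
  by move=> q; exact: (Ck_bump_at q hc).
pose w p := v p * (S p)^-1.
have hw : Ck_function A 1 w := Ck_functionM hv (Ck_functionV S0 hS).
pose V (t : seq M) p := \sum_(q <- t) bump_at q p * w p.
have hV t : Ck_function A 1 (V t).
  move=> c hc.
  apply: (@Ck_sum _ _ 1 (chart_image c) _ t (fun q => (fun p => bump_at q p * w p) \o param c)).
    exact: img_open.
  by move=> q; exact: (Ck_functionM (Ck_bump_at q) hw hc).
(* Stated for every list, with partial sums [V t] of [v], so that induction on the list is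
   possible. *)
suff H t : (\int[mu]_p (D (V t) p)%:E = 0)%E.
  rewrite -[RHS](H s); apply: eq_integral => p _; congr (_%:E).
  suff -> : v = V s by [].
  by apply/funext => q; rewrite /V -mulr_suml -/(S q) mulrC mulfVK ?gt_eqF.
elim: t => [|q t IH].
  apply: integral0_eq => p _; rewrite /D.
  have V0 : {in [set: M], V [::] =1 cst 0} by move=> r _; rewrite /V big_nil.
  by rewrite (grad_on0 A g u openT (I : setT p) V0) V0 ?inE// mul0r addr0.
pose b p := bump_at q p * w p.
have hb : Ck_function A 1 b := Ck_functionM (Ck_bump_at q) hw.
have E p : D (V (q :: t)) p = D b p + D (V t) p.
  have -> : V (q :: t) = fun p => b p + V t p by apply/funext => r; rewrite /V big_cons.
  by rewrite /D (grad_onD g hb (hV t) p hu1) mulrDl addrACA.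
transitivity (\int[mu]_p ((D b p)%:E + (D (V t) p)%:E))%E.
  by apply: eq_integral => p _; rewrite E.
rewrite integralD//; last 2 first.
- exact: (integrable_continuous (D_continuous hb)).
- exact: (integrable_continuous (D_continuous (hV t))).
rewrite IH adde0.
exact: (green_chart hM (chart_at_charts A q) (bump_radius_gt0 q) (@bump_radius_ball q)
    n3 hlam hg hmu hw hu u0).
Qed.

End Green.
End Compact.

(** * Total scalar curvature *)

Section RiemannianVolume.
Context {R : realType} {n : nat} {M : ptopologicalType} (A : smooth_atlas R n M).
Implicit Types (g : tensor_field R n M) (u : M -> R).
Hypotheses (n3 : (3 <= n)%N) (cM : compact [set: M]).

Definition has_volume g := exists mu, is_riemannian_volume A g mu.

Lemma riemannian_volumeP g : has_volume g -> is_riemannian_volume A g (riemannian_volume A g).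
Proof. by rewrite /riemannian_volume; case: pselect => // e _; case: cid. Qed.

Lemma riemannian_volume0 g (f : borel M -> \bar R) : ~ has_volume g ->
  (\int[riemannian_volume A g]_p f p = 0)%E.
Proof.
by rewrite /riemannian_volume; case: pselect => // _ _; exact: integral_measure_zero.
Qed.

Lemma conformalV u g : (forall p, 0 < u p) -> conformal (fun p => (u p)^-1) (conformal u g) = g.
Proof.
move=> u0; apply/funext => c; apply/funext => p; rewrite /conformal scalerA.
by rewrite -powRM ?invr_ge0 ?ltW// mulVf ?gt_eqF// powR1 scale1r.
Qed.

Lemma has_volume_conformal u g : C2_function A u -> (forall p, 0 < u p) -> C2_metric A g ->
  has_volume g -> has_volume (conformal u g).
Proof.
move=> hu u0 hg [mu hmu]; have [lam hlam] := @euclidean_measure_exists R n.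
exact: (ex_intro _ _ (conformal_volume hlam n3 hg hmu hu u0)).
Qed.

(** A conformal change by [u] is undone by one with the factor 1 / u, see [conformalV]. *)
Lemma has_volume_conformalE u g : C2_function A u -> (forall p, 0 < u p) -> C2_metric A g ->
  has_volume (conformal u g) -> has_volume g.
Proof.
move=> hu u0 hg h.
have v0 p : 0 < (u p)^-1 by rewrite invr_gt0.
have hv : C2_function A (fun p => (u p)^-1) := Ck_functionV u0 hu.
have := has_volume_conformal hv v0 (conformal_C2_metric hu u0 hg) h.
by rewrite (conformalV g u0).
Qed.

(** [riemannian_volume] is a chosen measure; [riemannian_volume_unique] identifies it with the
    explicit one of [conformal_volume]. *)
Lemma integral_conformal_volume u g (f : borel M -> R) : C2_function A u ->
  (forall p, 0 < u p) -> C2_metric A g -> has_volume g -> measurable_fun setT f ->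
  (\int[riemannian_volume A (conformal u g)]_p (f p)%:E =
   \int[riemannian_volume A g]_p (f p * volume_factor (n := n) u p)%:E)%E.
Proof.
move=> hu u0 hg hv mf; have [lam hlam] := @euclidean_measure_exists R n.
have hmu := riemannian_volumeP hv.
have hnu := riemannian_volumeP (has_volume_conformal hu u0 hg hv).
have hd := conformal_volume hlam n3 hg hmu hu u0.
rewrite -(integral_density_real (riemannian_volume A g)
  (measurable_volume_factor hu u0) (volume_factor_ge0 u) mf).
apply: eq_measure_integral => B mB _.
exact: (riemannian_volume_unique cM hnu hd mB).
Qed.

End RiemannianVolume.

(** * The pointwise energy inequality *)

Section Energy.
Context {R : realType} {n : nat} {M : ptopologicalType} (A : smooth_atlas R n M).
Variable g : tensor_field R n M.
Hypotheses (n3 : (3 <= n)%N) (hg : C2_metric A g).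

Let quadratic_formB (I : 'M[R]_n) (X Y : 'cV[R]_n) : ((X - Y)^T *m I *m (X - Y)) 0 0 =
  (X^T *m I *m X) 0 0 - (X^T *m I *m Y) 0 0 - (Y^T *m I *m X) 0 0 + (Y^T *m I *m Y) 0 0.
Proof.
have -> : (X - Y)^T = X^T - Y^T by apply/matrixP => i j; rewrite !mxE.
have B (U V : 'M[R]_1) : (U - V) 0 0 = U 0 0 - V 0 0 by rewrite !mxE.
by rewrite mulmxBl mulmxBl !mulmxBr !B opprB addrA addrAC.
Qed.

(** The three terms are |grad f - grad h|^2 written out. Definiteness is known for the metric and
    not for its inverse, so the index of the difference is raised first ([W]). *)
Lemma grad_on_sub_ge0 f h p : 0 <= grad_on A g f f p - 2 * grad_on A g f h p + grad_on A g h h p.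
Proof.
rewrite /grad_on; set c := chart_at A p; have cp : dom c p := chart_at_dom A p.
have hc : charts A c := chart_at_charts A p.
have hl := local_metric_chart hg hc; have cx := chart_image_coord cp.
set x := coord c p in cx *; set G := metric_in g c.
have C := @grad_pairingC _ _ _ _ hl (h \o param c) (f \o param c) x cx.
set X := gradient (f \o param c) x; set Y := gradient (h \o param c) x.
have -> : grad_pairing G (f \o param c) (f \o param c) x
    - 2 * grad_pairing G (f \o param c) (h \o param c) x
    + grad_pairing G (h \o param c) (h \o param c) x =
    (((X - Y)^T *m invmx (G x)) *m (X - Y)) 0 0.
  by rewrite quadratic_formB mulr_natl mulr2n -{2}C !grad_pairingE opprD addrA.
set Z := X - Y; have uG := local_metric_unit hl cx.
have [->|Z0] := eqVneq Z 0; first by rewrite mulmx0 mxE.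
pose W := Z^T *m invmx (G x).
have W0 : W != 0.
  apply: contra Z0 => /eqP W0; rewrite -(trmxK Z) -(mulmxKV uG Z^T) -/W W0.
  by rewrite mul0mx trmx0.
have -> : (Z^T *m invmx (G x) *m Z) 0 0 = (W *m G x *m W^T) 0 0.
  by rewrite /W mulmxKV// trmx_mul trmxK trmx_inv (local_metric_sym hl cx) mulmxA.
by apply/ltW; have := metric_pos hg hc cp W0; rewrite -{1}(coordK cp).
Qed.

(* With a, b for the two functions, la, lb for their Laplacians and gaa, gab, gbb
   for the pairings of their gradients: the derivatives of a only occur in
   divergences and in the nonnegative |grad (a - b)|^2. *)
Lemma energy_gap (c r a b la lb gaa gab gbb Ba Bb Br Bl : R) : 0 < c ->
  `|r| <= Br -> `|lb| <= Bl -> `|a| <= Ba -> `|b| <= Bb -> 0 <= gaa - 2 * gab + gbb ->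
  r * (b * b) - c * (b * lb) <= r * (a * a) - c * (a * la) +
    (c * (a * la + gaa) + - 2 * c * (a * lb + gab) + c * (b * lb + gbb))
    + (Br * (Ba + Bb) + 2 * c * Bl) * `|a - b|.
Proof.
move=> c0 hr hl hA hB hg'.
have h1 : `|r * (a + b) * (a - b)| <= Br * (Ba + Bb) * `|a - b|.
  rewrite normrM ler_wpM2r// normrM ler_pM//.
  by apply: le_trans (ler_normD _ _) _; exact: lerD.
have h2 : `|lb * (a - b)| <= Bl * `|a - b| by rewrite normrM ler_wpM2r.
have h3 : 0 <= c * (Bl * `|a - b| - lb * (a - b)).
  by rewrite mulr_ge0 ?(ltW c0)// subr_ge0; exact: le_trans (ler_norm _) h2.
have h4 : 0 <= c * (gaa - 2 * gab + gbb) by rewrite mulr_ge0 ?(ltW c0).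
move: h1; rewrite ler_norml => /andP[h1 _].
by move: `|a - b| h1 h3 h4 => T h1 h3 h4; lra.
Qed.

(** With the Laplacian defined through conformal covariance this is algebra: 2 n / (n - 2) = 4 / (n
    - 2) + 2 splits the volume factor into the conformal factor times u^2. *)
Lemma scalar_curvature_energy u p : 0 < u p ->
  scalar_curvature A (conformal u g) p * volume_factor (n := n) u p =
  scalar_curvature A g p * (u p * u p) - yamabe_constant n * (u p * laplacian_on A g u p).
Proof.
move=> u0; rewrite /laplacian_on /volume_factor [u p * (_ * _)]mulrCA mulVKf; last first.
  by rewrite gt_eqF// yamabe_constant_gt0.
have n2 : (n%:R - 2 : R) != 0.
  by rewrite subr_eq0 (eqr_nat R n 2); move: n3; case: (n) => [|[|[|]]].
rewrite (_ : 2 * n%:R / (n%:R - 2) = 4 / (n%:R - 2) + 2); last by field.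
rewrite powRD; last by apply/implyP => _; rewrite gt_eqF.
have -> : u p `^ 2 = u p * u p by rewrite (powR_mulrn 2)// ?ltW.
by move: (_ `^ _) => a; move: (scalar_curvature A _ p) (scalar_curvature A _ p) => s s'; ring.
Qed.

End Energy.

Theorem theorem2 (R : realType) (n : nat) (hn : (3 <= n)%N)
  (M : ptopologicalType) (hM : hausdorff_space M) (cM : compact [set: M])
  (A : smooth_atlas R n M)
  (g0 : tensor_field R n M) (hg0 : C2_metric A g0)
  (u_ : nat -> M -> R) (u : M -> R)
  (hu_C2 : forall i, C2_function A (u_ i)) (hu_gt0 : forall i p, 0 < u_ i p)
  (huC2 : C2_function A u) (hu0 : forall p, 0 < u p)
  (C0 : R) (hC0 : 0 < C0)
  (ha : forall i p, C0^-1 <= u_ i p /\ u_ i p <= C0)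
  (hb : (fun i => \int[riemannian_volume A g0]_p (`|u_ i p - u p|%:E))%E
          @ \oo --> 0%E)
  (kappa : R) (hkappa : kappa <= 0)
  (hc : forall i,
    (\int[riemannian_volume A (conformal (u_ i) g0)]_p
        (scalar_curvature A (conformal (u_ i) g0) p)%:E <= kappa%:E)%E) :
  (\int[riemannian_volume A (conformal u g0)]_p
      (scalar_curvature A (conformal u g0) p)%:E <= kappa%:E)%E.
Proof.
have [hv|nv] := pselect (has_volume A g0); last first.
  (* All the volumes are then the junk measure mzero, and hc gives 0 <= kappa. *)
  rewrite riemannian_volume0; last by move/(has_volume_conformalE hn huC2 hu0 hg0).
  have := hc 0%N; rewrite riemannian_volume0//.
  by move/(has_volume_conformalE hn (hu_C2 0%N) (hu_gt0 0%N) hg0).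
have [lam hlam] := @euclidean_measure_exists R n.
pose mu := riemannian_volume A g0; have hmu : is_riemannian_volume A g0 mu := riemannian_volumeP hv.
have int f := integrable_continuous hM cM hlam hg0 hmu (f := f).
pose s (w : M -> R) p := scalar_curvature A g0 p * (w p * w p)
  - yamabe_constant n * (w p * laplacian_on A g0 w p).
have C2_cont w : C2_function A w -> continuous w.
  move=> hw; apply: (@Ck_function_continuous _ _ _ A) => c hcc.
  exact: (Ck_le (isT : (0 <= 2)%N) (hw c hcc)).
have C21 w : C2_function A w -> Ck_function A 1 w by move=> hw c hcc; exact: Ck_pred (hw c hcc).
have total w : C2_function A w -> (forall p, 0 < w p) ->
    (\int[riemannian_volume A (conformal w g0)]_p
      (scalar_curvature A (conformal w g0) p)%:E = \int[mu]_p (s w p)%:E)%E.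
  move=> hw w0; rewrite (integral_conformal_volume hn cM hw w0 hg0 hv); last first.
    apply: continuous_borel; exact: (scalar_curvature_continuous (conformal_C2_metric hw w0 hg0)).
  by apply: eq_integral => p _; rewrite (scalar_curvature_energy A g0 hn (w0 p)).
have cR := scalar_curvature_continuous hg0.
have cu := C2_cont u huC2.
have cL := laplacian_on_continuous (n := n) hg0 huC2 hu0.
have [BR hBR] := continuous_bounded cM cR.
have [Bu hBu] := continuous_bounded cM cu.
have [BL hBL] := continuous_bounded cM cL.
(* The constant of [energy_gap], with [C0], [Bu], [BR] and [BL] bounding [u_ i], [u], the scalar
   curvature of [g0] and the Laplacian of [u]. It is the same for all [i]. *)
pose K : R := BR * (C0 + Bu) + 2 * yamabe_constant n * BL.
have c0 : (0 : R) < yamabe_constant n := yamabe_constant_gt0 hn.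
(* The divergence of f grad h. *)
pose D f h p := f p * laplacian_on A g0 h p + grad_on A g0 f h p.
have green0 f h : C2_function A f -> C2_function A h -> (forall p, 0 < h p) ->
    (\int[mu]_p (D f h p)%:E = 0)%E.
  move=> hf hh h0; exact: (green hM cM hn hlam hg0 hmu (C21 f hf) hh h0).
have contD f h : C2_function A f -> C2_function A h -> (forall p, 0 < h p) -> continuous (D f h).
  move=> hf hh h0 p; apply: cvgD; last exact: (grad_on_continuous hg0 (C21 f hf) (C21 h hh)).
  by apply: cvgM; [exact: C2_cont|exact: (laplacian_on_continuous hg0 hh h0)].
have conts w : C2_function A w -> (forall p, 0 < w p) -> continuous (s w).
  move=> hw w0 p; have cw := C2_cont w hw.
  apply: cvgB; apply: cvgM; [exact: cR|by apply: cvgM; exact: cw|exact: cvg_cst|].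
  by apply: cvgM; [exact: cw|exact: (laplacian_on_continuous hg0 hw w0)].
have contDD (f h : M -> R) : continuous f -> continuous h -> continuous (fun p => f p + h p).
  by move=> cf ch p; apply: cvgD; [exact: cf|exact: ch].
have contZ (a : R) (f : M -> R) : continuous f -> continuous (fun p => a * f p).
  by move=> cf p; apply: cvgM; [exact: cvg_cst|exact: cf].
have intD (f h : M -> R) : continuous f -> continuous h ->
    (\int[mu]_p (f p + h p)%:E = \int[mu]_p (f p)%:E + \int[mu]_p (h p)%:E)%E.
  by move=> cf ch; rewrite -(integralD _ (int f cf) (int h ch)).
have intZ (a : R) (f : M -> R) : continuous f ->
    (\int[mu]_p (a * f p)%:E = a%:E * \int[mu]_p (f p)%:E)%E.
  by move=> cf; rewrite -(integralZl _ (int f cf)).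
have key i : (\int[mu]_p (s u p)%:E <=
    \int[mu]_p (s (u_ i) p)%:E + K%:E * \int[mu]_p (`|u_ i p - u p|)%:E)%E.
  set w := u_ i; have hw := hu_C2 i; have w0 := hu_gt0 i; have cw := C2_cont _ hw.
  set c : R := yamabe_constant n in c0 K s total conts *.
  have cwu : continuous (fun p => `|w p - u p|).
    move=> p; apply: (@cvg_norm _ R); apply: cvgB; [exact: cw|exact: cu].
  have c1 := contZ c _ (contD w w hw hw w0).
  have c2 := contZ (- 2 * c) _ (contD w u hw huC2 hu0).
  have c3 := contZ c _ (contD u u huC2 huC2 hu0).
  have c4 := contZ K _ cwu; have c5 := contDD _ _ (contDD _ _ c1 c2) c3.
  (* The right-hand side of [energy_gap] at a point; its three divergences are integrated to 0 by
     [green0]. *)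
  pose r p := s w p + (c * D w w p + - 2 * c * D w u p + c * D u u p) + K * `|w p - u p|.
  have cr : continuous r := contDD _ _ (contDD _ _ (conts w hw w0) c5) c4.
  have Er : (\int[mu]_p (r p)%:E =
      \int[mu]_p (s w p)%:E + K%:E * \int[mu]_p (`|w p - u p|)%:E)%E.
    rewrite (intD _ _ (contDD _ _ (conts w hw w0) c5) c4) (intD _ _ (conts w hw w0) c5).
    rewrite (intD _ _ (contDD _ _ c1 c2) c3) (intD _ _ c1 c2).
    rewrite !intZ; [|exact: cwu|exact: contD|exact: contD|exact: contD].
    by rewrite !green0// !mule0 !adde0.
  rewrite -Er; apply: (le_integral measurableT (int _ (conts u huC2 hu0)) (int _ cr)) => p _.
  rewrite lee_fin /r /s /D -/c; have [_ wC0] := ha i p.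
  have wC : `|w p| <= C0 by rewrite gtr0_norm.
  have E := energy_gap (laplacian_on A g0 w p) c0 (hBR p) (hBL p) wC (hBu p) (grad_on_sub_ge0 hg0 w u p).
  exact: E.
rewrite (total u huC2 hu0); set I := (\int[mu]_p _)%E.
have bound i : (I <= kappa%:E + K%:E * \int[mu]_p (`|u_ i p - u p|)%:E)%E.
  have E := hc i; rewrite (total _ (hu_C2 i) (hu_gt0 i)) in E.
  exact: (le_trans (key i) (leeD E (lexx _))).
(* The L^1 convergence enters here, multiplied by the fixed constant [K]. *)
have lim : (fun i => kappa%:E + K%:E * \int[mu]_p (`|u_ i p - u p|)%:E)%E @ \oo --> kappa%:E.
  rewrite -[X in _ --> X]adde0 -[X in (_ + X)%E](mule0 K%:E).
  apply: cvgeD; [by rewrite mule0|exact: cvg_cst|].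
  by apply: cvgeZl => //; exact: hb.
by apply: (cvge_ge _ lim); near=> i; exact: bound.
Unshelve. all: by end_near. Qed.
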